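(* Let $U=\{s\in\mathbb{C}:\alpha<\operatorname{Re}s<\beta\}$ with $-\infty\le\alpha<\beta\le\infty$, and let $f\in B(U,\mathbb{C})$. Then $f$ is in $AP(U,\mathbb{C})$ if and only if the closure of its set of vertical translates $\{f(s+i\tau):\tau\in\mathbb{R}\}$, in the topology of uniform convergence on every reduced strip of $U$, is compact and coincides with a certain equivalence class of $\mathcal{D}_{\Lambda}$ with respect to $\overset{*}{\sim}$, for some set $\Lambda$ of exponents.
   Context: A set of exponents is a countable set $\Lambda=\{\lambda_1,\lambda_2,\ldots\}$ of distinct real numbers. A reduced strip of $U$ is a set $\{s=\sigma+it:\sigma_1\le\sigma\le\sigma_2\}$ with $\alpha<\sigma_1<\sigma_2<\beta$. $AP(U,\mathbb{C})$ is the space of almost periodic functions in $U$: analytic $f:U\to\mathbb{C}$ such that for every $\varepsilon>0$ and every reduced strip $U_1$ of $U$ there is $l>0$ such that each interval of length $l$ contains a $\tau$ with $|f(s+i\tau)-f(s)|\le\varepsilon$ for all $s\in U_1$. $B(\mathbb{R},\mathbb{C})$ is the Besicovitch space, obtained by completing the trigonometric polynomials with respect to the seminorm $\limsup_{l\to\infty}\frac{1}{2l}\int_{-l}^{l}|f(t)|\,dt$; each of its elements has a Fourier series $\sum_j a_je^{i\lambda_jt}$ with coefficients $\lim_{l\to\infty}\frac{1}{2l}\int_{-l}^{l}f(t)e^{-i\lambda t}\,dt$. $B(U,\mathbb{C})\supset AP(U,\mathbb{C})$ is the set of functions $f:U\to\mathbb{C}$ such that $t\mapsto f(\sigma_0+it)$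 is in $B(\mathbb{R},\mathbb{C})$ for every $\sigma_0\in(\alpha,\beta)$ and for which there is an exponential sum $\sum_{j\ge1}a_je^{\lambda_js}$ with real $\lambda_j$ (the Dirichlet series of $f$) such that for every $\sigma_0\in(\alpha,\beta)$ the Fourier series of $t\mapsto f(\sigma_0+it)$ is $\sum_{j\ge1}a_je^{\lambda_j\sigma_0}e^{i\lambda_jt}$. An element of $B(U,\mathbb{C})$ stands for a whole class of functions modulo the relation: $f\simeq g$ iff $\limsup_{l\to\infty}\frac1{2l}\int_{-l}^{l}|f(\sigma_0+it)-g(\sigma_0+it)|\,dt=0$ for every $\sigma_0\in(\alpha,\beta)$; $f$ is in $AP(U,\mathbb{C})$ means that the class contains a (necessarily unique) function of $AP(U,\mathbb{C})$, with which it is identified. Uniform convergence on reduced strips is measured, for each reduced strip $U_1$, by the infimum of $\sup_{s\in U_1}|f(s)-g(s)|$ over representatives $f,g$. $\mathcal{D}_{\Lambda}$ is the set of $f\in AP(U,\mathbb{C})$ whose Dirichlet series has the form $\sum_{j\ge1}a_je^{\lambda_js}$ with $a_j\in\mathbb{C}$, $\lambda_j\in\Lambda$. Equivalence: two functions in $\mathcal{D}_{\Lambda}$ with Dirichlet series $\sum_{j\ge1}a_je^{\lambda_js}$ and $\sum_{j\ge1}b_je^{\lambda_js}$ are equivalent (written $\overset{*}{\sim}$) if for each integer $n$ with $1\le n\le\sharp\Lambda$ there exists a $\mathbb{Q}$-linear map $\psi_n:V_n\to\mathbb{R}$, where $V_n\subset\mathbb{R}$ is the $\mathbb{Q}$-vector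 space generated by $\{\lambda_1,\ldots,\lambda_n\}$, such that $b_j=a_je^{i\psi_n(\lambda_j)}$ for $j=1,\ldots,n$. *)

(* Defs.v *)
From HB Require Import structures.
From mathcomp Require Import all_boot all_order all_algebra.
From mathcomp Require Import all_classical all_reals all_analysis.
From mathcomp Require Export complex.
From mathcomp Require Import ring lra.

Set Implicit Arguments.
Unset Strict Implicit.
Unset Printing Implicit Defensive.

Import Order.TTheory GRing.Theory Num.Theory.
Import numFieldNormedType.Exports.

Local Open Scope classical_set_scope.
Local Open Scope ring_scope.
Local Open Scope complex_scope.

(* [normc] is the real-valued modulus, whereas [`|z|] on [R[i]] is the modulus
   embedded in [R[i]]. *)
Notation normc := ComplexField.Normc.normc.

Section BesicovitchLine.
Context {R : realType}.
Notation C := R[i].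
Notation mu := (@lebesgue_measure R).
Implicit Types (f g h : R -> C) (x lambda : R).

Definition expi x : C := cos x +i* sin x.

Definition trig_poly h := exists (n : nat) (c : 'I_n -> C) (m : 'I_n -> R),
  h = fun t => \sum_(k < n) c k * expi (m k * t).

Definition mean_seminorm h : \bar R :=
  limf_esup (fun l : R => (((2 * l)^-1)%:E
     * \int[mu]_(t in `[(- l)%R, l]) (normc (h t))%:E)%E) +oo%R.

(* The completion of the trigonometric polynomials for [mean_seminorm] is
   realized inside the locally integrable functions, as the closure of the
   trigonometric polynomials; its elements are functions here, and the
   passage to classes is made in [Bspace] below. *)
Definition besicovitch h :=
  [/\ locally_integrable setT (fun t => complex.Re (h t)),
      locally_integrable setT (fun t => complex.Im (h t)) &
      forall eps : R, 0 < eps -> exists2 p, trig_poly p &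
        (mean_seminorm (fun t => h t - p t)%R < eps%:E)%E].

Definition cintegral (a b : R) h : C :=
  (\int[mu]_(t in `[a, b]) complex.Re (h t)) +i*
  (\int[mu]_(t in `[a, b]) complex.Im (h t)).

Definition has_fourier_coef h lambda (c : C) :=
  ((2 * l)^-1)%:C * cintegral (- l) l (fun t => h t * expi (- (lambda * t)))
    @[l --> +oo%R] --> (c : C^o).

End BesicovitchLine.

(* A finite or infinite enumeration lambda_0, lambda_1, ... of distinct reals:
   [exponent L j] is meaningful for [j] less than the cardinality, [None]
   standing for a countably infinite set. *)
Record exponents (R : realType) := Exponents {
  card_exponents : option nat;
  exponent :> nat -> R;
  exponent_inj : forall j k : nat,
    (if card_exponents is Some N then (j < N)%N && (k < N)%N else true) ->
    exponent j = exponent k -> j = k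
}.

Definition le_card {R : realType} (n : nat) (L : exponents R) :=
  if card_exponents L is Some N then (n <= N)%N else true.

Section Strip.
Context {R : realType}.
Notation C := R[i].
Variables alpha beta : \bar R.
Implicit Types (f g h : C -> C) (L : exponents R).

Definition in_dom (sigma : R) := (alpha < sigma%:E)%E /\ (sigma%:E < beta)%E.

Definition reduced (s1 s2 : R) :=
  [/\ (alpha < s1%:E)%E, s1 < s2 & (s2%:E < beta)%E].

Definition strip (s1 s2 : R) : set C :=
  [set s | s1 <= complex.Re s <= s2].

(* A function on the open strip U is represented by a function on all of [C]
   whose values outside U are irrelevant. *)
Definition vline f (sigma : R) : R -> C := fun t => f (sigma +i* t).

Definition vtranslate (tau : R) f : C -> C := fun s => f (s + tau *i).

Definition holomorphic_on_U f :=
  forall s : C, in_dom (complex.Re s) -> derivable (f : C^o -> C^o) s 1.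

Definition almost_periodic f := holomorphic_on_U f /\
  forall (eps s1 s2 : R), 0 < eps -> reduced s1 s2 ->
    exists2 l : R, 0 < l & forall x : R,
      exists2 tau : R, x <= tau <= x + l &
        forall s, strip s1 s2 s -> normc (vtranslate tau f s - f s) <= eps.

(* The Dirichlet series of [f] is \sum_j a_j e^{lambda_j s}, the lambda_j being
   enumerated by [L].  The series is formal: a Fourier series is the family of
   its coefficients, which vanish at the frequencies not listed. *)
Definition dirichlet_series L (a : nat -> C) f :=
  forall sigma : R, in_dom sigma ->
    (forall j : nat, le_card j.+1 L ->
       has_fourier_coef (vline f sigma) (L j)
         (a j * (expR (L j * sigma))%:C)) /\
    (forall lambda : R, (forall j : nat, le_card j.+1 L -> L j != lambda) ->
       has_fourier_coef (vline f sigma) lambda 0).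

Definition besicovitch_on_U f :=
  (forall sigma : R, in_dom sigma -> besicovitch (vline f sigma)) /\
  exists L a, dirichlet_series L a f.

Definition Beq f g := forall sigma : R, in_dom sigma ->
  mean_seminorm (fun t => vline f sigma t - vline g sigma t) = 0%E.

Definition is_Bclass (A : set (C -> C)) :=
  exists2 f, besicovitch_on_U f & A = [set g | besicovitch_on_U g /\ Beq f g].

Definition strip_dist (s1 s2 : R) (A B : set (C -> C)) : \bar R :=
  ereal_inf [set ereal_sup [set (normc (fg.1 s - fg.2 s))%:E | s in strip s1 s2]
            | fg in A `*` B].

Definition DLambda L : set (C -> C) :=
  [set f | almost_periodic f /\ exists a, dirichlet_series L a f].

(* [Qspan L n] is V_n, and a map V_n -> R is represented by a map R -> R of
   which only the restriction to V_n matters. *)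
Definition Qspan L (n : nat) : set R :=
  [set x | exists q : 'I_n -> rat, x = \sum_(j < n) ratr (q j) * L j].

Definition Qlinear_on (V : set R) (psi : R -> R) :=
  (forall x y, V x -> V y -> psi (x + y) = psi x + psi y) /\
  (forall (q : rat) x, V x -> psi (ratr q * x) = ratr q * psi x).

Definition equivalent L f g := exists a b : nat -> C,
  [/\ dirichlet_series L a f, dirichlet_series L b g &
      forall n : nat, (1 <= n)%N -> le_card n L ->
        exists2 psi : R -> R, Qlinear_on (Qspan L n) psi &
          forall j : nat, (j < n)%N -> b j = a j * expi (psi (L j))].

Definition is_equiv_class L (S : set (C -> C)) :=
  exists2 f, DLambda L f & S = [set g | DLambda L g /\ equivalent L f g].

Lemma strip_dist_le (s1 s2 t1 t2 : R) A B : s1 <= t1 -> t2 <= s2 ->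
  (strip_dist t1 t2 A B <= strip_dist s1 s2 A B)%E.
Proof.
move=> s1t1 t2s2; apply: le_ereal_inf_tmp => _ [fg ABfg <-].
apply: ge_ereal_inf; exists (ereal_sup
  [set (normc (fg.1 s - fg.2 s))%:E | s in strip t1 t2]); first by exists fg.
apply: ereal_sup_le => _ [s /andP[t1s st2] <-]; exists s => //.
by rewrite /strip /= (le_trans s1t1)//= (le_trans st2).
Qed.

Lemma reduced_ex : (alpha < beta)%E -> exists s1 s2, reduced s1 s2.
Proof.
rewrite /reduced; case: alpha beta => [a| |] [b| |] //= ab.
- exists (a + (b - a) / 3), (a + (b - a) / 2).
  move: ab; rewrite !lte_fin => ab; split; lra.
- by exists (a + 1), (a + 2); split; rewrite ?ltry// ?lte_fin; lra.
- by exists (b - 2), (b - 1); split; rewrite ?ltNyr// ?lte_fin; lra.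
- by exists 0, 1; split; rewrite ?ltNyr ?ltry.
Qed.

End Strip.

(* B(U, C) for U = {alpha < Re s < beta}: its points are the classes. *)
Record Bspace (R : realType) (alpha beta : \bar R) (ab : (alpha < beta)%E) :=
  MkBspace {
    Bclass :> set (R[i] -> R[i]);
    BclassP : is_Bclass alpha beta Bclass
  }.

Section Topology.
Context {R : realType} (alpha beta : \bar R) (ab : (alpha < beta)%E).
Notation B := (Bspace ab).

HB.instance Definition _ := gen_eqMixin B.
HB.instance Definition _ := gen_choiceMixin B.

(* Topology of uniform convergence on every reduced strip.  The reduced strips
   are directed by inclusion, so balls for one strip at a time suffice. *)
Definition Bopen : set_system B :=
  [set O : set B | forall F : B, O F -> exists s1 s2 eps : R,
    [/\ reduced alpha beta s1 s2, 0 < eps &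
        forall G : B, (strip_dist s1 s2 F G < eps%:E)%E -> O G]].

Lemma BopenT : Bopen setT.
Proof. by move=> F _; have [s1 [s2 r]] := reduced_ex ab; exists s1, s2, 1. Qed.

Lemma BopenI : setI_closed Bopen.
Proof.
move=> O P oO oP F [/oO[s1 [s2 [e [[as1 s12 s2b] e0 OG]]]]].
move=> /oP[t1 [t2 [d [[at1 t12 t2b] d0 PG]]]].
exists (Num.min s1 t1), (Num.max s2 t2), (Num.min e d); split.
- split.
  + by rewrite /Num.min; case: ifP.
  + by rewrite lt_max !gt_min s12 t12.
  + by rewrite /Num.max; case: ifP.
- by rewrite lt_min e0.
- move=> G FG; split.
  + apply: OG; apply: le_lt_trans (lt_le_trans FG _).
      by apply: strip_dist_le; rewrite ?ge_min ?le_max lexx.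
    by rewrite lee_fin ge_min lexx.
  + apply: PG; apply: le_lt_trans (lt_le_trans FG _).
      by apply: strip_dist_le; rewrite ?ge_min ?le_max lexx orbT.
    by rewrite lee_fin ge_min lexx orbT.
Qed.

Lemma Bopen_bigU (I : Type) (O : I -> set B) :
  (forall i, Bopen (O i)) -> Bopen (\bigcup_i O i).
Proof.
move=> oO F [i _ /oO[s1 [s2 [e [r e0 OG]]]]].
by exists s1, s2, e; split => // G /OG; exists i.
Qed.

HB.instance Definition _ := isOpenTopological.Build B BopenT BopenI Bopen_bigU.

(* For a class, "being in AP(U, C)" means containing an almost periodic
   function. *)
Definition in_AP (F : B) := exists2 f, Bclass F f & almost_periodic alpha beta f.

Definition vtranslates (F : B) : set B :=
  [set G | exists tau f, Bclass F f /\ Bclass G (vtranslate tau f)].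

(* Identification of a set of functions with the set of their classes. *)
Definition classes_of (S : set (R[i] -> R[i])) : set B :=
  [set G | exists2 g, S g & Bclass G g].

End Topology.

(* Main.v *)
Require Import Defs.
From HB Require Import structures.
From mathcomp Require Import all_boot all_order all_algebra.
From mathcomp Require Import all_classical all_reals all_analysis.
From mathcomp Require Import measurable_realfun.
From mathcomp Require Import ring lra.

Set Implicit Arguments.
Unset Strict Implicit.
Unset Printing Implicit Defensive.

Import Order.TTheory GRing.Theory Num.Theory.
Import numFieldNormedType.Exports.

Local Open Scope classical_set_scope.
Local Open Scope ring_scope.
Local Open Scope complex_scope.

(** Only the direct implication has content: a class [F] is its own translate by
    [0], so it belongs to the closure of its translates, and every member of an
    equivalence class of [DLambda L] is almost periodic.

    Let [f] be an almost periodic function of the class [F], and let the hull of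
    [f] be the set of the functions that translates of [f] approximate uniformly
    on each reduced strip. The closure of the translates of [F] is the set of the
    classes of the functions of the hull.

    _Compactness._ Almost periodicity and uniform continuity in the vertical
    direction make the translates of [f] totally bounded for the supremum norm of
    each reduced strip. Hence a family of functions of the hull converges along
    any ultrafilter, uniformly on reduced strips, to a function of the hull
    ([hull_limit]). Ultrafilters replace the diagonal extraction of subsequences.
    The functions of the hull are almost periodic again
    ([hull_almost_periodic]): almost periods survive in the limit, and
    holomorphy survives by Weierstrass's theorem ([uniform_limit_cderiv]). The
    latter comes from the Cauchy estimate [|f'(c)| <= 2 M / rho], itself a
    consequence of Goursat's theorem for the rectangles of the logarithmic plane.
    It follows that the classes of the hull form a set that is both compact and
    closed ([compact_hull_classes], [closed_hull_classes]).

    _The hull is contained in the equivalence class of [f]._ Let [h] be the limit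
    of the translates of [f] along an ultrafilter. Along it the characters
    [lambda |-> expi (lambda * tau)] converge to a character [chi], and the
    coefficient of [h] at [lambda_j] is [a_j * chi(lambda_j)]. The group generated by
    [lambda_1, ..., lambda_n] is free on a rationally independent family
    ([integral_basis]). A rational-linear map that takes suitable arguments of
    [chi] as its values on this family is the required [psi_n]
    ([character_Qlinear]). Such a map gives [chi] at the [lambda_j] only, not on
    the whole rational span, where [chi] need not have a rational-linear argument.

    _The equivalence class of [f] is contained in the hull._ Let [g] be
    equivalent to [f]. Kronecker's theorem produces translations whose characters
    approach [expi (psi_n lambda_j)] for [j <= n], and compactness turns them into
    a function [h] of the hull with the same Dirichlet series as [g]
    ([equivalent_hull]). It remains to see that such [g] and [h] are in the same
    class. On a vertical line [u = h - g] is bounded, has zero Fourier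
    coefficients, and is close in the mean to trigonometric polynomials [p]. The
    mean of [|u|^2] equals that of [u * conj (u - p)], which is at most
    [sup |u|] times the mean of [|u - p|]; hence [u] has mean modulus zero
    ([zero_fourier_coef_null]). *)

(** * The modulus and the derivative of a complex function *)

Section Modulus.
Context {R : realType}.
Notation C := R[i].
Implicit Types (z w : C) (x y : R).

Lemma normcE z : `|z| = (normc z)%:C.
Proof. by case: z. Qed.

Lemma normc_ge0 z : 0 <= normc z.
Proof. by case: z => a b; exact: sqrtr_ge0. Qed.

Lemma normcD z w : normc (z + w) <= normc z + normc w.
Proof. exact: le_normcD. Qed.

Lemma normcM z w : normc (z * w) = normc z * normc w.
Proof. exact: ComplexField.Normc.normcM. Qed.

Lemma normc_opp z : normc (- z) = normc z.
Proof. exact: normcN. Qed.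

Lemma normcB z w : normc (z - w) = normc (w - z).
Proof. by rewrite -normc_opp opprB. Qed.

Lemma normcBD z w v : normc (z - w) <= normc (z - v) + normc (v - w).
Proof. by rewrite (le_trans _ (normcD _ _))// addrA subrK. Qed.

Lemma normc_zero : normc (0 : C) = 0.
Proof. exact: ComplexField.Normc.normc0. Qed.

Lemma normc_one : normc (1 : C) = 1.
Proof. exact: ComplexField.Normc.normc1. Qed.

Lemma normc_eq0 z : (normc z == 0) = (z == 0).
Proof.
apply/eqP/eqP => [/ComplexField.Normc.eq0_normc//|->]; exact: normc_zero.
Qed.

Lemma normc_gt0 z : (0 < normc z) = (z != 0).
Proof. by rewrite lt_def normc_eq0 normc_ge0 andbT. Qed.

Lemma normc_real x : normc x%:C = `|x|.
Proof. by rewrite /= expr0n addr0 sqrtr_sqr. Qed.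

Lemma normcJ z : normc z^* = normc z.
Proof. by case: z => a b /=; rewrite sqrrN. Qed.

Lemma ReD z w : complex.Re (z + w) = complex.Re z + complex.Re w.
Proof. by case: z w => a b []. Qed.
Lemma ImD z w : complex.Im (z + w) = complex.Im z + complex.Im w.
Proof. by case: z w => a b []. Qed.
Lemma ReN z : complex.Re (- z) = - complex.Re z.
Proof. by case: z. Qed.
Lemma ImN z : complex.Im (- z) = - complex.Im z.
Proof. by case: z. Qed.
Lemma ReM z w : complex.Re (z * w) =
  complex.Re z * complex.Re w - complex.Im z * complex.Im w.
Proof. by case: z w => a b []. Qed.
Lemma ImM z w : complex.Im (z * w) =
  complex.Re z * complex.Im w + complex.Im z * complex.Re w.
Proof. by case: z w => a b []. Qed.

Lemma ler_Re_normc z : `|complex.Re z| <= normc z.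
Proof.
by case: z => a b /=; rewrite -sqrtr_sqr ler_wsqrtr// lerDl sqr_ge0.
Qed.

Lemma ler_Im_normc z : `|complex.Im z| <= normc z.
Proof.
by case: z => a b /=; rewrite -sqrtr_sqr ler_wsqrtr// lerDr sqr_ge0.
Qed.

Lemma normc_le_ReIm z : normc z <= `|complex.Re z| + `|complex.Im z|.
Proof.
case: z => a b /=; rewrite -[leRHS]ger0_norm ?addr_ge0// -sqrtr_sqr.
rewrite ler_wsqrtr// sqrrD !real_normK ?num_real//.
have : 0 <= `|a| * `|b| by rewrite mulr_ge0.
lra.
Qed.

Lemma normc_le_eps z : (forall e : R, 0 < e -> normc z <= e) -> z = 0.
Proof.
move=> H; apply/eqP; rewrite -normc_eq0 eq_le normc_ge0 andbT.
by apply/ler_addgt0Pl => e e0; rewrite addr0 H.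
Qed.

Lemma nearC (c : C) (P : set C) : nbhs (c : C^o) P <->
  exists2 d, 0 < d & forall w, normc (w - c) < d -> P w.
Proof.
split=> [/nbhs_ballP[/= e e0 eP]|[d d0 dP]].
- have e0' : 0 < complex.Re e by move: e0; rewrite ltcE => /andP[_].
  exists (complex.Re e) => // w we; apply: eP; rewrite /ball/= normcE.
  rewrite normcB ltcE/= we andbT; move: e0; rewrite ltcE/= => /andP[/eqP->].
  by rewrite eqxx.
- apply/nbhs_ballP; exists d%:C => /=; first by rewrite ltcR.
  by move=> w; rewrite /ball/= normcE ltcR normcB => /dP.
Qed.

Lemma near0_C (P : set C) : (\forall w \near (0 : C^o), P w) <->
  exists2 d, 0 < d & forall w, normc w < d -> P w.
Proof.
split=> [/nearC[d d0 H]|[d d0 H]].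
  by exists d => // w wd; apply: H; rewrite subr0.
by apply/nearC; exists d => // w; rewrite subr0; exact: H.
Qed.

Lemma cvgC (T : Type) (F : set_system T) (FF : Filter F) (f : T -> C) (c : C) :
  (f @ F --> (c : C^o)) <->
  (forall e : R, 0 < e -> \forall t \near F, normc (f t - c) < e).
Proof.
split=> [fc e e0|H A].
  by apply: (fc [set w | normc (w - c) < e]); apply/nearC; exists e.
by move=> /nearC[d d0 dA]; apply: filterS (H _ d0) => t /dA.
Qed.

(** The derivative is written as a first-order expansion with a real error bound:
    the estimates below are about moduli, which this form gives at once. *)
Definition cderiv (f : C -> C) (s D : C) := forall e : R, 0 < e ->
  exists2 d, 0 < d & forall w, normc w < d ->
    normc (f (s + w) - f s - D * w) <= e * normc w.

Lemma derivableP_cderiv (f : C -> C) s :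
  derivable (f : C^o -> C^o) s 1 <-> exists D, cderiv f s D.
Proof.
split.
- move=> /cvg_ex[/= D /cvgC H]; exists D => e e0.
  have [d d0 dP] := iffLR (near0_C _) (H e e0).
  exists d => // w wd; have [->|w0] := eqVneq w 0.
    by rewrite addr0 mulr0 subrr subr0 normc_zero mulr0.
  have := dP w wd w0; rewrite /= => /ltW.
  rewrite /GRing.scale/= mulr1 => H2.
  have -> : f (s + w) - f s - D * w = (w^-1 * (f (w + s) - f s) - D) * w.
    by rewrite addrC mulrBl mulrAC mulVf// mul1r addrC [w + s]addrC.
  by rewrite normcM ler_wpM2r// normc_ge0.
- move=> [D HD]; apply/cvg_ex; exists (D : C^o); apply/cvgC => e e0.
  have [d d0 dP] := HD (e / 2) ltac:(lra).
  apply/near0_C; exists d => // w wd w0 /=.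
  rewrite /GRing.scale/= mulr1.
  have -> : w^-1 * (f (w + s) - f s) - D = (f (s + w) - f s - D * w) * w^-1.
    by rewrite mulrBl -[D * w * _]mulrA divff// mulr1 [w + s]addrC [w^-1 * _]mulrC.
  rewrite normcM ComplexField.Normc.normcV ltr_pdivrMr ?normc_gt0//.
  rewrite (le_lt_trans (dP _ wd))// ltr_pM2r ?normc_gt0//; lra.
Qed.

Lemma cderiv_continuous f s D : cderiv f s D ->
  forall e : R, 0 < e -> exists2 d, 0 < d & forall w, normc w < d ->
    normc (f (s + w) - f s) <= e.
Proof.
move=> H e e0; have [d d0 dP] := H 1 ltr01.
have n0 := normc_ge0 D.
exists (Num.min d (e / (normc D + 1))); first by rewrite lt_min d0 divr_gt0//; lra.
move=> w; rewrite lt_min => /andP[wd we].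
rewrite -(subrK (D * w) (f _ - _)) (le_trans (normcD _ _))//.
rewrite normcM; apply: (le_trans (lerD (dP _ wd) (lexx _))).
by rewrite -mulrDl addrC -ler_pdivlMl ?(mulrC _ e) 1?ltW//; lra.
Qed.

End Modulus.

(** * Additive functions of rectangles *)

Section Bisection.
Context {R : realType}.
Variable (T : R -> R -> R -> R -> R) (a0 b0 c0 d0 : R).

Definition subrect (a b c d : R) :=
  [&& a0 <= a, a <= b & b <= b0] && [&& c0 <= c, c <= d & d <= d0].

Hypothesis T_splitx : forall a b c d m, subrect a b c d -> a <= m <= b ->
  T a b c d = T a m c d + T m b c d.
Hypothesis T_splity : forall a b c d m, subrect a b c d -> c <= m <= d ->
  T a b c d = T a b c m + T a b m d.
Hypothesis T_local : forall x y, a0 <= x <= b0 -> c0 <= y <= d0 ->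
  forall e, 0 < e -> exists2 r, 0 < r &
    forall a b c d, subrect a b c d -> a <= x <= b -> c <= y <= d ->
      b - a < r -> d - c < r -> `|T a b c d| <= e * ((b - a) + (d - c)) ^+ 2.

Let rect : Type := (R * R * R * R)%type.
Let val (p : rect) := let: (a, b, c, d) := p in T a b c d.
Let ok (p : rect) := let: (a, b, c, d) := p in subrect a b c d.
Let half (p q : rect) := let: (a, b, c, d) := p in let: (a', b', c', d') := q in
  [/\ a <= a', b' <= b, c <= c', d' <= d &
      b' - a' = (b - a) / 2 /\ d' - c' = (d - c) / 2].

Let quarter p : ok p -> exists q, [/\ ok q, half p q & `|val p| <= 4 * `|val q|].
Proof.
move: p => [[[a b] c] d] /= okp; have := okp => /andP[/and3P[h1 h2 h3] /and3P[h4 h5 h6]].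
set m := (a + b) / 2; set n := (c + d) / 2.
have am : a <= m by rewrite /m; lra.
have mb : m <= b by rewrite /m; lra.
have cn : c <= n by rewrite /n; lra.
have nd : n <= d by rewrite /n; lra.
have okl : subrect a m c d by apply/andP; split; apply/and3P; split => //; lra.
have okr : subrect m b c d by apply/andP; split; apply/and3P; split => //; lra.
have E : T a b c d = (T a m c n + T a m n d) + (T m b c n + T m b n d).
  by rewrite (@T_splitx a b c d m) ?am//; congr (_ + _);
    rewrite (@T_splity _ _ c d n)// cn nd.
have tri : `|T a b c d| <=
    `|T a m c n| + `|T a m n d| + (`|T m b c n| + `|T m b n d|).
  rewrite E (le_trans (ler_normD _ _))// lerD// ler_normD//.
have [A1|A1] := leP (`|T a b c d|) (4 * `|T a m c n|).
  exists (a, m, c, n); split => //; first by apply/andP; split; apply/and3P; split => //; lra.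
  by split => //; rewrite /m /n; lra.
have [A2|A2] := leP (`|T a b c d|) (4 * `|T a m n d|).
  exists (a, m, n, d); split => //; first by apply/andP; split; apply/and3P; split => //; lra.
  by split => //; rewrite /m /n; lra.
have [A3|A3] := leP (`|T a b c d|) (4 * `|T m b c n|).
  exists (m, b, c, n); split => //; first by apply/andP; split; apply/and3P; split => //; lra.
  by split => //; rewrite /m /n; lra.
exists (m, b, n, d); split => //; first by apply/andP; split; apply/and3P; split => //; lra.
  by split => //; rewrite /m /n; lra.
lra.
Qed.

(** If [T] is not zero on a rectangle, one of the four quarters carries at least a
    quarter of its modulus. Iterating, rectangles of size [2 ^- n] shrink to a point
    while [|T|] decays no faster than [4 ^- n], against the local bound there. *)
Lemma bisection_eq0 : a0 <= b0 -> c0 <= d0 -> T a0 b0 c0 d0 = 0.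
Proof.
move=> ab cd.
have /choice[next nextP] : forall p, exists q, ok p ->
    [/\ ok q, half p q & `|val p| <= 4 * `|val q|].
  move=> p; have [/quarter[q qP]|nok] := pselect (ok p); first by exists q.
  by exists p.
pose s n := iter n next (a0, b0, c0, d0).
have oks n : ok (s n).
  elim: n => [|n IH] /=; first by apply/andP; split; apply/and3P; split.
  by have [] := nextP _ IH.
pose A n := (s n).1.1.1; pose B n := (s n).1.1.2.
pose G n := (s n).1.2; pose D n := (s n).2.
have sE n : s n = (A n, B n, G n, D n) by rewrite /A /B /G /D; case: (s n) => [[[]]].
have st n : [/\ A n <= A n.+1, B n.+1 <= B n, G n <= G n.+1, D n.+1 <= D n &
    B n.+1 - A n.+1 = (B n - A n) / 2 /\ D n.+1 - G n.+1 = (D n - G n) / 2].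
  have [_ + _] := nextP _ (oks n).
  by rewrite (_ : next (s n) = s n.+1)// (sE n) (sE n.+1).
have okS n : subrect (A n) (B n) (G n) (D n) by have := oks n; rewrite sE.
have vS n : `|T a0 b0 c0 d0| <= 4 ^+ n * `|T (A n) (B n) (G n) (D n)|.
  elim: n => [|n IH]; first by rewrite mul1r.
  apply: (le_trans IH); rewrite exprSr -mulrA ler_wpM2l ?exprn_ge0//.
  have [_ _] := nextP _ (oks n).
  by rewrite (_ : next (s n) = s n.+1)// (sE n) (sE n.+1).
have BA n : B n - A n = (b0 - a0) / 2 ^+ n.
  elim: n => [|n IH]; first by rewrite divr1.
  by have [_ _ _ _ [-> _]] := st n; rewrite IH exprSr invfM mulrA.
have DG n : D n - G n = (d0 - c0) / 2 ^+ n.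
  elim: n => [|n IH]; first by rewrite divr1.
  by have [_ _ _ _ [_ ->]] := st n; rewrite IH exprSr invfM mulrA.
have nest (X Y : nat -> R) : (forall n, X n <= X n.+1) ->
    (forall n, Y n.+1 <= Y n) -> (forall n, X n <= Y n) ->
    exists x, forall n, X n <= x <= Y n.
  move=> X1 Y1 XY.
  have XY' n m : X n <= Y m.
    have /orP[nm|mn] := leq_total n m.
      by apply: le_trans (XY m); apply: (homo_leq (le_refl) le_trans X1).
    apply: (le_trans (XY n)).
    by apply: (homo_leq (r := fun x y : R => y <= x) le_refl _ Y1) => // x y z h1 /le_trans; apply.
  have ubX m : ubound (range X) (Y m) by move=> _ [n _ <-].
  have X0 : range X !=set0 by exists (X 0%N), 0%N.
  exists (sup (range X)) => n; apply/andP; split.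
    by apply: sup_upper_bound; [split => //; exists (Y 0%N)|exists n].
  by apply: ge_sup => //; exact: ubX.
have [x xP] : exists x, forall n, A n <= x <= B n.
  by apply: nest => n; [case: (st n)|case: (st n)|case/andP: (okS n) => /and3P[? ? ?] /and3P[]].
have [y yP] : exists y, forall n, G n <= y <= D n.
  by apply: nest => n; [case: (st n)|case: (st n)|case/andP: (okS n) => /and3P[? ? ?] /and3P[]].
apply/eqP; rewrite -normr_eq0 eq_le normr_ge0 andbT.
set w := (b0 - a0) + (d0 - c0).
have w0 : 0 <= w by rewrite /w; lra.
suff H e : 0 < e -> `|T a0 b0 c0 d0| <= e * w ^+ 2.
  apply/ler_addgt0Pl => e e0; rewrite addr0.
  have w1 : 0 < w ^+ 2 + 1 by rewrite ltr_wpDl// sqr_ge0.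
  apply: (le_trans (H (e / (w ^+ 2 + 1)) _)); first by rewrite divr_gt0.
  by rewrite mulrAC ler_pdivrMr// ler_wpM2l ?ltW//; lra.
move=> e0; have [r r0 rP] := T_local (xP 0%N) (yP 0%N) e0.
have [n nP] : exists n, w / 2 ^+ n < r.
  have rw : 0 < r / (w + 1) by rewrite divr_gt0//; lra.
  have [n _ /(_ n (leqnn n)) nP] := near_infty_natSinv_lt (PosNum rw).
  exists n; move: nP => /= nP.
  have w1 : 0 < w + 1 by lra.
  have n2 : (n.+1%:R : R) <= 2 ^+ n by rewrite -natrX ler_nat ltn_expl.
  rewrite ltr_pdivrMr ?exprn_gt0// (lt_le_trans _ (ler_wpM2l (ltW r0) n2))//.
  move: nP; rewrite ltr_pdivlMr// mulrC ltr_pdivrMr//; lra.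
have wr : forall v, v <= w -> v / 2 ^+ n < r.
  by move=> v vw; apply: le_lt_trans nP; rewrite ler_wpM2r// invr_ge0 exprn_ge0.
apply: (le_trans (vS n)).
have := rP _ _ _ _ (okS n) (xP n) (yP n); rewrite BA DG -mulrDl -/w.
move=> /(_ (wr _ _) (wr _ _)) H.
apply: (le_trans (ler_wpM2l _ (H _ _))); rewrite ?exprn_ge0//; rewrite ?/w; try lra.
rewrite exprMn exprVn -exprM mulnC exprM (_ : 2 ^+ 2 = 4 :> R); last by ring.
have q0 : (4 ^+ n : R) != 0 by rewrite expf_neq0.
by rewrite le_eqVlt; apply/orP; left; apply/eqP; field.
Qed.

End Bisection.

(** * Integrals over a segment *)

Section SegmentIntegral.
Context {R : realType}.
Notation mu := (@lebesgue_measure R).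
Implicit Types (f g : R -> R) (a b m c : R).

Lemma segment_integrable f a b : {within `[a, b], continuous f} ->
  mu.-integrable `[a, b] (EFin \o f).
Proof. by move=> cf; apply: continuous_compact_integrable => //; exact: segment_compact. Qed.

Lemma within_subsegment f a b a' b' : {within `[a, b], continuous f} ->
  a <= a' -> b' <= b -> {within `[a', b'], continuous f}.
Proof.
move=> cf aa bb; apply: continuous_subspaceW cf.
by apply: subset_itv; rewrite bnd_simp.
Qed.

Lemma Rintegral_split f a b m : {within `[a, b], continuous f} -> a <= m <= b ->
  \int[mu]_(x in `[a, b]) f x =
  \int[mu]_(x in `[a, m]) f x + \int[mu]_(x in `[m, b]) f x.
Proof.
move=> cf /andP[am mb].
have := @Rintegral_itvB R f (BLeft a) (BRight b) m (segment_integrable cf).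
rewrite !bnd_simp => /(_ am mb)/eqP; rewrite subr_eq => /eqP ->.
rewrite addrC Rintegral_itv_obnd_cbnd//.
apply: integrableS (segment_integrable cf) => //.
by apply: subset_itv; rewrite !bnd_simp.
Qed.

Lemma Rintegral_segment_cst a b c : a <= b ->
  \int[mu]_(x in `[a, b]) c = c * (b - a).
Proof.
move=> ab; rewrite Rintegral_cst//= lebesgue_measure_itv/= lte_fin.
by case: ltP => //= ba; rewrite (_ : b = a) ?subrr//; apply/eqP; rewrite eq_le ba ab.
Qed.

Lemma segment_integrableZ f a b c : {within `[a, b], continuous f} ->
  mu.-integrable `[a, b] (EFin \o (fun x => c * f x)).
Proof.
move=> cf; rewrite (_ : _ \o _ = (fun x => c%:E * (EFin \o f) x)%E).
  by apply: integrableZl => //; exact: segment_integrable.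
by apply/funext => x /=; rewrite EFinM.
Qed.

Lemma Rintegral_segment_le f g a b : {within `[a, b], continuous f} ->
  {within `[a, b], continuous g} -> (forall x, a <= x <= b -> f x <= g x) ->
  \int[mu]_(x in `[a, b]) f x <= \int[mu]_(x in `[a, b]) g x.
Proof.
move=> cf cg fg; apply: le_Rintegral => //; exact: segment_integrable.
Qed.

Lemma within_cst a b c : {within `[a, b], continuous (fun _ : R => c)}.
Proof. by apply: continuous_subspaceT => x; exact: cst_continuous. Qed.

Lemma Rintegral_segment_bound f a b c : a <= b -> {within `[a, b], continuous f} ->
  (forall x, a <= x <= b -> `|f x| <= c) ->
  `|\int[mu]_(x in `[a, b]) f x| <= c * (b - a).
Proof.
move=> ab cf fc; rewrite ler_norml -mulNr -!Rintegral_segment_cst//.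
apply/andP; split; apply: Rintegral_segment_le => //; try exact: within_cst.
  by move=> x /fc; rewrite ler_norml => /andP[].
by move=> x /fc; rewrite ler_norml => /andP[].
Qed.

Lemma within_segmentP f a b :
  (forall x, a <= x <= b -> forall e, 0 < e -> exists2 d, 0 < d &
     forall y, a <= y <= b -> `|y - x| < d -> `|f y - f x| <= e) ->
  {within `[a, b], continuous f}.
Proof.
move=> H; apply/subspace_continuousP => x /=; rewrite in_itv/= => xab.
apply/cvgrPdist_le => /= e e0; have [d d0 dP] := H x xab e e0.
rewrite near_withinE; apply/nbhs_ballP; exists d => // y /= xy.
rewrite in_itv/= => yab; rewrite distrC; apply: dP => //.
by move: xy; rewrite /ball/= distrC.
Qed.

End SegmentIntegral.

(** * Goursat's theorem for a rectangle *)

Section Goursat.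
Context {R : realType}.
Notation mu := (@lebesgue_measure R).
Variables (u v : R -> R -> R) (a0 b0 c0 d0 : R).

(** The condition says that [u + i v] has the complex derivative [A + i B] at
    [(x0, y0)]. The approximation is only required inside the rectangle. *)
Definition cauchy_riemann_at (x0 y0 : R) := exists A B : R,
  forall e : R, 0 < e -> exists2 r : R, 0 < r &
    forall x y, a0 <= x <= b0 -> c0 <= y <= d0 -> `|x - x0| < r -> `|y - y0| < r ->
      `|u x y - u x0 y0 - (A * (x - x0) - B * (y - y0))|
         <= e * (`|x - x0| + `|y - y0|) /\
      `|v x y - v x0 y0 - (B * (x - x0) + A * (y - y0))|
         <= e * (`|x - x0| + `|y - y0|).

Hypothesis CR : forall x y, a0 <= x <= b0 -> c0 <= y <= d0 -> cauchy_riemann_at x y.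

Lemma lipschitz_within_segment (f : R -> R) a b :
  (forall x, a <= x <= b -> exists k r, 0 < r /\ forall y, a <= y <= b -> `|y - x| < r ->
     `|f y - f x| <= k * `|y - x|) ->
  {within `[a, b], continuous f}.
Proof.
move=> H; apply: within_segmentP => x xab e e0.
have [k [r [r0 kr]]] := H x xab.
have k0 : 0 <= `|k| by [].
exists (Num.min r (e / (`|k| + 1))).
  by rewrite lt_min r0 divr_gt0//; lra.
move=> y yab; rewrite lt_min => /andP[yr ye].
apply: (le_trans (kr y yab yr)).
have k1 : 0 < `|k| + 1 by lra.
move: ye; rewrite ltr_pdivlMr// => /ltW; apply: le_trans.
rewrite mulrC ler_wpM2l//; have := ler_norm k; lra.
Qed.

Lemma CR_continuous_y x : a0 <= x <= b0 -> {within `[c0, d0], continuous (u x)}.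
Proof.
move=> xab; apply: lipschitz_within_segment => y ycd.
have [A [B /(_ 1 ltr01)[r r0 H]]] := CR xab ycd.
exists (1 + `|B|), r; split => // y' y'cd y'r.
have [|+ _] := H x y' xab y'cd _ y'r; first by rewrite subrr normr0.
rewrite subrr normr0 mulr0 sub0r add0r opprK => H1.
have -> : u x y' - u x y = (u x y' - u x y + B * (y' - y)) - B * (y' - y) by ring.
by rewrite (le_trans (ler_normB _ _))// mulrDl normrM lerD.
Qed.

Lemma CR_continuous_x y : c0 <= y <= d0 -> {within `[a0, b0], continuous (v ^~ y)}.
Proof.
move=> ycd; apply: lipschitz_within_segment => x xab.
have [A [B /(_ 1 ltr01)[r r0 H]]] := CR xab ycd.
exists (1 + `|B|), r; split => // x' x'ab x'r.
have [|_] := H x' y x'ab ycd x'r; first by rewrite subrr normr0.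
rewrite subrr normr0 mulr0 !addr0 => H1.
have -> : v x' y - v x y = (v x' y - v x y - B * (x' - x)) + B * (x' - x) by ring.
by rewrite (le_trans (ler_normD _ _))// mulrDl normrM lerD.
Qed.

Let T a b c d :=
  (\int[mu]_(y in `[c, d]) u b y - \int[mu]_(y in `[c, d]) u a y) -
  (\int[mu]_(x in `[a, b]) v x d - \int[mu]_(x in `[a, b]) v x c).

(** The imaginary part of the vanishing of the contour integral of [u + i v]. Both
    sides are additive in the rectangle. For an affine [u + i v] they are equal, so
    that near each point they differ by [o] of the square of the size. *)
Lemma goursat : a0 <= b0 -> c0 <= d0 ->
  \int[mu]_(y in `[c0, d0]) u b0 y - \int[mu]_(y in `[c0, d0]) u a0 y =
  \int[mu]_(x in `[a0, b0]) v x d0 - \int[mu]_(x in `[a0, b0]) v x c0.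
Proof.
have cu x a b : a0 <= x <= b0 -> c0 <= a -> b <= d0 ->
    {within `[a, b], continuous (u x)}.
  by move=> xab; apply: within_subsegment; exact: CR_continuous_y.
have cv y a b : c0 <= y <= d0 -> a0 <= a -> b <= b0 ->
    {within `[a, b], continuous (v ^~ y)}.
  by move=> ycd; apply: within_subsegment; exact: CR_continuous_x.
move=> ab cd; apply/eqP; rewrite -subr_eq0; apply/eqP.
apply: (@bisection_eq0 R T a0 b0 c0 d0) => //.
- move=> a b c d m /andP[/and3P[h1 h2 h3] /and3P[h4 h5 h6]] /andP[am mb].
  rewrite /T (Rintegral_split (m := m) (f := v ^~ d)) ?am//; last by apply: cv => //; lra.
  rewrite (Rintegral_split (m := m) (f := v ^~ c)) ?am//; last by apply: cv => //; lra.
  ring.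
- move=> a b c d m /andP[/and3P[h1 h2 h3] /and3P[h4 h5 h6]] /andP[cm md].
  rewrite /T (Rintegral_split (m := m) (f := u a)) ?cm//; last by apply: cu => //; lra.
  rewrite (Rintegral_split (m := m) (f := u b)) ?cm//; last by apply: cu => //; lra.
  ring.
- move=> x y xab ycd e e0.
  have [A [B /(_ (e / 2) ltac:(lra))[r r0 H]]] := CR xab ycd.
  exists r => // a b c d /andP[/and3P[h1 h2 h3] /and3P[h4 h5 h6]] /andP[ax xb] /andP[cy yd] br dr.
  set w := b - a in br *; set h := d - c in dr *.
  have Bu s t : a <= s <= b -> c <= t <= d ->
      `|u s t - u x y - (A * (s - x) - B * (t - y))| <= e / 2 * (w + h) /\
      `|v s t - v x y - (B * (s - x) + A * (t - y))| <= e / 2 * (w + h).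
    move=> /andP[as_ sb] /andP[ct td].
    have sx : `|s - x| <= w by rewrite ler_norml /w; lra.
    have ty : `|t - y| <= h by rewrite ler_norml /h; lra.
    have [] := H s t ltac:(lra) ltac:(lra) (le_lt_trans sx br) (le_lt_trans ty dr).
    have wh : e / 2 * (`|s - x| + `|t - y|) <= e / 2 * (w + h).
      by rewrite ler_wpM2l ?lerD//; lra.
    by move=> /le_trans H1 /le_trans H2; split; [apply: H1|apply: H2].
  have wu : {within `[c, d], continuous (fun t => u b t - u a t - A * w)}.
    move=> t; apply: cvgB; last exact: cvg_cst.
    by apply: cvgB; [apply: (cu b c d _ _ _ t) => //; lra|apply: (cu a c d _ _ _ t) => //; lra].
  have wv : {within `[a, b], continuous (fun s => v s d - v s c - A * h)}.
    move=> t; apply: cvgB; last exact: cvg_cst.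
    by apply: cvgB; [apply: (cv d a b _ _ _ t) => //; lra|apply: (cv c a b _ _ _ t) => //; lra].
  have E1 : \int[mu]_(t in `[c, d]) (u b t - u a t - A * w) =
     \int[mu]_(t in `[c, d]) u b t - \int[mu]_(t in `[c, d]) u a t - A * w * h.
    rewrite RintegralB//; last 2 first.
    + apply: segment_integrable => t; apply: cvgB;
        [apply: (cu b c d _ _ _ t) => //; lra|apply: (cu a c d _ _ _ t) => //; lra].
    + exact/segment_integrable/within_cst.
    rewrite RintegralB//; last 2 first.
    + by apply/segment_integrable/cu => //; lra.
    + by apply/segment_integrable/cu => //; lra.
    by rewrite Rintegral_segment_cst.
  have E2 : \int[mu]_(t in `[a, b]) (v t d - v t c - A * h) =
     \int[mu]_(t in `[a, b]) v t d - \int[mu]_(t in `[a, b]) v t c - A * h * w.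
    rewrite RintegralB//; last 2 first.
    + apply: segment_integrable => t; apply: cvgB;
        [apply: (cv d a b _ _ _ t) => //; lra|apply: (cv c a b _ _ _ t) => //; lra].
    + exact/segment_integrable/within_cst.
    rewrite RintegralB//; last 2 first.
    + by apply/segment_integrable/cv => //; lra.
    + by apply/segment_integrable/cv => //; lra.
    by rewrite Rintegral_segment_cst.
  have b1 : `|\int[mu]_(t in `[c, d]) (u b t - u a t - A * w)| <= e * (w + h) * h.
    apply: Rintegral_segment_bound => // t tcd.
    have [p1 _] := Bu b t ltac:(lra) tcd; have [p2 _] := Bu a t ltac:(lra) tcd.
    have -> : u b t - u a t - A * w =
      (u b t - u x y - (A * (b - x) - B * (t - y))) -
      (u a t - u x y - (A * (a - x) - B * (t - y))) by rewrite /w; ring.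
    rewrite (le_trans (ler_normB _ _))//; lra.
  have b2 : `|\int[mu]_(t in `[a, b]) (v t d - v t c - A * h)| <= e * (w + h) * w.
    apply: Rintegral_segment_bound => // t tcd.
    have [_ p1] := Bu t d tcd ltac:(lra); have [_ p2] := Bu t c tcd ltac:(lra).
    have -> : v t d - v t c - A * h =
      (v t d - v x y - (B * (t - x) + A * (d - y))) -
      (v t c - v x y - (B * (t - x) + A * (c - y))) by rewrite /h; ring.
    rewrite (le_trans (ler_normB _ _))//; lra.
  have -> : T a b c d = \int[mu]_(t in `[c, d]) (u b t - u a t - A * w) -
      \int[mu]_(t in `[a, b]) (v t d - v t c - A * h).
    by rewrite E1 E2 /T; ring.
  rewrite (le_trans (ler_normB _ _))//; nra.
Qed.

End Goursat.

(** * The exponential in polar coordinates *)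

Section Expi.
Context {R : realType}.
Implicit Types x y : R.

Lemma expi0 : expi 0 = 1 :> R[i].
Proof. by rewrite /expi cos0 sin0. Qed.

Lemma expiD x y : expi (x + y) = expi x * expi y.
Proof. by rewrite /expi cosD sinD; simpc; congr (_ +i* _); rewrite addrC. Qed.

Lemma normc_expi x : normc (expi x) = 1.
Proof. by rewrite /expi /= cos2Dsin2 sqrtr1. Qed.

Lemma expiN x : expi (- x) = (expi x)^*.
Proof. by rewrite /expi cosN sinN. Qed.

End Expi.

Section Polar.
Context {R : realType}.
Notation C := R[i].
Notation mu := (@lebesgue_measure R).
Implicit Types (x y : R).

Definition cexp x y : C := (expR x)%:C * expi y.

Lemma cexpD x x' y y' : cexp (x + x') (y + y') = cexp x y * cexp x' y'.
Proof. by rewrite /cexp expRD expiD rmorphM mulrACA. Qed.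

Lemma normc_cexp x y : normc (cexp x y) = expR x.
Proof. by rewrite /cexp normcM normc_expi mulr1 normc_real gtr0_norm// expR_gt0. Qed.

Lemma cexp_neq0 x y : cexp x y != 0.
Proof. by rewrite -normc_eq0 normc_cexp gt_eqF// expR_gt0. Qed.

Lemma is_derive_expand (f : R -> R) (a D : R) : is_derive a 1 f D ->
  forall e : R, 0 < e -> exists2 d : R, 0 < d & forall h : R, `|h| < d ->
    `|f (a + h) - f a - D * h| <= e * `|h|.
Proof.
move=> [df <-] e e0; have /cvgrPdist_le/(_ e e0) := df.
move=> /nbhs_ballP[d /= d0 dP]; exists d => // h hd.
have [->|h0] := eqVneq h 0; first by rewrite addr0 mulr0 subrr subr0 normr0 mulr0.
have := dP h; rewrite /ball/= sub0r normrN => /(_ hd h0).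
rewrite -[X in _ -> X <= _]normrN opprB.
rewrite /GRing.scale/= mulr1 => H.
have -> : 'D_1 f a * h - (f (a + h) - f a) =
   ('D_1 f a - h^-1 * (f (h + a) - f a)) * h.
  by rewrite mulrBl mulrAC mulVf// mul1r [h + a]addrC.
by rewrite normrM ler_wpM2r.
Qed.

Lemma cexp_expand (e : R) : 0 < e -> exists2 d : R, 0 < d & forall x y,
  `|x| < d -> `|y| < d -> normc (cexp x y - 1 - (x +i* y)) <= e * (`|x| + `|y|).
Proof.
move=> e0; pose e' := Num.min (e / 8) 1.
have e'0 : 0 < e' by rewrite lt_min ltr01 andbT; lra.
have e'e : e' <= e / 8 by rewrite ge_min lexx.
have e'1 : e' <= 1 by rewrite ge_min lexx orbT.
have [d1 d10 H1] := is_derive_expand (is_derive_expR 0) e'0.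
have [d2 d20 H2] := is_derive_expand (is_derive_cos 0) e'0.
have [d3 d30 H3] := is_derive_expand (is_derive_sin 0) e'0.
exists (Num.min (e / 16) (Num.min d1 (Num.min d2 d3))).
  by rewrite !lt_min d10 d20 d30 !andbT; lra.
move=> x y; rewrite !lt_min => /and4P[xe x1 _ _] /and4P[ye _ y2 y3].
have := H1 x x1; have := H2 y y2; have := H3 y y3.
rewrite !(add0r, expR0, cos0, sin0, oppr0, mul0r, subr0, addr0, mul1r).
set s := sin y; set c := cos y; set E := expR x => hs hc hE.
apply: (le_trans (normc_le_ReIm _)); rewrite /cexp /expi -/s -/c -/E; simpc => /=.
have nx : 0 <= `|x| by []; have ny : 0 <= `|y| by [].
have hE1 : `|E - 1| <= 2 * `|x|.
  rewrite (_ : E - 1 = (E - 1 - x) + x); last by ring.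
  rewrite (le_trans (ler_normD _ _))//; nra.
have p1 := ler_wpM2r ny e'1.
have p2 : e' * `|y| <= e / 16 by lra.
have p3 := ler_wpM2l nx p2.
have p4 := ler_wpM2l nx (ltW ye).
have p5 := ler_wpM2r nx e'e.
have p7 := mulr_ge0 (ltW e0) nx.
have p8 := mulr_ge0 (ltW e0) ny.
have p6 := ler_wpM2r ny e'e.
have hs1 : `|s| <= 2 * `|y|.
  rewrite (_ : s = (s - y) + y); last by ring.
  rewrite (le_trans (ler_normD _ _))//; lra.
have r1 : `|E * c - 1 - x| <= e / 2 * (`|x| + `|y|).
  rewrite (_ : _ - x = (E - 1) * (c - 1) + (E - 1 - x) + (c - 1)); last by ring.
  rewrite (le_trans (ler_normD _ _))// (le_trans (lerD (ler_normD _ _) (lexx _)))//.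
  rewrite normrM.
  have : `|E - 1| * `|c - 1| <= 2 * `|x| * (e' * `|y|) by rewrite ler_pM.
  lra.
have r2 : `|E * s - y| <= e / 2 * (`|x| + `|y|).
  rewrite (_ : _ - y = (E - 1) * s + (s - y)); last by ring.
  rewrite (le_trans (ler_normD _ _))// normrM.
  have : `|E - 1| * `|s| <= 2 * `|x| * (2 * `|y|) by rewrite ler_pM.
  lra.
lra.
Qed.

(** Multiplying by the value at the base point reduces the expansion of [cexp] to
    the one at the origin. *)
Lemma cexp_cauchy_riemann (G : C -> C) a b c d x0 y0 :
  (exists D, cderiv G (cexp x0 y0) D) ->
  cauchy_riemann_at (fun x y => complex.Re (G (cexp x y)))
    (fun x y => complex.Im (G (cexp x y))) a b c d x0 y0.
Proof.
move=> [D GD]; set z := cexp x0 y0.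
exists (complex.Re (D * z)), (complex.Im (D * z)) => e e0.
have z0 : 0 < normc z by rewrite normc_cexp expR_gt0.
have nD := normc_ge0 D.
have dz : 0 <= normc D * normc z by rewrite mulr_ge0// ltW.
have [d1 d10 H1] := GD (e / (4 * normc z)) ltac:(by rewrite divr_gt0//; lra).
pose k := Num.min 1 (e / (2 * (normc D * normc z + 1))).
have k0 : 0 < k by rewrite lt_min ltr01 divr_gt0//; lra.
have [d2 d20 H2] := cexp_expand k0.
exists (Num.min d2 (d1 / (8 * normc z))).
  by rewrite lt_min d20 divr_gt0//; lra.
move=> x y _ _; rewrite !lt_min => /andP[x2 x1] /andP[y2 y1].
have nx : 0 <= `|x - x0| by []; have ny : 0 <= `|y - y0| by [].
have := H2 _ _ x2 y2; set q := cexp (x - x0) (y - y0) => Hq.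
have zq : cexp x y = z + (z * q - z).
  by rewrite addrC subrK /z /q -cexpD; congr cexp; ring.
have kk1 : k <= 1 by rewrite ge_min lexx.
have nq : normc (q - 1) <= 2 * (`|x - x0| + `|y - y0|).
  rewrite (_ : q - 1 = (q - 1 - ((x - x0) +i* (y - y0))) +
    ((x - x0) +i* (y - y0))); last by rewrite subrK.
  rewrite (le_trans (normcD _ _))//.
  have S1 : normc ((x - x0) +i* (y - y0)) <= `|x - x0| + `|y - y0|.
    exact: normc_le_ReIm.
  have := ler_wpM2r (addr_ge0 nx ny) kk1; lra.
have nw : normc (z * q - z) <= normc z * (2 * (`|x - x0| + `|y - y0|)).
  by rewrite -{2}(mulr1 z) -mulrBr normcM ler_pM2l.
have Hw : normc (z * q - z) < d1.
  apply: (le_lt_trans nw).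
  move: x1 y1; rewrite !ltr_pdivlMr; lra.
have := H1 _ Hw; rewrite -zq => K1.
have K : normc (G (cexp x y) - G z - D * z * ((x - x0) +i* (y - y0)))
   <= e * (`|x - x0| + `|y - y0|).
  rewrite (_ : _ - _ = (G (cexp x y) - G z - D * (z * q - z)) +
     D * z * (q - 1 - ((x - x0) +i* (y - y0)))); last by ring.
  rewrite (le_trans (normcD _ _))//.
  have K2 : normc (D * z * (q - 1 - ((x - x0) +i* (y - y0)))) <=
      e / 2 * (`|x - x0| + `|y - y0|).
    rewrite normcM [normc (D * z)]normcM.
    apply: (le_trans (ler_wpM2l dz Hq)); rewrite mulrA ler_wpM2r ?addr_ge0//.
    have : k <= e / (2 * (normc D * normc z + 1)) by rewrite ge_min lexx orbT.
    rewrite ler_pdivlMr; last lra.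
    nra.
  have K3 : e / (4 * normc z) * normc (z * q - z) <=
      e / 2 * (`|x - x0| + `|y - y0|).
    have e4 : 0 <= e / (4 * normc z) by rewrite divr_ge0//; lra.
    apply: (le_trans (ler_wpM2l e4 nw)).
    rewrite le_eqVlt; apply/orP; left; apply/eqP; field.
    by rewrite gt_eqF.
  lra.
split.
- apply: le_trans (le_trans (ler_Re_normc _) K).
  by rewrite !ReD !ReN [complex.Re (D * z * _)]ReM/=.
- apply: le_trans (le_trans (ler_Im_normc _) K).
  rewrite !ImD !ImN [complex.Im (D * z * _)]ImM/= [_ * (y - y0) + _]addrC//.
Qed.

End Polar.

(** * Cauchy's estimate and Weierstrass's theorem *)

Section CauchyEstimate.
Context {R : realType}.
Notation C := R[i].
Notation mu := (@lebesgue_measure R).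
Implicit Types (f g : C -> C) (z w c D E : C).

Lemma cderivM f g z D E : cderiv f z D -> cderiv g z E ->
  cderiv (fun w => f w * g w) z (D * g z + f z * E).
Proof.
move=> HD HE e e0.
have nD := normc_ge0 D; have nf := normc_ge0 (f z); have ng := normc_ge0 (g z).
have [d1 d10 H1] := HD (e / (3 * (normc (g z) + 1))) ltac:(by rewrite divr_gt0//; lra).
have [d2 d20 H2] := HE (e / (3 * (normc (f z) + 1))) ltac:(by rewrite divr_gt0//; lra).
pose k := Num.min 1 (e / (3 * (normc D + 1))).
have k0 : 0 < k by rewrite lt_min ltr01 divr_gt0//; lra.
have [d3 d30 H3] := cderiv_continuous HE k0.
exists (Num.min d1 (Num.min d2 d3)); first by rewrite !lt_min d10 d20.
move=> w; rewrite !lt_min => /and3P[/H1 K1 /H2 K2 /H3 K3].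
have nw := normc_ge0 w.
have k1 : k <= 1 by rewrite ge_min lexx.
have k2 : k <= e / (3 * (normc D + 1)) by rewrite ge_min lexx orbT.
have -> : f (z + w) * g (z + w) - f z * g z - (D * g z + f z * E) * w =
  (f (z + w) - f z - D * w) * g (z + w) + D * w * (g (z + w) - g z) +
  f z * (g (z + w) - g z - E * w) by ring.
rewrite (le_trans (normcD _ _))// (le_trans (lerD (normcD _ _) (lexx _)))//.
rewrite !normcM.
have Kg : normc (g (z + w)) <= normc (g z) + 1.
  by have := normcD (g (z + w) - g z) (g z); rewrite subrK; lra.
have A1 : normc (f (z + w) - f z - D * w) * normc (g (z + w)) <= e / 3 * normc w.
  apply: (le_trans (ler_pM (normc_ge0 _) (normc_ge0 _) K1 Kg)).
  by rewrite le_eqVlt; apply/orP; left; apply/eqP; field; rewrite gt_eqF//; lra.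
have A2 : normc D * normc w * normc (g (z + w) - g z) <= e / 3 * normc w.
  rewrite mulrAC ler_wpM2r//.
  apply: (le_trans (ler_wpM2l nD (le_trans K3 k2))).
  rewrite mulrA ler_pdivrMr; last lra.
  nra.
have A3 : normc (f z) * normc (g (z + w) - g z - E * w) <= e / 3 * normc w.
  apply: (le_trans (ler_wpM2l nf K2)).
  rewrite mulrA ler_wpM2r// mulrA ler_pdivrMr; last lra.
  nra.
lra.
Qed.

Lemma cderivB f g z D E : cderiv f z D -> cderiv g z E ->
  cderiv (fun w => f w - g w) z (D - E).
Proof.
move=> HD HE e e0; have e2 : 0 < e / 2 by lra.
have [d1 d10 H1] := HD _ e2; have [d2 d20 H2] := HE _ e2.
exists (Num.min d1 d2); first by rewrite lt_min d10.
move=> w; rewrite lt_min => /andP[/H1 K1 /H2 K2].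
have -> : f (z + w) - g (z + w) - (f z - g z) - (D - E) * w =
  (f (z + w) - f z - D * w) - (g (z + w) - g z - E * w) by ring.
rewrite (le_trans (normcD _ _))// normc_opp; lra.
Qed.

Lemma cderivV z : z != 0 -> cderiv (fun w => w^-1) z (- z ^- 2).
Proof.
move=> z0 e e0; have nz : 0 < normc z by rewrite normc_gt0.
exists (Num.min (normc z / 2) (e * normc z ^+ 3 / 2)).
  by rewrite lt_min !divr_gt0// mulr_gt0// exprn_gt0.
move=> w; rewrite lt_min => /andP[w1 w2].
have nzw : normc z / 2 <= normc (z + w).
  by have := normcD (z + w) (- w); rewrite addrK normc_opp; lra.
have zw0 : z + w != 0 by rewrite -normc_gt0; lra.
have -> : (z + w)^-1 - z^-1 - - z ^- 2 * w = w ^+ 2 / (z ^+ 2 * (z + w)).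
  by field; rewrite z0 zw0.
rewrite normcM ComplexField.Normc.normcV !normcM.
rewrite ler_pdivrMr; last by rewrite !mulr_gt0// normc_gt0.
have nw := normc_ge0 w.
have B1 := ler_wpM2r nw (ltW w2).
have c0 : 0 <= e * normc w * (normc z * normc z) by rewrite !mulr_ge0 ?normc_ge0 ?ltW.
have B2 := ler_wpM2l c0 nzw.
move: B1; rewrite 2!exprS expr1; lra.
Qed.

(** The difference quotient at [c], as a function of the increment, is holomorphic
    outside [0]; the Cauchy estimate is an estimate for its means on circles. *)
Lemma cderiv_ex_quotient f c z :
  z != 0 -> (exists D, cderiv f (c + z) D) -> forall k,
  exists D, cderiv (fun w => (f (c + w) - f c) * w^-1 * k) z D.
Proof.
move=> z0 [D HD] k.
have da : cderiv (fun w => f (c + w) - f c) z D.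
  move=> e e0; have [d d0 dP] := HD e e0.
  exists d => // w wd; rewrite addrA.
  have -> : f (c + z + w) - f c - (f (c + z) - f c) - D * w =
    f (c + z + w) - f (c + z) - D * w by ring.
  exact: dP.
have dk : cderiv (fun=> k) z 0.
  move=> e e0; exists 1 => // w _; rewrite mul0r subrr subr0 normc_zero.
  by rewrite mulr_ge0 ?normc_ge0 ?ltW.
by eexists; apply: cderivM dk; apply: cderivM da (cderivV z0).
Qed.

Lemma cexp_periodic : exists2 p : R, 0 < p & forall x, cexp x p = cexp x 0.
Proof.
exists (pi *+ 2); first by rewrite pmulrn_lgt0// pi_gt0.
by move=> x; rewrite /cexp /expi cos2pi sin2pi cos0 sin0.
Qed.

(** In the logarithmic plane an annulus is a rectangle whose height is a period of
    [Q \o exp]. The two horizontal sides cancel in Goursat's theorem, and the means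
    of [Re Q] on the two boundary circles are equal. *)
Lemma annulus_mean (Q : C -> C) (a b k l : R) : a <= b ->
  (forall x y, a <= x <= b -> exists D, cderiv Q (cexp x y) D) ->
  (forall y, k <= complex.Re (Q (cexp a y))) ->
  (forall y, complex.Re (Q (cexp b y)) <= l) -> k <= l.
Proof.
move=> ab dQ Qa Qb; have [p p0 Ep] := cexp_periodic.
have CR x y : a <= x <= b -> 0 <= y <= p -> cauchy_riemann_at
    (fun x y => complex.Re (Q (cexp x y))) (fun x y => complex.Im (Q (cexp x y)))
    a b 0 p x y.
  by move=> xab _; apply: cexp_cauchy_riemann; exact: dQ.
have ca : {within `[0, p], continuous (fun y => complex.Re (Q (cexp a y)))}.
  by apply: (CR_continuous_y CR); rewrite lexx.
have cb : {within `[0, p], continuous (fun y => complex.Re (Q (cexp b y)))}.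
  by apply: (CR_continuous_y CR); rewrite lexx andbT.
have := goursat CR ab (ltW p0).
under [X in _ = X - _ -> _]eq_Rintegral do rewrite Ep.
rewrite [RHS]subrr => /(canRL (subrK _)); rewrite add0r => Iab.
have := Rintegral_segment_le (@within_cst R 0 p k) ca (fun y _ => Qa y).
have := Rintegral_segment_le cb (@within_cst R 0 p l) (fun y _ => Qb y).
rewrite !(Rintegral_segment_cst _ (ltW p0)) subr0 Iab => h1 h2.
by rewrite -(ler_pM2r p0) (le_trans h2).
Qed.

Lemma real_between (I : Type) (P : set I) (lo hi : I -> R) : P !=set0 ->
  (forall i j, P i -> P j -> lo i <= hi j) ->
  exists x, forall i, P i -> lo i <= x <= hi i.
Proof.
move=> [i0 Pi0] H; exists (sup [set lo i | i in P]) => i Pi; apply/andP; split.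
  apply: sup_upper_bound; last by exists i.
  by split; [exists (lo i0), i0|exists (hi i0) => _ [j Pj <-]; exact: H].
by apply: ge_sup; [exists (lo i0), i0|move=> _ [j Pj <-]; exact: H].
Qed.

(** Completeness of the complex numbers, for a Cauchy family that comes with its
    rate; the limit is found between the bounds that the rate provides. *)
Lemma complete_C (D : R -> C) :
  (forall e e' : R, 0 < e -> 0 < e' -> normc (D e - D e') <= e + e') ->
  exists c, forall e : R, 0 < e -> normc (D e - c) <= 2 * e.
Proof.
move=> DD; have P1 : [set e : R | 0 < e] !=set0 by exists 1 => /=.
have [x xP] : exists x, forall e, 0 < e ->
    complex.Re (D e) - e <= x <= complex.Re (D e) + e.
  apply: (real_between P1) => e e' /= e0 e'0; have := DD e e' e0 e'0.
  have := ler_Re_normc (D e - D e'); rewrite ReD ReN ler_norml => /andP[]; lra.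
have [y yP] : exists y, forall e, 0 < e ->
    complex.Im (D e) - e <= y <= complex.Im (D e) + e.
  apply: (real_between P1) => e e' /= e0 e'0; have := DD e e' e0 e'0.
  have := ler_Im_normc (D e - D e'); rewrite ImD ImN ler_norml => /andP[]; lra.
exists (x +i* y) => e e0.
rewrite (le_trans (normc_le_ReIm _))// ReD ImD ReN ImN /=.
have := xP _ e0; have := yP _ e0 => /andP[h1 h2] /andP[h3 h4].
have : `|complex.Re (D e) - x| <= e by rewrite ler_norml; lra.
have : `|complex.Im (D e) - y| <= e by rewrite ler_norml; lra.
lra.
Qed.

Lemma cderiv_approx f c : (forall e : R, 0 < e -> exists D, exists2 d, 0 < d &
    forall w, normc w < d -> normc (f (c + w) - f c - D * w) <= e * normc w) ->
  exists D, cderiv f c D.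
Proof.
move=> H.
have /choice[D HD] : forall e : R, exists D, 0 < e -> exists2 d, 0 < d &
    forall w, normc w < d -> normc (f (c + w) - f c - D * w) <= e * normc w.
  by move=> e; have [/H[D]|] := pselect (0 < e); [exists D|exists 0].
have DD e e' : 0 < e -> 0 < e' -> normc (D e - D e') <= e + e'.
  move=> e0 e'0; have [d d0 dP] := HD e e0; have [d' d'0 dP'] := HD e' e'0.
  pose h : R := Num.min d d' / 2.
  have h0 : 0 < h by rewrite divr_gt0// lt_min d0.
  have hm : h < Num.min d d' by rewrite /h; move: h0; rewrite /h; lra.
  have nh : normc h%:C = h by rewrite normc_real gtr0_norm.
  move: hm; rewrite lt_min => /andP[hd hd'].
  have := dP h%:C; rewrite nh => /(_ hd) K1.
  have := dP' h%:C; rewrite nh => /(_ hd') K2.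
  rewrite -(ler_pM2r h0) -{1}nh -normcM.
  have -> : (D e - D e') * h%:C = (f (c + h%:C) - f c - D e' * h%:C) -
     (f (c + h%:C) - f c - D e * h%:C) by ring.
  rewrite (le_trans (normcD _ _))// normc_opp; lra.
have [L LP] := complete_C DD.
exists L => e e0; have e4 : 0 < e / 4 by lra.
have [d d0 dP] := HD _ e4; exists d => // w wd.
rewrite (_ : _ - _ = (f (c + w) - f c - D (e / 4) * w) + (D (e / 4) - L) * w);
  last by ring.
rewrite (le_trans (normcD _ _))// normcM.
have := LP _ e4.
have := dP w wd; have nw := normc_ge0 w; nra.
Qed.

(** On small circles around [c] the difference quotient is close to [D]; on the
    circle of radius [rho] it is at most [2 M / rho]. Multiplied by [D^*], whose role
    is to turn [D] into [|D|^2], its real parts are compared by [annulus_mean]. *)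
Lemma cauchy_estimate f c (rho M : R) D : 0 < rho ->
  (forall z, normc (z - c) <= rho -> exists D', cderiv f z D') ->
  (forall z, normc (z - c) <= rho -> normc (f z) <= M) ->
  cderiv f c D -> normc D <= 2 * M / rho.
Proof.
move=> rho0 df fM fD.
have [->|D0] := eqVneq D 0.
  rewrite normc_zero divr_ge0 ?(ltW rho0)// mulr_ge0//.
  by apply: le_trans (fM c _); rewrite ?normc_ge0// subrr normc_zero ltW.
have nD : 0 < normc D by rewrite normc_gt0.
apply/ler_addgt0Pr => e e0.
have [d d0 dP] := fD e e0.
pose r := Num.min (d / 2) rho.
have r0 : 0 < r by rewrite lt_min rho0 andbT; lra.
have rrho : r <= rho by rewrite ge_min lexx orbT.
have rd : r < d by apply: (@le_lt_trans _ _ (d / 2)); [rewrite ge_min lexx|lra].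
have [a aE] : exists a, expR a = r by exists (ln r); rewrite lnK// posrE.
have [b bE] : exists b, expR b = rho by exists (ln rho); rewrite lnK// posrE.
have ab : a <= b by rewrite -ler_expR aE bE.
pose Q z := (f (c + z) - f c) * z^-1 * D^*.
have key : normc D ^+ 2 - e * normc D <= 2 * M / rho * normc D.
  apply: (@annulus_mean Q a b) => //.
  - move=> x y /andP[ax xb]; apply: cderiv_ex_quotient; first exact: cexp_neq0.
    by apply: df; rewrite addrAC subrr add0r normc_cexp -bE ler_expR.
  - move=> y; move: (cexp a y) (normc_cexp a y) (cexp_neq0 a y) => z.
    rewrite aE => nz z0.
    have -> : Q z = D * D^* + (f (c + z) - f c - D * z) * z^-1 * D^*.
      rewrite /Q; move: (f (c + z) - f c) (D^*) z0 => X Y z0; field; exact: z0.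
    have -> : D * D^* = (normc D ^+ 2)%:C.
      by rewrite -sqr_normc normcE -rmorphXn.
    rewrite ReD /=.
    have : normc ((f (c + z) - f c - D * z) * z^-1 * D^*) <= e * normc D.
      rewrite !normcM normcJ ComplexField.Normc.normcV (ler_wpM2r (ltW nD))//.
      by rewrite ler_pdivrMr nz// -nz dP// nz.
    have := ler_Re_normc ((f (c + z) - f c - D * z) * z^-1 * D^*).
    rewrite ler_norml => /andP[]; lra.
  - move=> y; rewrite (le_trans (ler_norm _))// (le_trans (ler_Re_normc _))// /Q.
    rewrite !normcM normcJ ComplexField.Normc.normcV (ler_wpM2r (ltW nD))//.
    have ir : 0 <= rho^-1 by rewrite invr_ge0 ltW.
    rewrite normc_cexp bE (ler_wpM2r ir)//.
    rewrite (le_trans (normcD _ _))// normc_opp.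
    have h1 : normc (f (c + cexp b y)) <= M.
      by apply: fM; rewrite addrAC subrr add0r normc_cexp bE.
    have h2 : normc (f c) <= M by apply: fM; rewrite subrr normc_zero ltW.
    lra.
move: key; rewrite expr2 -mulrBl (ler_pM2r nD); lra.
Qed.

(** The Cauchy estimate on discs of radius [rho / 2] bounds the derivative along
    the segment from [c] to [c + z]. The mean value theorem is applied to the real
    part of [k * f], where [k] is the unit that makes the increment positive. *)
Lemma lipschitz_estimate f c (rho M : R) z : 0 < rho ->
  (forall z, normc (z - c) <= rho -> exists D', cderiv f z D') ->
  (forall z, normc (z - c) <= rho -> normc (f z) <= M) ->
  normc z < rho / 2 -> normc (f (c + z) - f c) <= 4 * M / rho * normc z.
Proof.
move=> rho0 df fM zr.
have M0 : 0 <= M.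
  by apply: le_trans (fM c _); rewrite ?normc_ge0// subrr normc_zero ltW.
have [k [k1 kE]] : exists k, normc k = 1 /\
    complex.Re (k * (f (c + z) - f c)) = normc (f (c + z) - f c).
  set w := f (c + z) - f c; have [->|w0] := eqVneq w 0.
    by exists 1; rewrite normc_one mulr0 normc_zero.
  exists (w^* / (normc w)%:C); rewrite normcM normcJ ComplexField.Normc.normcV normc_real.
  rewrite ger0_norm ?normc_ge0// divff ?normc_eq0//; split=> //.
  rewrite mulrAC [w^* * w]mulrC -sqr_normc normcE expr2 mulfK//.
  by rewrite eq_complex /= normc_eq0 (negbTE w0).
pose phi (t : R) := complex.Re (k * f (c + t%:C * z)).
have inb (t : R) : 0 <= t <= 1 -> normc (t%:C * z) <= rho / 2.
  move=> t01; rewrite normcM normc_real ger0_norm; last by lra.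
  have := normc_ge0 z; nra.
have dphi (t : R) : 0 <= t <= 1 -> exists D, is_derive t 1 phi (complex.Re (k * (D * z))) /\
    normc D <= 4 * M / rho.
  move=> t01; set p := c + t%:C * z.
  have pc : normc (p - c) <= rho / 2 by rewrite /p addrAC subrr add0r inb.
  have [D HD] := df p ltac:(lra).
  exists D; split; last first.
    have -> : 4 * M / rho = 2 * M / (rho / 2) by field; rewrite gt_eqF.
    apply: (@cauchy_estimate f p (rho / 2) M D) => //; first lra.
    + move=> q qp; apply: df; have := normcBD q c p; lra.
    + move=> q qp; apply: fM; have := normcBD q c p; lra.
  have H : (fun h : R => h^-1 *: (phi (h *: 1 + t) - phi t)) @ 0^' -->
       complex.Re (k * (D * z)).
    apply/cvgrPdist_le => /= e e0.
    have nz := normc_ge0 z.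
    have [d d0 dP] := HD (e / (normc z + 1)) ltac:(by rewrite divr_gt0//; lra).
    exists (d / (normc z + 1)) => /=; first by rewrite divr_gt0//; lra.
    move=> h /=; rewrite sub0r normrN ltr_pdivlMr; last lra.
    move=> hd h0.
    have -> : h *: (1 : R^o) = h by exact: mulr1.
    have hz : normc (h%:C * z) < d.
      rewrite normcM normc_real; nra.
    have := dP _ hz; rewrite /p.
    have -> : c + t%:C * z + h%:C * z = c + (h + t)%:C * z by rewrite rmorphD/=; ring.
    rewrite -/p normcM normc_real => K.
    rewrite distrC.
    have -> : h^-1 *: (phi (h + t) - phi t) - complex.Re (k * (D * z)) =
       h^-1 * complex.Re (k * (f (c + (h + t)%:C * z) - f p - D * (h%:C * z))).
      rewrite /phi /GRing.scale/= -/p -ReN -ReD.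
      rewrite (_ : k * (_ - _ - _) = (k * f (c + (h + t)%:C * z) - k * f p)
         - h%:C * (k * (D * z))); last by ring.
      rewrite [in RHS]ReD [complex.Re (- (h%:C * _))]ReN [complex.Re (h%:C * _)]ReM /= mul0r subr0.
      by rewrite mulrBr mulKf.
    rewrite normrM normfV ler_pdivrMl ?normr_gt0//.
    rewrite (le_trans (ler_Re_normc _))// normcM k1 mul1r (le_trans K)//.
    rewrite mulrCA ler_wpM2l//.
    rewrite mulrAC ler_pdivrMr; last lra.
    by rewrite ler_wpM2l ?ltW//; lra.
  split; last by apply: cvg_lim.
  by apply/cvg_ex; exists (complex.Re (k * (D * z))).
have /choice[D HD] : forall t : R, exists D, 0 <= t <= 1 ->
    is_derive t 1 phi (complex.Re (k * (D * z))) /\ normc D <= 4 * M / rho.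
  move=> t; have [/dphi[D]|n] := pselect (0 <= t <= 1); first by exists D.
  by exists 0.
have dphi1 (t : R) : t \in `]0, 1[ -> is_derive t 1 phi (complex.Re (k * (D t * z))).
  by rewrite in_itv/= => /andP[t0 t1]; apply: (HD t _).1; rewrite !ltW.
have cphi : {within `[0, 1], continuous phi}.
  apply: derivable_within_continuous => t; rewrite in_itv/= => t01.
  by have [[]] := HD t t01.
have [t] := MVT_segment ler01 dphi1 cphi; rewrite in_itv/= => t01.
have [_ Db] := HD t t01.
rewrite subr0 mulr1 => E.
rewrite -kE mulrBr ReD ReN.
have -> : complex.Re (k * f (c + z)) = phi 1 by rewrite /phi mul1r.
have -> : complex.Re (k * f c) = phi 0 by rewrite /phi mul0r addr0.
rewrite E (le_trans (ler_norm _))// (le_trans (ler_Re_normc _))//.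
by rewrite !normcM k1 mul1r ler_wpM2r ?normc_ge0.
Qed.

(** Weierstrass's theorem. By [lipschitz_estimate], applied to the difference of
    two approximants, closeness of the approximants implies closeness of their
    difference quotients at [c]. So the quotients of [f] are close, uniformly in the
    increment, to those of an approximant, which have a limit. *)
Lemma uniform_limit_cderiv f c (rho : R) : 0 < rho ->
  (forall e : R, 0 < e -> exists g,
    (forall z, normc (z - c) <= rho -> exists D, cderiv g z D) /\
    (forall z, normc (z - c) <= rho -> normc (g z - f z) <= e)) ->
  exists D, cderiv f c D.
Proof.
move=> rho0 H; apply: cderiv_approx => e e0.
(* the constant of [lipschitz_estimate] for a difference bounded by [2 e'] is
[k * e']; the choice of [e'] makes it at most [e / 2] *)
pose k := 8 / rho.
have k0 : 0 < k by rewrite divr_gt0.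
pose e' := e / 2 / (k + 1).
have e'0 : 0 < e' by rewrite !divr_gt0//; lra.
have crho : normc (c - c) <= rho by rewrite subrr normc_zero ltW.
have [g [dg gf]] := H _ e'0.
have [D gD] := dg c crho.
have [d d0 dP] := gD (e / 2) ltac:(lra).
exists D, (Num.min d (rho / 2)); first by rewrite lt_min d0; lra.
move=> w; rewrite lt_min => /andP[wd wr].
have wrho : normc (c + w - c) <= rho.
  by rewrite addrAC subrr add0r; have := normc_ge0 w; lra.
have : normc ((f (c + w) - f c) - (g (c + w) - g c)) <= e / 2 * normc w.
  apply/ler_addgt0Pr => eta eta0.
  have et : 0 < Num.min (eta / 2) e' by rewrite lt_min e'0 andbT; lra.
  have [h [dh hf]] := H _ et.
  have d1 z : normc (z - c) <= rho -> exists D', cderiv (fun z => h z - g z) z D'.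
    move=> zr; have [D1 H1] := dg z zr; have [D2 H2] := dh z zr.
    by exists (D2 - D1); exact: cderivB.
  have d2 z : normc (z - c) <= rho -> normc (h z - g z) <= 2 * e'.
    move=> zr; have := gf z zr; have := hf z zr; rewrite le_min => /andP[_ h1] h2.
    by have := normcBD (h z) (g z) (f z); rewrite [normc (f z - _)]normcB; lra.
  have L := lipschitz_estimate rho0 d1 d2 wr.
  have := hf _ wrho; rewrite le_min => /andP[h1 _].
  have := hf _ crho; rewrite le_min => /andP[h2 _].
  have -> : f (c + w) - f c - (g (c + w) - g c) =
    (h (c + w) - g (c + w) - (h c - g c)) - (h (c + w) - f (c + w)) + (h c - f c) by ring.
  rewrite (le_trans (normcD _ _))// (le_trans (lerD (normcD _ _) (lexx _)))// normc_opp.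
  have : 4 * (2 * e') / rho * normc w <= e / 2 * normc w.
    rewrite ler_wpM2r ?normc_ge0//.
    have -> : 4 * (2 * e') / rho = e / 2 * (k / (k + 1)).
      rewrite /e' /k; field; rewrite gt_eqF//= gt_eqF//; lra.
    rewrite ler_piMr//; first lra.
    rewrite ler_pdivrMr; lra.
  lra.
have := dP w wd.
rewrite (_ : f (c + w) - f c - D * w = (f (c + w) - f c - (g (c + w) - g c)) +
  (g (c + w) - g c - D * w)); last by ring.
move=> h1 h2; rewrite (le_trans (normcD _ _))//; lra.
Qed.

End CauchyEstimate.

(** * Almost periodic functions in a strip *)

Section AlmostPeriodic.
Context {R : realType}.
Notation C := R[i].
Variables alpha beta : \bar R.
Implicit Types (f g h : C -> C) (z w : C) (t tau : R).

Local Notation in_dom := (in_dom alpha beta).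
Local Notation reduced := (reduced alpha beta).
Local Notation almost_periodic := (almost_periodic alpha beta).

Lemma reduced_in_dom (s1 s2 sigma : R) : reduced s1 s2 -> s1 <= sigma <= s2 -> in_dom sigma.
Proof.
move=> [a1 _ b2] /andP[h1 h2]; split.
  by rewrite (lt_le_trans a1)// lee_fin.
by rewrite (le_lt_trans _ b2)// lee_fin.
Qed.

Lemma reduced_around (sigma : R) : in_dom sigma ->
  exists s1 s2, [/\ reduced s1 s2, s1 < sigma & sigma < s2].
Proof.
move=> [al sb].
have [s1 a1 h1] : exists2 s1 : R, (alpha < s1%:E)%E & s1 < sigma.
  case: (alpha) al => [a| |] //; last by exists (sigma - 1); rewrite ?ltNyr//; lra.
  by rewrite lte_fin => h; exists ((a + sigma) / 2); rewrite ?lte_fin; lra.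
have [s2 b2 h2] : exists2 s2 : R, (s2%:E < beta)%E & sigma < s2.
  case: (beta) sb => [b| |] //; last by exists (sigma + 1); rewrite ?ltry//; lra.
  by rewrite lte_fin => h; exists ((b + sigma) / 2); rewrite ?lte_fin; lra.
by exists s1, s2; split => //; split => //; lra.
Qed.

Lemma strip_vshift (s1 s2 : R) (s : C) t : strip s1 s2 s -> strip s1 s2 (s + t *i).
Proof. by rewrite /strip/= ReD/= addr0. Qed.

Lemma vtranslate0 f : vtranslate 0 f = f.
Proof. by apply/funext => s; rewrite /vtranslate; congr f; rewrite -[RHS]addr0. Qed.

Lemma holomorphic_cderiv f (s : C) : holomorphic_on_U alpha beta f ->
  in_dom (complex.Re s) -> exists D, cderiv f s D.
Proof. by move=> hf /hf /derivableP_cderiv. Qed.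

Lemma holomorphic_continuous f (s : C) : holomorphic_on_U alpha beta f ->
  in_dom (complex.Re s) -> forall e : R, 0 < e ->
  exists2 d : R, 0 < d & forall w, normc w < d -> normc (f (s + w) - f s) <= e.
Proof. by move=> hf /(holomorphic_cderiv hf)[D /cderiv_continuous]. Qed.

(** A property that holds locally near each point of a compact rectangle, from some
    stage on, holds on the whole rectangle from some stage on. *)
Lemma rectangle_near (F : set_system R) (FF : Filter F) (P : R -> C -> Prop)
    (s1 s2 a b : R) :
  (forall s : C, strip s1 s2 s -> a <= complex.Im s <= b ->
    exists2 r : R, 0 < r &
      \forall d \near F, forall w, normc w < r -> P d (s + w)) ->
  \forall d \near F, forall s : C, strip s1 s2 s -> a <= complex.Im s <= b -> P d s.
Proof.
move=> H.
have cK : compact (`[s1, s2] `*` `[a, b]).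
  by apply: compact_setX; exact: segment_compact.
pose P' d (p : R * R) := P d (p.1 +i* p.2).
have cov x : (`[s1, s2] `*` `[a, b]) x -> \forall x' \near x & d \near F, P' d x'.
  case: x => x y [/=]; rewrite !in_itv/= => xs yab.
  have [r r0 rP] := H (x +i* y) xs yab.
  exists (ball (x, y) (r / 2), [set d | forall w, normc w < r -> P d ((x +i* y) + w)]).
    by split => //=; apply: nbhsx_ballx; lra.
  move=> [[x' y'] d] /= [[/= bx by_] Pd]; rewrite /P' /=.
  have -> : x' +i* y' = (x +i* y) + ((x' - x) +i* (y' - y)).
    by simpc; congr (_ +i* _); ring.
  apply: Pd; rewrite (le_lt_trans (normc_le_ReIm _))//=.
  move: bx by_; rewrite /ball/= distrC [`|y - y'|]distrC; lra.
apply: filterS ((compact_near_coveringP _).1 cK R F P' FF cov) => d Pd [x y] xs yab.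
by apply: (Pd (x, y)); split; rewrite /= in_itv.
Qed.

Section OneFunction.
Variable f : C -> C.
Hypothesis apf : almost_periodic f.

(** Some almost period moves any given point into the rectangle of height [l].
    Properties of [f] on the strip are thus read on a compact set. *)
Lemma almost_period_into s1 s2 (e : R) : reduced s1 s2 -> 0 < e ->
  exists2 l : R, 0 < l & forall s : C, exists2 tau : R,
    0 <= complex.Im (s + tau *i) <= l &
    forall z, strip s1 s2 z -> normc (f (z + tau *i) - f z) <= e.
Proof.
move=> rs e0; have [l l0 H] := apf.2 e s1 s2 e0 rs.
exists l => // s; have [tau taub tauP] := H (- complex.Im s).
by exists tau => //; rewrite ImD/=; lra.
Qed.

Lemma almost_periodic_unif_vcontinuous s1 s2 (e : R) : reduced s1 s2 -> 0 < e ->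
  exists2 d : R, 0 < d & forall s : C, strip s1 s2 s ->
    forall eta, `|eta| <= d -> normc (f (s + eta *i) - f s) <= e.
Proof.
move=> rs e0; have e3 : 0 < e / 3 by lra.
have [l l0 lP] := almost_period_into rs e3.
have : \forall d \near (0 : R)^'+, forall s : C, strip s1 s2 s ->
    0 <= complex.Im s <= l -> forall eta, `|eta| <= d -> normc (f (s + eta *i) - f s) <= e / 3.
  apply: rectangle_near => s ss _.
  have [d d0 dP] := holomorphic_continuous apf.1 (reduced_in_dom rs ss)
    (ltac:(lra) : 0 < e / 6).
  exists (d / 2); first lra.
  near=> d' => w wd eta etad.
  have d'd : d' < d / 2 by near: d'; apply: nbhs_right_lt; lra.
  have K1 := dP w ltac:(lra).
  have -> : s + w + eta *i = s + (w + eta *i) by rewrite addrA.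
  have K2 : normc (f (s + (w + eta *i)) - f s) <= e / 6.
    apply: dP; rewrite (le_lt_trans (normcD _ _))//.
    have : normc (eta *i) <= `|eta|.
      by rewrite (le_trans (normc_le_ReIm _))//= normr0 add0r.
    lra.
  have := normcBD (f (s + (w + eta *i))) (f (s + w)) (f s).
  rewrite [normc (f s - _)]normcB; lra.
move=> near_d.
have [d d0 dP] : exists2 d : R, 0 < d & forall s : C, strip s1 s2 s ->
    0 <= complex.Im s <= l -> forall eta, `|eta| <= d -> normc (f (s + eta *i) - f s) <= e / 3.
  near (0 : R)^'+ => d; exists d; first by near: d; exact: nbhs_right_gt.
  by near: d.
exists d => // s ss eta etad; have [tau taul tauP] := lP s.
have h1 := tauP _ ss; have h2 := tauP _ (strip_vshift eta ss).
have h3 := dP _ (strip_vshift tau ss) taul eta etad.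
have E : s + tau *i + eta *i = s + eta *i + tau *i by rewrite addrAC.
rewrite E in h3.
have := normcBD (f (s + eta *i)) (f s) (f (s + eta *i + tau *i)).
have := normcBD (f (s + eta *i + tau *i)) (f s) (f (s + tau *i)).
rewrite [normc (f (s + eta *i) - f (s + eta *i + tau *i))]normcB; lra.
Unshelve. all: by end_near. Qed.

Lemma almost_periodic_bounded s1 s2 : reduced s1 s2 ->
  exists M : R, forall s : C, strip s1 s2 s -> normc (f s) <= M.
Proof.
move=> rs; have [l l0 lP] := almost_period_into rs ltr01.
have near_M : \forall M \near +oo%R, forall s : C, strip s1 s2 s ->
    0 <= complex.Im s <= l -> normc (f s) <= M.
  apply: rectangle_near => s ss _.
  have [d d0 dP] := holomorphic_continuous apf.1 (reduced_in_dom rs ss) ltr01.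
  exists d => //; near=> M => w wd.
  have : normc (f s) + 1 <= M by near: M; apply: nbhs_pinfty_ge; exact: num_real.
  have := dP w wd; have := normcD (f (s + w) - f s) (f s); rewrite subrK; lra.
have [M MP] : exists M : R, forall s : C, strip s1 s2 s ->
    0 <= complex.Im s <= l -> normc (f s) <= M.
  by near (pinfty_nbhs R) => M; exists M; near: M.
exists (M + 1) => s ss; have [tau taul tauP] := lP s.
have := MP _ (strip_vshift tau ss) taul; have := tauP _ ss.
have := normcBD (f s) 0 (f (s + tau *i)); rewrite !subr0.
rewrite [normc (f s - _)]normcB; lra.
Unshelve. all: by end_near. Qed.

(** An almost period brings [tau] into [0, l], and there [tau] is replaced by a
    multiple of the step [d] that vertical uniform continuity provides. *)
Lemma almost_periodic_totally_bounded s1 s2 (e : R) : reduced s1 s2 -> 0 < e ->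
  exists (N : nat) (t : nat -> R), forall tau, exists2 k, (k < N)%N &
    forall s : C, strip s1 s2 s ->
      normc (vtranslate tau f s - vtranslate (t k) f s) <= e.
Proof.
move=> rs e0; have e2 : 0 < e / 2 by lra.
have [l l0 lP] := apf.2 _ s1 s2 e2 rs.
have [d d0 dP] := almost_periodic_unif_vcontinuous rs e2.
exists (Num.truncn (l / d)).+1, (fun k => k%:R * d) => tau.
have [p /andP[p1 p2] pP] := lP (- tau).
have tp0 : 0 <= tau + p by lra.
exists (Num.truncn ((tau + p) / d)).
  by rewrite ltnS le_truncn// ler_wpM2r ?invr_ge0 ?(ltW d0)//; lra.
move=> s ss; rewrite /vtranslate; set k := Num.truncn _.
have h1 := pP _ (strip_vshift tau ss).
have /andP[k1 k2] : k%:R <= (tau + p) / d < k.+1%:R.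
  by apply: truncn_itv; rewrite divr_ge0// ltW.
rewrite ler_pdivlMr// in k1; rewrite ltr_pdivrMr// -natr1 mulrDl mul1r in k2.
have := dP _ (strip_vshift (k%:R * d) ss) (tau + p - k%:R * d).
have -> : s + (k%:R * d) *i + (tau + p - k%:R * d) *i = s + tau *i + p *i.
  by rewrite -!addrA; congr (_ + _); simpc; congr (_ +i* _); ring.
move=> /(_ _)/= h2.
have {}h2 := h2 ltac:(rewrite ler_norml; lra).
have := normcBD (f (s + tau *i)) (f (s + (k%:R * d) *i)) (f (s + tau *i + p *i)).
rewrite [normc (f (s + tau *i) - f (s + tau *i + p *i))]normcB.
rewrite /vtranslate in h1; lra.
Qed.

End OneFunction.
End AlmostPeriodic.

(** * The hull of an almost periodic function *)

Section Ultrafilters.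

Lemma ultra_bigcup (T : Type) (U : set_system T) (UU : UltraFilter U)
    (A : nat -> set T) N :
  U [set t | exists2 k, (k < N)%N & A k t] -> exists2 k, (k < N)%N & U (A k).
Proof.
elim: N => [|N IH] H.
  by have [t [k]] := filter_ex H.
have [UA|UA] := in_ultra_setVsetC (A N) UU; first by exists N.
have [|k kN Uk] := IH; last by exists k => //; rewrite ltnS ltnW.
apply: filterS (filterI H UA) => t [[k]]; rewrite ltnS leq_eqVlt => /predU1P[->//|kN] Ak _.
by exists k.
Qed.

End Ultrafilters.

Section Hull.
Context {R : realType}.
Notation C := R[i].
Variables alpha beta : \bar R.
Implicit Types (f g h : C -> C) (z w : C) (t tau : R).

Local Notation in_dom := (in_dom alpha beta).
Local Notation reduced := (reduced alpha beta).
Local Notation almost_periodic := (almost_periodic alpha beta).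

(** The closure of the vertical translates of [f] among functions, before any
    passage to classes. *)
Definition hull f : set (C -> C) := [set h | forall s1 s2 e : R,
  reduced s1 s2 -> 0 < e -> exists tau, forall s, strip s1 s2 s ->
    normc (h s - vtranslate tau f s) <= e].

Lemma hull_vtranslate f tau : hull f (vtranslate tau f).
Proof.
move=> s1 s2 e _ e0; exists tau => s _.
by rewrite subrr normc_zero ltW.
Qed.

(** The almost periods of [f] for a given precision are almost periods of [h], and
    holomorphy passes to uniform limits. *)
Lemma hull_almost_periodic f h : almost_periodic f -> hull f h -> almost_periodic h.
Proof.
move=> apf hh; split.
- move=> s sd; apply/derivableP_cderiv.
  have [s1 [s2 [rs s1s ss2]]] := reduced_around sd.
  pose rho := Num.min (complex.Re s - s1) (s2 - complex.Re s).
  have rho0 : 0 < rho by rewrite lt_min; lra.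
  have ball_strip z : normc (z - s) <= rho -> strip s1 s2 z.
    move=> zs; have := ler_Re_normc (z - s); rewrite ReD ReN ler_norml /strip/=.
    move: zs; rewrite le_min => /andP[h1 h2] /andP[h3 h4]; lra.
  apply: (@uniform_limit_cderiv _ h s rho) => // e e0.
  have [tau tauP] := hh s1 s2 e rs e0.
  exists (vtranslate tau f); split; last first.
    by move=> z /ball_strip /tauP; rewrite normcB.
  move=> z /ball_strip zs.
  have [|D HD] := @holomorphic_cderiv _ _ _ f (z + tau *i) apf.1.
    exact: (reduced_in_dom rs (strip_vshift tau zs)).
  exists D => e' e'0; have [d d0 dP] := HD e' e'0.
  by exists d => // w wd; rewrite /vtranslate (addrAC z); exact: dP.
- move=> e s1 s2 e0 rs; have e3 : 0 < e / 3 by lra.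
  have [l l0 lP] := apf.2 _ s1 s2 e3 rs.
  exists l => // x; have [p pl pP] := lP x; exists p => // s ss.
  have [tau tauP] := hh s1 s2 _ rs e3.
  have h1 := tauP s ss; have h2 := tauP _ (strip_vshift p ss).
  have h3 := pP _ (strip_vshift tau ss).
  have E : vtranslate p f (s + tau *i) = vtranslate tau f (s + p *i).
    by rewrite /vtranslate (addrAC s).
  rewrite E in h3.
  have := normcBD (vtranslate p h s) (h s) (vtranslate tau f (s + p *i)).
  have := normcBD (vtranslate tau f (s + p *i)) (h s) (vtranslate tau f s).
  rewrite [normc (vtranslate tau f s - h s)]normcB.
  rewrite /vtranslate in h1 h2 h3 *; lra.
Qed.

(** Bochner's compactness property. On each strip the hull is covered by finitely
    many balls centred at translates of [f], and the ultrafilter selects one of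
    them. So [k] is Cauchy along it, uniformly on the strip. *)
Lemma hull_limit f (T : Type) (U : set_system T) (k : T -> C -> C) :
  almost_periodic f -> UltraFilter U -> U [set t | hull f (k t)] ->
  exists2 h, hull f h & forall s1 s2 e : R, reduced s1 s2 -> 0 < e ->
    U [set t | forall s, strip s1 s2 s -> normc (k t s - h s) <= e].
Proof.
move=> apf UU Uk.
have near_translate s1 s2 e : reduced s1 s2 -> 0 < e -> exists tau,
    U [set t | forall s, strip s1 s2 s -> normc (k t s - vtranslate tau f s) <= e].
  move=> rs e0; have e2 : 0 < e / 2 by lra.
  have [N [tt ttP]] := almost_periodic_totally_bounded apf rs e2.
  have [|j _ Uj] := @ultra_bigcup T U UU (fun j => [set t | forall s, strip s1 s2 s ->
      normc (k t s - vtranslate (tt j) f s) <= e]) N; last by exists (tt j).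
  apply: filterS Uk => t /= /(_ s1 s2 _ rs e2)[tau tauP].
  have [j jN jP] := ttP tau; exists j => // s ss.
  have := tauP s ss; have := jP s ss.
  have := normcBD (k t s) (vtranslate (tt j) f s) (vtranslate tau f s); lra.
have /choice[h hP] : forall s : C, exists c, in_dom (complex.Re s) ->
    forall e : R, 0 < e -> U [set t | normc (k t s - c) <= e].
  move=> s; have [sd|] := pselect (in_dom (complex.Re s)); last by exists 0.
  have [s1 [s2 [rs s1s ss2]]] := reduced_around sd.
  have ss : strip s1 s2 s by rewrite /strip/=; lra.
  have /choice[m mP] : forall e : R, exists tau, 0 < e -> U [set t | forall s,
      strip s1 s2 s -> normc (k t s - vtranslate tau f s) <= e].
    by move=> e; have [/(near_translate _ _ _ rs)[tau]|] := pselect (0 < e); [exists tau|exists 0].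
  have [c cP] : exists c, forall e : R, 0 < e ->
      normc (vtranslate (m e) f s - c) <= 2 * e.
    apply: (@complete_C R (fun e => vtranslate (m e) f s)) => e e' e0 e'0.
    have [t [t1 t2]] := filter_ex (filterI (mP e e0) (mP e' e'0)).
    have := t1 s ss; have := t2 s ss.
    have := normcBD (vtranslate (m e) f s) (vtranslate (m e') f s) (k t s).
    rewrite [normc (_ - k t s)]normcB; lra.
  exists c => _ e e0; have e3 : 0 < e / 3 by lra.
  apply: filterS (mP _ e3) => t /= /(_ s ss) h1.
  have := cP _ e3; have := normcBD (k t s) c (vtranslate (m (e / 3)) f s); lra.
have unif s1 s2 e : reduced s1 s2 -> 0 < e ->
    U [set t | forall s, strip s1 s2 s -> normc (k t s - h s) <= e].
  move=> rs e0; have e3 : 0 < e / 3 by lra.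
  have [tau Utau] := near_translate _ _ _ rs e3.
  apply: filterS (Utau) => t /= tP s ss.
  have sd := reduced_in_dom rs ss.
  have [t' [t'1 t'2]] := filter_ex (filterI Utau (hP s sd _ e3)).
  have := t'1 s ss; have := tP s ss; move: t'2 => /=.
  have := normcBD (k t s) (h s) (vtranslate tau f s).
  have := normcBD (vtranslate tau f s) (h s) (k t' s).
  rewrite [normc (vtranslate tau f s - k t' s)]normcB; lra.
exists h => // s1 s2 e rs e0; have e2 : 0 < e / 2 by lra.
have [t [t1 t2]] := filter_ex (filterI Uk (unif _ _ _ rs e2)).
have [tau tauP] := t1 s1 s2 _ rs e2; exists tau => s ss.
have := tauP s ss; have := t2 s ss.
have := normcBD (h s) (vtranslate tau f s) (k t s).
rewrite [normc (h s - k t s)]normcB; lra.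
Qed.

End Hull.

(** * Rational independence *)

Section RationalIndependence.
Context {R : realType}.
Implicit Types (mu lam theta : nat -> R) (m n : nat).

Definition rat_independent m mu := forall q : nat -> rat,
  \sum_(k < m) ratr (q k) * mu k = 0 -> forall k, (k < m)%N -> q k = 0.

Definition rat_span m mu : set R :=
  [set x | exists q : nat -> rat, x = \sum_(k < m) ratr (q k) * mu k].

Lemma common_denominator (q : nat -> rat) m : exists D : int, D != 0 /\
  exists z : nat -> int, forall k, (k < m)%N -> q k * D%:~R = (z k)%:~R.
Proof.
elim: m => [|m [D [D0 [z zP]]]]; first by exists 1; split => //; exists (fun=> 0).
exists (D * denq (q m)); split; first by rewrite mulf_neq0// denq_neq0.
exists (fun k => if k == m then D * numq (q m) else z k * denq (q m)) => k.
rewrite ltnS leq_eqVlt; have [->|km] /= := eqVneq k m.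
  move=> _; rewrite !intrM mulrCA; congr (_ * _).
  by rewrite numqE.
by move=> /zP zk; rewrite !intrM mulrA zk.
Qed.

(** Either the family extended by [x] stays independent, or a relation that
    involves [x] expresses it through the family. *)
Lemma rat_dependence m mu x : rat_independent m mu ->
  rat_independent m.+1 (fun k => if (k < m)%N then mu k else x) \/ rat_span m mu x.
Proof.
move=> ind; set mu' := (X in rat_independent _ X).
have [sx|nsx] := pselect (rat_span m mu x); [by right|left => q].
rewrite big_ord_recr/= /mu' ltnn => E.
have {}E : \sum_(k < m) ratr (q k) * mu k + ratr (q m) * x = 0.
  by rewrite -[RHS]E; congr (_ + _); apply: eq_bigr => k _; rewrite ltn_ord.
have [qm0|qm0] := eqVneq (q m) 0.
  move: E; rewrite qm0 rmorph0 mul0r addr0 => /ind H k.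
  by rewrite ltnS leq_eqVlt => /predU1P[->//|/H].
exfalso; apply: nsx; exists (fun k => - (q k / q m)).
have r0 : ratr (q m) != 0 :> R by rewrite fmorph_eq0.
apply: (mulfI r0); rewrite mulr_sumr; apply: (addrI (\sum_(k < m) ratr (q k) * mu k)).
rewrite E -big_split/=; apply/esym/big1 => k _.
rewrite rmorphN/= fmorph_div mulrA mulrN mulrCA mulfV// mulr1; ring.
Qed.

Lemma rat_spanZ m mu (r : rat) x : rat_span m mu x -> rat_span m mu (ratr r * x).
Proof.
move=> [q ->]; exists (fun k => r * q k); rewrite mulr_sumr.
by apply: eq_bigr => k _; rewrite rmorphM/= mulrA.
Qed.

Lemma rat_spanS m mu x : rat_span m mu x -> rat_span m.+1 mu x.
Proof.
move=> [q ->]; exists (fun k => if (k < m)%N then q k else 0).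
rewrite big_ord_recr/= ltnn rmorph0 mul0r addr0.
by apply: eq_bigr => k _; rewrite ltn_ord.
Qed.

Lemma rat_span_gen m mu k : (k < m)%N -> rat_span m mu (mu k).
Proof.
move=> km; exists (fun i => (i == k)%:R).
rewrite (bigD1 (Ordinal km))//= eqxx rmorph1 mul1r big1 ?addr0// => i.
by rewrite -val_eqE/= => /negbTE ->; rewrite rmorph0 mul0r.
Qed.

(** A finitely generated group of reals is free, on a rationally independent
    family. A new generator either extends the family, or is a rational combination
    of it; in the latter case the family is divided by a common denominator. *)
Lemma integral_basis lam n : exists m mu, [/\ rat_independent m mu,
  forall j, (j < n)%N -> exists z : nat -> int, lam j = \sum_(k < m) (z k)%:~R * mu k &
  forall k, (k < m)%N -> rat_span n lam (mu k)].
Proof.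
elim: n => [|n [m [mu [ind gen sp]]]].
  by exists 0%N, (fun=> 0); split => // q _ k.
have [ind'|[q qE]] := rat_dependence (lam n) ind.
  exists m.+1, (fun k => if (k < m)%N then mu k else lam n); split => // [j|k].
    rewrite ltnS leq_eqVlt => /predU1P[->|/gen[z zE]].
      exists (fun k => (k == m)%:R); rewrite big_ord_recr/= ltnn eqxx mul1r big1 ?add0r// => k _.
      by rewrite (ltn_eqF (ltn_ord k)) mul0r.
    exists (fun k => if (k < m)%N then z k else 0).
    rewrite big_ord_recr/= ltnn mul0r addr0 zE.
    by apply: eq_bigr => k _; rewrite ltn_ord.
  by case: ifPn => [km _|_ _]; [exact/rat_spanS/sp|exact: rat_span_gen].
have [D [D0 [z zP]]] := common_denominator q m.
have DR : D%:~R != 0 :> R by rewrite intr_eq0.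
exists m, (fun k => mu k / D%:~R); split.
- move=> p E; apply: ind; apply: (mulIf (_ : (D%:~R^-1 : R) != 0)); first by rewrite invr_eq0.
  by rewrite mul0r -[RHS]E mulr_suml; apply: eq_bigr => k _; rewrite mulrA.
- move=> j; rewrite ltnS leq_eqVlt => /predU1P[->|/gen[w wE]].
    exists z; rewrite qE; apply: eq_bigr => k _.
    have := congr1 (ratr : rat -> R) (zP k (ltn_ord k)).
    by rewrite rmorphM !ratr_int /= => <-; field.
  exists (fun k => w k * D); rewrite wE; apply: eq_bigr => k _.
  by rewrite intrM; field.
- move=> k km; rewrite mulrC.
  have -> : D%:~R^-1 * mu k = ratr (D%:~R^-1 : rat) * mu k.
    by rewrite fmorphV /= ratr_int.
  exact/rat_spanZ/rat_spanS/sp.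
Qed.

(** Independence makes coordinates in the family unique. *)
Lemma rat_linear_extension m mu theta : rat_independent m mu ->
  exists2 psi : R -> R, Qlinear_on (rat_span m mu) psi &
    forall z : nat -> int, psi (\sum_(k < m) (z k)%:~R * mu k) =
      \sum_(k < m) (z k)%:~R * theta k.
Proof.
move=> ind.
have /choice[psi psiP] : forall x, exists y, forall q : nat -> rat,
    x = \sum_(k < m) ratr (q k) * mu k -> y = \sum_(k < m) ratr (q k) * theta k.
  move=> x; have [[q0 xE]|n] := pselect (rat_span m mu x); last first.
    by exists 0 => q xE; exfalso; apply: n; exists q.
  exists (\sum_(k < m) ratr (q0 k) * theta k) => q xE'.
  apply: eq_bigr => k _; congr (ratr _ * _); apply/eqP; rewrite -subr_eq0; apply/eqP.
  apply: (ind (fun k => q0 k - q k)) => //.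
  under eq_bigr do rewrite rmorphB/= mulrBl.
  by rewrite sumrB -xE -xE' subrr.
have psiE (q : nat -> rat) :
    psi (\sum_(k < m) ratr (q k) * mu k) = \sum_(k < m) ratr (q k) * theta k.
  by rewrite (psiP _ q erefl).
exists psi; last first.
  move=> z; have E (th : nat -> R) :
      \sum_(k < m) (z k)%:~R * th k = \sum_(k < m) ratr (z k)%:~R * th k.
    by apply: eq_bigr => k _; rewrite ratr_int.
  by rewrite !E (psiE (fun k => (z k)%:~R)).
split.
- move=> _ _ [p ->] [q ->]; have E (th : nat -> R) :
      \sum_(k < m) ratr (p k) * th k + \sum_(k < m) ratr (q k) * th k =
      \sum_(k < m) ratr (p k + q k) * th k.
    by rewrite -big_split/=; apply: eq_bigr => k _; rewrite rmorphD/= mulrDl.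
  by rewrite !psiE !E (psiE (fun k => p k + q k)).
- move=> r _ [p ->]; have E (th : nat -> R) :
      ratr r * \sum_(k < m) ratr (p k) * th k = \sum_(k < m) ratr (r * p k) * th k.
    by rewrite mulr_sumr; apply: eq_bigr => k _; rewrite rmorphM/= mulrA.
  by rewrite !psiE !E (psiE (fun k => r * p k)).
Qed.

Lemma Qlinear_on_sum n lam (psi : R -> R) m mu (z : nat -> int) :
  Qlinear_on (rat_span n lam) psi -> (forall k, (k < m)%N -> rat_span n lam (mu k)) ->
  psi (\sum_(k < m) (z k)%:~R * mu k) = \sum_(k < m) (z k)%:~R * psi (mu k).
Proof.
move=> [psiD psiZ] sp.
have span0 : rat_span n lam 0.
  by exists (fun=> 0); rewrite big1// => k _; rewrite rmorph0 mul0r.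
have spanD x y : rat_span n lam x -> rat_span n lam y -> rat_span n lam (x + y).
  move=> [p ->] [q ->]; exists (fun k => p k + q k); rewrite -big_split/=.
  by apply: eq_bigr => k _; rewrite rmorphD/= mulrDl.
have psi0 : psi 0 = 0.
  by have := psiZ 0 0 span0; rewrite rmorph0 !mul0r.
suff [] : rat_span n lam (\sum_(k < m) (z k)%:~R * mu k) /\
  psi (\sum_(k < m) (z k)%:~R * mu k) = \sum_(k < m) (z k)%:~R * psi (mu k) by [].
apply: (big_ind2 (fun x y => rat_span n lam x /\ psi x = y)) => //.
  by move=> x _ y _ [sx <-] [sy <-]; split; [exact: spanD|exact: psiD].
move=> k _; have sk := sp k (ltn_ord k).
rewrite -[X in X * mu k]ratr_int -[X in _ = X * _]ratr_int.
by split; [exact: rat_spanZ|exact: psiZ].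
Qed.

Lemma Qlinear_onS (V W : set R) (psi : R -> R) : V `<=` W ->
  Qlinear_on W psi -> Qlinear_on V psi.
Proof.
by move=> VW [H1 H2]; split => [x y /VW Wx /VW Wy|q x /VW Wx]; [exact: H1|exact: H2].
Qed.

End RationalIndependence.

(** * Characters of the line *)

Section Characters.
Context {R : realType}.
Notation C := R[i].

Definition character (chi : R -> C) :=
  (forall x y, chi (x + y) = chi x * chi y) /\ chi 0 = 1.

Lemma characterN chi x : character chi -> chi (- x) = (chi x)^-1.
Proof.
move=> [chiD chi0]; have E : chi x * chi (- x) = 1 by rewrite -chiD subrr.
have x0 : chi x != 0.
  by apply/eqP => x0; move: E; rewrite x0 mul0r => /eqP; rewrite eq_sym oner_eq0.
by apply: (mulfI x0); rewrite E mulfV.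
Qed.

Lemma character_expi (t : R) : character (fun x => expi (x * t)).
Proof. by split=> [x y|]; rewrite ?mul0r ?expi0// mulrDl expiD. Qed.

Lemma character_expi_sum chi m (mu theta : nat -> R) : character chi ->
  (forall k, (k < m)%N -> chi (mu k) = expi (theta k)) ->
  forall z : nat -> int, chi (\sum_(k < m) (z k)%:~R * mu k) =
    expi (\sum_(k < m) (z k)%:~R * theta k).
Proof.
move=> chiP H z; have [chiD chi0] := chiP.
have [eD e0] := character_expi 1.
apply: (big_ind2 (fun x y => chi x = expi y)) => [|x y x' y' Hx Hx'|k _].
- by rewrite chi0 expi0.
- by rewrite chiD Hx Hx' expiD.
have Hk := H k (ltn_ord k).
have Hn (n : nat) : chi (n%:R * mu k) = expi (n%:R * theta k).
  elim: n => [|n IH]; first by rewrite !mul0r chi0 expi0.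
  by rewrite -natr1 !mulrDl !mul1r chiD IH Hk expiD.
case: (z k) => n; first exact: Hn.
rewrite NegzE mulrNz !mulNr characterN// Hn.
by have := characterN (n.+1%:R * theta k) (character_expi 1); rewrite !mulr1.
Qed.

End Characters.

(** * Kronecker's theorem *)

Section Kronecker.
Context {R : realType}.
Notation C := R[i].
Implicit Types (s : seq (C * R)) (c : C).

(** Averaging a trigonometric polynomial with its translate by [pi / nu] kills the
    frequency [nu], keeps the constant term and does not increase the supremum.
    The frequencies are removed one at a time. *)
Lemma constant_term_bound s c (M : R) : all (fun p => p.2 != 0) s ->
  (forall t : R, normc (c + \sum_(p <- s) p.1 * expi (p.2 * t)) <= M) -> normc c <= M.
Proof.
have [n] := ubnP (size s); elim: n s => // n IH [_|[a nu] s] /=.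
  by move=> _ /(_ 0); rewrite big_nil addr0.
rewrite ltnS => sn /andP[nu0 s0] H.
pose h := pi / nu.
pose s' := [seq (p.1 * (1 + expi (p.2 * h)) / 2, p.2) | p <- s].
apply: (IH s'); first by rewrite size_map.
  by rewrite all_map; apply: sub_all s0.
move=> t.
have -> : c + \sum_(p <- s') p.1 * expi (p.2 * t) =
   ((c + \sum_(p <- (a, nu) :: s) p.1 * expi (p.2 * t)) +
    (c + \sum_(p <- (a, nu) :: s) p.1 * expi (p.2 * (t + h)))) / 2.
  rewrite !big_cons /= big_map /=.
  have -> : expi (nu * (t + h)) = - expi (nu * t) :> C.
    rewrite mulrDr expiD /h [nu * (pi / nu)]mulrC divfK// /expi cospi sinpi.
    by simpc.
  have -> : \sum_(p <- s) p.1 * (1 + expi (p.2 * h)) / 2 * expi (p.2 * t) =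
      (\sum_(p <- s) p.1 * expi (p.2 * t) + \sum_(p <- s) p.1 * expi (p.2 * (t + h))) / 2.
    rewrite -big_split/= mulr_suml; apply: eq_bigr => p _.
    by rewrite [p.2 * (t + h)]mulrDr expiD; field.
  by field.
rewrite normcM ComplexField.Normc.normcV.
have -> : normc (2 : C) = 2.
  by rewrite (_ : 2 = (2 : R)%:C) ?normc_real ?normr_nat// rmorph_nat.
rewrite ler_pdivrMr// (le_trans (normcD _ _))//.
have := H t; have := H (t + h); lra.
Qed.

(** Multiplication by [expi (- nu i0 * t)] makes [c i0] the constant term. *)
Lemma coefficient_bound (I : finType) (c : I -> C) (nu : I -> R) (i0 : I) (M : R) :
  (forall t : R, normc (\sum_i c i * expi (nu i * t)) <= M) ->
  (forall i, nu i = nu i0 -> i = i0) -> normc (c i0) <= M.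
Proof.
move=> H inj.
apply: (@constant_term_bound [seq (c i, nu i - nu i0) | i <- index_enum I & i != i0]).
  rewrite all_map; apply/allP => i /=; rewrite mem_filter => /andP[ii0 _].
  by rewrite subr_eq0; apply: contra ii0 => /eqP/inj ->.
move=> t; rewrite big_map big_filter/=.
have := H t; rewrite -[X in X <= _](mulr1) -[X in _ * X <= _](normc_expi (- (nu i0 * t))).
rewrite -normcM mulr_suml (bigD1 i0)//= -mulrA -expiD subrr expi0 mulr1.
congr (normc (_ + _) <= _); apply: eq_bigr => i _.
by rewrite -mulrA -expiD; congr (_ * expi _); ring.
Qed.

Lemma expiMn (x : R) n : expi (n%:R * x) = expi x ^+ n.
Proof.
elim: n => [|n IH]; first by rewrite mul0r expi0.
by rewrite -natr1 mulrDl mul1r expiD IH exprSr.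
Qed.

(** The [N + 1] binomial coefficients add up to [2 ^ N]. *)
Lemma large_binomial N : exists2 j : nat, (j < N.+1)%N & (2 ^ N <= 'C(N, j) * N.+1)%N.
Proof.
apply: contrapT => H.
have {}H j : (j < N.+1)%N -> ('C(N, j) * N.+1 < 2 ^ N)%N.
  by move=> jN; rewrite ltnNge; apply/negP => le; apply: H; exists j.
have : (\sum_(j < N.+1) 'C(N, j) * N.+1 < \sum_(j < N.+1) 2 ^ N)%N.
  rewrite big_ord_recl [X in (_ < X)%N]big_ord_recl -addSn leq_add//; first exact: H.
  by apply: leq_sum => i _; exact/ltnW/H.
rewrite sum_nat_const card_ord -big_distrl/= mulnC ltn_mul2l/= ltnNge => /negP; apply.
rewrite leq_eqVlt; apply/orP; left; apply/eqP.
rewrite -[2%N]/(1 + 1)%N expnDn; apply: eq_bigr => i _.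
by rewrite !exp1n !muln1.
Qed.

(** [|(1 + w) / 2|^2 = 1 - |w - 1|^2 / 4] for [w] on the unit circle. *)
Lemma half_one_plus_expi (x d : R) : 0 <= d -> d <= normc (expi x - 1) ->
  normc ((1 + expi x) / 2) <= 1 - d ^+ 2 / 8.
Proof.
move=> d0 dx.
have e2 : 0 <= sin x ^+ 2 by rewrite sqr_ge0.
have cs := cos2Dsin2 x.
have d2 : d ^+ 2 <= 2 - 2 * cos x.
  have : d ^+ 2 <= normc (expi x - 1) ^+ 2 by rewrite ler_sqr ?nnegrE ?normc_ge0.
  rewrite /expi -[1]/(1 +i* 0); simpc => /=; rewrite sqr_sqrtr ?addr_ge0 ?sqr_ge0//; nra.
have c1 : -1 <= cos x by exact: cos_geN1.
have n2 : normc ((1 + expi x) / 2) ^+ 2 = (1 + cos x) / 2.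
  rewrite normcM ComplexField.Normc.normcV exprMn.
  have -> : normc (2 : C) = 2.
    by rewrite (_ : 2 = (2 : R)%:C) ?normc_real ?normr_nat// rmorph_nat.
  rewrite /expi -[1]/(1 +i* 0); simpc => /=; rewrite sqr_sqrtr ?addr_ge0 ?sqr_ge0//.
  nra.
have d8 : 0 <= 1 - d ^+ 2 / 8 by lra.
rewrite -ler_sqr ?nnegrE ?normc_ge0// n2.
have : 0 <= (d ^+ 2) ^+ 2 by rewrite sqr_ge0.
nra.
Qed.

Lemma bernoulli_expr (x : R) n : 0 <= x -> 1 + n%:R * x <= (1 + x) ^+ n.
Proof.
move=> x0; elim: n => [|n IH]; first by rewrite mul0r addr0.
have n0 : 0 <= n%:R * x * x by rewrite !mulr_ge0.
have x1 : 0 <= 1 + x by lra.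
by rewrite exprSr (le_trans _ (ler_wpM2r x1 IH))// -natr1; lra.
Qed.

Lemma exponential_beats_polynomial (eta : R) m : 0 < eta -> eta <= 1 ->
  exists N : nat, (1 - eta) ^+ N < (N.+1%:R ^-1) ^+ m.
Proof.
(* with [N = M (m + 1)] Bernoulli's inequality gives
[(1 - eta) ^+ N <= (1 + M eta) ^- (m + 1)], while [N + 1 <= K (1 + M eta)] *)
move=> eta0 eta1; pose K : R := m.+1%:R / eta.
have K1 : 1 <= K.
  by rewrite ler_pdivlMr// mul1r (le_trans eta1)// ler1n.
have K0 : 0 < K by lra.
have Km0 : 0 <= K ^+ m / eta by rewrite divr_ge0 ?exprn_ge0// ltW.
pose M := (Num.truncn (K ^+ m / eta)).+1.
have KM : K ^+ m < M%:R * eta.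
  by rewrite -ltr_pdivrMr//; have /andP[] := truncn_itv Km0.
have M1 : 0 < 1 + M%:R * eta by rewrite ltr_wpDr// mulr_ge0// ltW.
exists (M * m.+1)%N.
have le1 : (1 - eta) ^+ M <= (1 + M%:R * eta)^-1.
  rewrite -[leRHS]mul1r ler_pdivlMr//.
  have e1 : 0 <= (1 - eta) ^+ M by rewrite exprn_ge0//; lra.
  rewrite (le_trans (ler_wpM2l e1 (bernoulli_expr M (ltW eta0))))// -exprMn exprn_ile1//; nra.
have le2 : ((1 - eta) ^+ M) ^+ m.+1 <= ((1 + M%:R * eta)^-1) ^+ m.+1.
  by rewrite lerXn2r// nnegrE ?invr_ge0 ?(ltW M1)// exprn_ge0//; lra.
rewrite exprM (le_lt_trans le2)// !exprVn ltf_pV2 ?posrE ?exprn_gt0//.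
have le3 : (M * m.+1).+1%:R <= K * (1 + M%:R * eta).
  rewrite mulrDr mulr1 -natr1 natrM [K * _]mulrCA /K divfK ?gt_eqF//.
  by rewrite addrC lerD.
have le4 : (M * m.+1).+1%:R ^+ m <= (K * (1 + M%:R * eta)) ^+ m.
  by rewrite lerXn2r// nnegrE// mulr_ge0// ltW.
rewrite (le_lt_trans le4)// exprMn exprS ltr_pM2r ?exprn_gt0//; lra.
Qed.

Lemma normc_prod (I : finType) (F : I -> C) : normc (\prod_i F i) = \prod_i normc (F i).
Proof. by apply: (big_morph (fun z : C => normc z)); [exact: normcM|exact: normc_one]. Qed.

(** Consider the trigonometric polynomial in [t] that is the product over [k] of
    the powers [((1 + w_k) / 2) ^+ N], where [w_k = expi (mu_k * t - theta_k)]. If no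
    [t] brings all the [w_k] near [1], its supremum decays exponentially in [N]. By
    independence its frequencies are distinct, so no coefficient exceeds this
    supremum; but some coefficient is at least [(N + 1) ^- m]. *)
Lemma kronecker m (mu theta : nat -> R) (d : R) : rat_independent m mu -> 0 < d ->
  exists t : R, forall k, (k < m)%N -> normc (expi (mu k * t) - expi (theta k)) < d.
Proof.
move=> ind d0; apply: contrapT => H.
have far t : exists k : 'I_m, d <= normc (expi (mu k * t - theta k) - 1).
  apply: contrapT => H1; apply: H; exists t => k km.
  rewrite ltNge; apply/negP => dk; apply: H1; exists (Ordinal km).
  suff E : normc (expi (mu k * t - theta k) - 1) =
      normc (expi (mu k * t) - expi (theta k)) by rewrite (le_trans dk)// -E.
  have -> : expi (mu k * t) = expi (mu k * t - theta k) * expi (theta k) :> C.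
    by rewrite -expiD subrK.
  by rewrite -{2}[expi (theta k)]mul1r -mulrBl normcM normc_expi mulr1.
pose eta := d ^+ 2 / 8.
have eta0 : 0 < eta by rewrite divr_gt0// exprn_gt0.
have eta1 : eta <= 1.
  have [k kd] := far 0; have := le_trans kd (normcD _ _).
  rewrite normc_opp normc_one normc_expi => d2; rewrite /eta; nra.
have [N] := exponential_beats_polynomial m eta0 eta1.
rewrite ltNge => /negP; apply.
have [j jN jP] := large_binomial N.
pose a (i : nat) : C := 'C(N, i)%:R / 2 ^+ N.
pose cc (p : {ffun 'I_m -> 'I_N.+1}) : C := \prod_k (a (p k) * expi (- ((p k)%:R * theta k))).
pose nu (p : {ffun 'I_m -> 'I_N.+1}) : R := \sum_k (p k)%:R * mu k.
pose p0 : {ffun 'I_m -> 'I_N.+1} := [ffun=> Ordinal jN].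
have expand t : \prod_(k < m) ((1 + expi (mu k * t - theta k)) / 2) ^+ N =
    \sum_p cc p * expi (nu p * t).
  transitivity (\prod_(k < m) \sum_(i < N.+1) a i * expi (i%:R * (mu k * t - theta k))).
    apply: eq_bigr => k _; rewrite exprMn exprDn mulr_suml; apply: eq_bigr => i _.
    by rewrite expr1n mul1r expiMn /a exprVn -mulr_natl mulrAC.
  rewrite bigA_distr_bigA; apply: eq_bigr => p _; rewrite /cc /nu mulr_suml.
  have -> : expi (\sum_(k < m) (p k)%:R * mu k * t) =
      \prod_(k < m) expi ((p k)%:R * mu k * t) :> C.
    by apply: (big_morph (fun x : R => expi x)); [exact: expiD|exact: expi0].
  rewrite -big_split/=; apply: eq_bigr => k _.
  by rewrite -[RHS]mulrA -expiD; congr (_ * expi _); ring.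
have nu_inj p : nu p = nu p0 -> p = p0.
  move=> E; apply/ffunP => k; rewrite ffunE; apply: val_inj => /=.
  pose q (k : nat) : rat := if insub k is Some i then ((p i : nat)%:R - j%:R) else 0.
  have : q k = 0.
    apply: ind (ltn_ord k); transitivity (nu p - nu p0); last by rewrite E subrr.
    rewrite /nu -sumrB; apply: eq_bigr => i _; rewrite /q valK ffunE rmorphB/= !ratr_nat.
    by rewrite mulrBl.
  by rewrite /q valK => /eqP; rewrite subr_eq0 eqr_nat => /eqP.
have n2 : normc (2 : C) = 2.
  by rewrite (_ : 2 = (2 : R)%:C) ?normc_real ?normr_nat// rmorph_nat.
have nN n : normc (n%:R : C) = n%:R.
  by rewrite (_ : n%:R = (n%:R : R)%:C) ?normc_real ?normr_nat// rmorph_nat.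
have bound t : normc (\sum_p cc p * expi (nu p * t)) <= (1 - eta) ^+ N.
  rewrite -expand normc_prod; have [k0 k0d] := far t.
  rewrite (bigD1 k0)//= -[leRHS]mulr1 ler_pM ?normc_ge0//.
  - by apply: prodr_ge0 => i _; exact: normc_ge0.
  - have -> : normc (((1 + expi (mu k0 * t - theta k0)) / 2) ^+ N) =
       normc ((1 + expi (mu k0 * t - theta k0)) / 2) ^+ N.
      by elim: (N) => [|n IH]; rewrite ?normc_one// !exprS normcM IH.
    have h := half_one_plus_expi (ltW d0) k0d.
    by rewrite lerXn2r// nnegrE ?normc_ge0// (le_trans _ h)// normc_ge0.
  - apply: prodr_ile1 => i _; rewrite normc_ge0/=.
    have -> : normc (((1 + expi (mu i * t - theta i)) / 2) ^+ N) =
       normc ((1 + expi (mu i * t - theta i)) / 2) ^+ N.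
      by elim: (N) => [|n IH]; rewrite ?normc_one// !exprS normcM IH.
    rewrite exprn_ile1 ?normc_ge0// normcM ComplexField.Normc.normcV n2.
    by rewrite ler_pdivrMr// (le_trans (normcD _ _))// normc_one normc_expi; lra.
apply: le_trans (coefficient_bound bound nu_inj).
rewrite /cc normc_prod; under eq_bigr do rewrite ffunE normcM normc_expi mulr1.
rewrite prodr_const card_ord lerXn2r// ?nnegrE ?invr_ge0 ?normc_ge0//.
rewrite /a normcM nN ComplexField.Normc.normcV -natrX nN.
rewrite ler_pdivlMr ?ltr0n ?expn_gt0// mulrC ler_pdivrMr//.
by rewrite -natrM ler_nat.
Qed.

End Kronecker.

(** * Translation invariance of the integral *)

Section Translation.
Context {R : realType}.
Notation mu := (@lebesgue_measure R).

Lemma translation_preimage_itv (b0 b1 : bool) (a b t : R) :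
  ((fun x : R => x + t) : R -> measurableTypeR R) @^-1`
     [set` Interval (BSide b0 a) (BSide b1 b)] =
  [set` Interval (BSide b0 (a - t)) (BSide b1 (b - t))].
Proof.
by apply/seteqP; split => x /=; rewrite !in_itv /= lteifBlDr -?lteifBrDr.
Qed.

Lemma translation_measurable (t : R) :
  measurable_fun setT ((fun x => x + t) : R -> measurableTypeR R).
Proof.
apply: continuous_measurable_fun => x.
by apply: cvgD; [exact: cvg_id|exact: cvg_cst].
Qed.

(** Lebesgue measure is determined by its values on intervals. *)
Lemma lebesgue_measure_translation (t : R) (A : set R) : measurable A ->
  pushforward mu ((fun x => x + t) : R -> measurableTypeR R) A = mu A.
Proof.
have mt := translation_measurable t.
move=> mA; apply/esym/lebesgue_measure_unique => //= _ [[a b]] _ <-.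
rewrite /pushforward translation_preimage_itv/= !lebesgue_measure_itv/=.
rewrite !lte_fin ltrD2; case: ifP => // _.
by rewrite -!EFinB; congr (_%:E); ring.
Qed.

Lemma ge0_integral_translation (f : R -> \bar R) (a b t : R) :
  measurable_fun setT f -> (forall x, (0 <= f x)%E) ->
  (\int[mu]_(x in `[a, b]) f (x + t)%R = \int[mu]_(x in `[(a + t)%R, (b + t)%R]) f x)%E.
Proof.
move=> mf f0; have mt := translation_measurable t.
have E : (\int[pushforward mu (fun x : R => (x + t)%R : measurableTypeR R)]_(y in
      `[(a + t)%R, (b + t)%R]) f y =
    \int[mu]_(x in `[a, b]) f (x + t)%R)%E.
  rewrite ge0_integral_pushforward//=; last exact: measurable_funS mf.
  by rewrite translation_preimage_itv !addrK.
rewrite -E; apply: eq_measure_integral => //= A mA AS.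
by apply: lebesgue_measure_translation.
Qed.

Lemma Rintegral_translation (f : R -> R) (a b t : R) : continuous f ->
  \int[mu]_(x in `[a, b]) f (x + t) = \int[mu]_(x in `[a + t, b + t]) f x.
Proof.
move=> cf; have mf : measurable_fun setT (EFin \o f).
  by apply/measurable_EFinP; exact: continuous_measurable_fun.
rewrite /Rintegral integralE [in RHS]integralE; congr (fine (_ - _)).
  have := @ge0_integral_translation (EFin \o f)^\+%E a b t
    (measurable_funepos mf) (fun x => funepos_ge0 _ x).
  by move=> <-; apply: eq_integral => x _; rewrite !funeposE.
have := @ge0_integral_translation (EFin \o f)^\-%E a b t
  (measurable_funeneg mf) (fun x => funeneg_ge0 _ x).
by move=> <-; apply: eq_integral => x _; rewrite !funenegE.
Qed.

End Translation.

(** * Mean values *)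

Section Means.
Context {R : realType}.
Notation C := R[i].
Notation mu := (@lebesgue_measure R).
Implicit Types (u v w : R -> C).

Definition mean l u : \bar R :=
  (((2 * l)^-1)%:E * \int[mu]_(t in `[(- l)%R, l]) (normc (u t))%:E)%E.

(** The inequality between the upper mean of [|u|] and [a] in eventual form, free
    of extended real upper limits; see [mean_seminorm_le]. *)
Definition mean_le (a : R) u := forall d : R, 0 < d ->
  \forall l \near +oo%R, (mean l u <= (a + d)%:E)%E.

Lemma mean_seminorm_le (a : R) u :
  (mean_seminorm u <= a%:E)%E <-> mean_le a u.
Proof.
split=> [le_a d d0|H].
- have : (mean_seminorm u < (a + d)%:E)%E.
    by rewrite (le_lt_trans le_a)// lte_fin ltrDl.
  move=> /ereal_inf_lt[_ [A FA <-]] supA.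
  apply: filterS FA => l Al; rewrite (le_trans _ (ltW supA))//.
  by apply: ereal_sup_ubound; exists l.
- apply/lee_addgt0Pr => d d0.
  apply: (@le_trans _ _ (ereal_sup ((fun l => mean l u) @` [set l | (mean l u <= (a + d)%:E)%E]))).
    apply: ereal_inf_lbound; exists [set l | (mean l u <= (a + d)%:E)%E] => //.
    exact: H.
  by apply: ge_ereal_sup => _ [l le_l <-].
Qed.

Lemma mean_ge0 l u : 0 <= l -> (0 <= mean l u)%E.
Proof.
move=> l0; rewrite mule_ge0 ?lee_fin ?invr_ge0 ?mulr_ge0//.
by apply: integral_ge0 => t _; rewrite lee_fin normc_ge0.
Qed.

Lemma mean_seminorm_ge0 u : (0 <= mean_seminorm u)%E.
Proof.
apply: le_ereal_inf_tmp => _ [A FA <-].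
have [l [Al l0]] := filter_ex (filterI FA (nbhs_pinfty_ge (num_real (0 : R)))).
by apply: le_trans (mean_ge0 u l0) _; apply: ereal_sup_ubound; exists l.
Qed.

Lemma mean_seminorm_eq0 u : mean_seminorm u = 0%E <-> mean_le 0 u.
Proof.
rewrite -mean_seminorm_le; split => [->//|le0].
by apply/eqP; rewrite eq_le le0 mean_seminorm_ge0.
Qed.

Lemma mean_le_inf u : (forall e : R, 0 < e -> mean_le e u) -> mean_le 0 u.
Proof.
move=> H d d0; have d2 : 0 < d / 2 by lra.
by apply: filterS (H _ d2 _ d2) => l; rewrite add0r -splitr.
Qed.

Definition measurableC u :=
  measurable_fun setT (fun t => complex.Re (u t)) /\
  measurable_fun setT (fun t => complex.Im (u t)).

Definition continuousC u :=
  continuous (fun t => complex.Re (u t)) /\ continuous (fun t => complex.Im (u t)).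

Lemma continuousC_measurable u : continuousC u -> measurableC u.
Proof. by move=> [cr ci]; split; exact: continuous_measurable_fun. Qed.

Lemma measurable_normc u : measurableC u -> measurable_fun setT (fun t => normc (u t)).
Proof.
move=> [mr mi].
rewrite (_ : (fun t => _) = (fun t => Num.sqrt (complex.Re (u t) ^+ 2 + complex.Im (u t) ^+ 2))).
  have ms : measurable_fun setT (Num.sqrt : R -> R).
    by apply: continuous_measurable_fun; exact: sqrt_continuous.
  have mq : measurable_fun setT (fun t => complex.Re (u t) ^+ 2 + complex.Im (u t) ^+ 2).
    by apply: measurable_funD; apply: measurable_funX.
  exact: (measurableT_comp ms mq).
by apply/funext => t; case: (u t).
Qed.

Lemma measurableCB u v : measurableC u -> measurableC v ->
  measurableC (fun t => u t - v t).
Proof.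
move=> [ur ui] [vr vi]; split.
- rewrite (_ : (fun t => _) = (fun t => complex.Re (u t) - complex.Re (v t))).
    exact: measurable_funB.
  by apply/funext => t; rewrite ReD ReN.
- rewrite (_ : (fun t => _) = (fun t => complex.Im (u t) - complex.Im (v t))).
    exact: measurable_funB.
  by apply/funext => t; rewrite ImD ImN.
Qed.

(** One form of monotonicity and subadditivity that covers all the comparisons
    of means that are needed. *)
Lemma mean_le_dominated u v w (a b k1 k2 M : R) :
  measurableC u -> measurableC v -> measurableC w ->
  0 <= k1 -> 0 <= k2 -> 0 <= M ->
  (forall t, normc (u t) <= k1 * normc (v t) + k2 * normc (w t) + M) ->
  mean_le a v -> mean_le b w -> mean_le (k1 * a + k2 * b + M) u.
Proof.
move=> mu_ mv mw k10 k20 M0 H va wb d d0.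
have mnu := measurable_normc mu_; have mnv := measurable_normc mv.
have mnw := measurable_normc mw.
pose k := k1 + k2 + 1.
have k0 : 0 < k by rewrite /k; lra.
have d' : 0 < d / k by rewrite divr_gt0.
near=> l.
have l0 : 0 < l by near: l; apply: nbhs_pinfty_gt; exact: num_real.
have Lv : (mean l v <= (a + d / k)%:E)%E by near: l; exact: va.
have Lw : (mean l w <= (b + d / k)%:E)%E by near: l; exact: wb.
have il : 0 <= (2 * l)^-1 by rewrite invr_ge0 mulr_ge0// ltW.
apply: (@le_trans _ _ (k1%:E * mean l v + k2%:E * mean l w + M%:E)%E).
  have -> : (k1%:E * mean l v + k2%:E * mean l w + M%:E)%E =
     (((2 * l)^-1)%:E * (\int[mu]_(t in `[(- l)%R, l])
       (k1 * normc (v t) + k2 * normc (w t) + M)%:E))%E.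
    under eq_integral do rewrite !EFinD !EFinM.
    have mk (c : R) z : measurableC z ->
        measurable_fun `[- l, l] (fun t => (c%:E * (normc (z t))%:E)%E).
      move=> mz; apply: measurable_funeM; apply/measurable_EFinP.
      exact: measurable_funS (measurable_normc mz).
    have ge0 (c : R) z x : 0 <= c -> (0 <= c%:E * (normc (z x))%:E)%E.
      by move=> c0; rewrite mule_ge0// lee_fin normc_ge0.
    rewrite ge0_integralD//; last 2 first.
    - by move=> x _; rewrite adde_ge0// ge0.
    - by apply: emeasurable_funD; exact: mk.
    rewrite ge0_integralD//;
      [|by move=> x _; exact: ge0|exact: mk|by move=> x _; exact: ge0|exact: mk].
    have mz z : measurableC z -> measurable_fun `[- l, l] (fun t => (normc (z t))%:E).
      by move=> mz; apply/measurable_EFinP; exact: measurable_funS (measurable_normc mz).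
    rewrite !ge0_integralZl//; try (by move=> x _; rewrite lee_fin normc_ge0); try exact: mz.
    rewrite integral_cst//= lebesgue_measure_itv/= lte_fin gtrN//= -EFinB opprK.
    have i0 z : (0 <= \int[mu]_(t in `[(- l)%R, l]) (normc (z t))%:E)%E.
      by apply: integral_ge0 => t _; rewrite lee_fin normc_ge0.
    rewrite ge0_muleDr ?adde_ge0 ?mule_ge0 ?lee_fin//; [|by lra].
    rewrite ge0_muleDr ?mule_ge0 ?lee_fin//.
    rewrite /mean !muleA; congr (_ + _ + _)%E.
    - by rewrite [(_%:E * k1%:E)%E]muleC.
    - by rewrite [(_%:E * k2%:E)%E]muleC.
    - by rewrite -!EFinM; congr (_%:E); field; rewrite gt_eqF.
  rewrite /mean lee_wpmul2l ?lee_fin//; apply: ge0_le_integral => //.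
  - by move=> t _; rewrite lee_fin normc_ge0.
  - by apply/measurable_EFinP; exact: measurable_funS mnu.
  - apply/measurable_EFinP; apply: (@measurable_funS _ _ _ _ setT) => //.
    by apply: measurable_funD => //; apply: measurable_funD; apply: measurable_funM.
  - by move=> t _; rewrite lee_fin.
apply: (@le_trans _ _ (k1%:E * (a + d / k)%:E + k2%:E * (b + d / k)%:E + M%:E)%E).
  by rewrite leeD// leeD// lee_wpmul2l ?lee_fin.
rewrite -!EFinM -!EFinD lee_fin.
have : (k1 + k2) * (d / k) <= d.
  by rewrite mulrA ler_pdivrMr// mulrC ler_wpM2l ?ltW// /k; lra.
lra.
Unshelve. all: by end_near. Qed.

Lemma mean_le0 : mean_le 0 (fun=> 0).
Proof.
move=> d d0; apply: nearW => l; rewrite /mean.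
under eq_integral do rewrite normc_zero.
by rewrite integral0 mule0 add0r lee_fin ltW.
Qed.

Lemma measurableC_cst (c : C) : measurableC (fun=> c).
Proof. by split; exact: measurable_cst. Qed.

Lemma mean_le_sum u v w (a b : R) :
  measurableC u -> measurableC v -> measurableC w ->
  (forall t, normc (u t) <= normc (v t) + normc (w t)) ->
  mean_le a v -> mean_le b w -> mean_le (a + b) u.
Proof.
move=> mu_ mv mw H va wb.
have -> : a + b = 1 * a + 1 * b + 0 by ring.
by apply: mean_le_dominated va wb => // t; rewrite !mul1r addr0.
Qed.

Lemma mean_le_bounded u (M : R) : measurableC u -> 0 <= M ->
  (forall t, normc (u t) <= M) -> mean_le M u.
Proof.
move=> mu_ M0 H; have -> : M = 0 * 0 + 0 * 0 + M by ring.
apply: (mean_le_dominated mu_ (measurableC_cst 0) (measurableC_cst 0)) => //.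
- by move=> t; rewrite !mul0r !add0r.
- exact: mean_le0.
- exact: mean_le0.
Qed.

(** The window [-l, l] moved by [t] lies in the window of half-length [l + |t|],
    which is at most twice as long. The factor [2] is crude but harmless: the bound
    is used for null functions and for approximations of arbitrary precision. *)
Lemma mean_le_translation u (a t : R) : 0 <= a -> measurableC u ->
  mean_le a u -> mean_le (2 * a) (fun x => u (x + t)).
Proof.
move=> a0 mu_ H d d0; have d2 : 0 < d / 2 by lra.
near=> l.
have l0 : 0 < l by near: l; apply: nbhs_pinfty_gt; exact: num_real.
have lt : `|t| <= l by near: l; apply: nbhs_pinfty_ge; exact: num_real.
have L : (mean (l + `|t|) u <= (a + d / 2)%:E)%E.
  near: l; have [M [Mr MP]] := H _ d2.
  exists M; split => // x Mx; apply: MP.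
  by rewrite (lt_le_trans Mx)// lerDl.
have t0 : 0 <= `|t| by [].
have mn : measurable_fun setT (fun x => (normc (u x))%:E).
  by apply/measurable_EFinP; exact: measurable_normc.
have n0 x : (0 <= (normc (u x))%:E)%E by rewrite lee_fin normc_ge0.
have i0 : (0 <= \int[mu]_(x in `[(- (l + `|t|))%R, (l + `|t|)%R]) (normc (u x))%:E)%E.
  exact: integral_ge0.
apply: (@le_trans _ _ (2%:E * mean (l + `|t|) u)%E).
  rewrite /mean muleA -EFinM.
  rewrite (@ge0_integral_translation _ (fun x => (normc (u x))%:E))//.
  apply: (@le_trans _ _ (((2 * l)^-1)%:E *
    \int[mu]_(x in `[(- (l + `|t|))%R, (l + `|t|)%R]) (normc (u x))%:E)%E).
    have il : (0 <= ((2 * l)^-1)%:E)%E by rewrite lee_fin invr_ge0 mulr_ge0// (ltW l0).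
    apply: (lee_wpmul2l il); apply: ge0_subset_integral => //; first exact: measurable_funS mn.
    apply: subset_itv; rewrite bnd_simp; have := ler_norm t; have := ler_norm (- t);
    rewrite normrN; lra.
  rewrite lee_wpmul2r// lee_fin.
  have -> : 2 * (2 * (l + `|t|))^-1 = (l + `|t|)^-1.
    by rewrite invfM mulrA divff// mul1r.
  rewrite lef_pV2 ?posrE//; lra.
apply: (le_trans (lee_wpmul2l _ L)); first by rewrite lee_fin.
by rewrite -EFinM lee_fin; lra.
Unshelve. all: by end_near. Qed.

End Means.

(** * Integrals of continuous complex functions *)

Section ComplexContinuity.
Context {R : realType}.
Notation C := R[i].
Notation mu := (@lebesgue_measure R).
Implicit Types (u v w p : R -> C) (c : C).

Lemma continuousCD u v : continuousC u -> continuousC v -> continuousC (fun t => u t + v t).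
Proof.
move=> [ur ui] [vr vi]; split.
- have -> : (fun t => complex.Re (u t + v t)) =
      (fun t => complex.Re (u t) + complex.Re (v t)) by apply/funext => t; exact: ReD.
  by move=> x; exact: (cvgD (ur x) (vr x)).
- have -> : (fun t => complex.Im (u t + v t)) =
      (fun t => complex.Im (u t) + complex.Im (v t)) by apply/funext => t; exact: ImD.
  by move=> x; exact: (cvgD (ui x) (vi x)).
Qed.

Lemma continuousCM u v : continuousC u -> continuousC v -> continuousC (fun t => u t * v t).
Proof.
move=> [ur ui] [vr vi]; split.
- have -> : (fun t => complex.Re (u t * v t)) = (fun t => complex.Re (u t) *
      complex.Re (v t) - complex.Im (u t) * complex.Im (v t)).
    by apply/funext => t; exact: ReM.
  by move=> x; exact: (cvgB (cvgM (ur x) (vr x)) (cvgM (ui x) (vi x))).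
- have -> : (fun t => complex.Im (u t * v t)) = (fun t => complex.Re (u t) *
      complex.Im (v t) + complex.Im (u t) * complex.Re (v t)).
    by apply/funext => t; exact: ImM.
  by move=> x; exact: (cvgD (cvgM (ur x) (vi x)) (cvgM (ui x) (vr x))).
Qed.

Lemma continuousC_cst c : continuousC (fun=> c : C).
Proof. by split => x; exact: cvg_cst. Qed.

Lemma continuousCB u v : continuousC u -> continuousC v -> continuousC (fun t => u t - v t).
Proof.
move=> cu cv; rewrite (_ : (fun t => _) = (fun t => u t + (-1) * v t)).
  by apply: continuousCD => //; apply: continuousCM => //; exact: continuousC_cst.
by apply/funext => t; rewrite mulN1r.
Qed.

Lemma continuousC_conj u : continuousC u -> continuousC (fun t => (u t)^*).
Proof.
move=> [ur ui]; split.
- have -> : (fun t => complex.Re (u t)^*) = (fun t => complex.Re (u t)).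
    by apply/funext => t; case: (u t).
  exact: ur.
- have -> : (fun t => complex.Im (u t)^*) = (fun t => - complex.Im (u t)).
    by apply/funext => t; case: (u t).
  by move=> x; exact: (cvgN (ui x)).
Qed.

Lemma continuousC_translation u (t : R) : continuousC u -> continuousC (fun x => u (x + t)).
Proof.
move=> [ur ui]; have ct x : (fun y : R => y + t) @ x --> x + t.
  by apply: cvgD; [exact: cvg_id|exact: cvg_cst].
by split => x; [exact: (cvg_comp _ _ (ct x) (ur _))|exact: (cvg_comp _ _ (ct x) (ui _))].
Qed.

Lemma continuousC_expi (m : R) : continuousC (fun t => expi (m * t)).
Proof.
have cm x : (fun y : R => m * y) @ x --> m * x.
  by apply: cvgM; [exact: cvg_cst|exact: cvg_id].
by split => x; [exact: (cvg_comp _ _ (cm x) (@continuous_cos R _))|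
  exact: (cvg_comp _ _ (cm x) (@continuous_sin R _))].
Qed.

Lemma continuousC_fourier u (m : R) : continuousC u ->
  continuousC (fun t => u t * expi (- (m * t))).
Proof.
move=> cu; rewrite (_ : (fun t => _) = (fun t => u t * expi ((- m) * t))).
  by apply: continuousCM => //; exact: continuousC_expi.
by apply/funext => t; rewrite mulNr.
Qed.

Lemma continuous_normc u : continuousC u -> continuous (fun t => normc (u t)).
Proof.
move=> [ur ui].
have -> : (fun t => normc (u t)) = (fun t => Num.sqrt
    (complex.Re (u t) * complex.Re (u t) + complex.Im (u t) * complex.Im (u t))).
  by apply/funext => t; case: (u t).
move=> x; apply: (cvg_comp _ _ (cvgD (cvgM (ur x) (ur x)) (cvgM (ui x) (ui x)))).
exact: sqrt_continuous.
Qed.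

Lemma continuous_segment_integrable (f : R -> R) (a b : R) : continuous f ->
  mu.-integrable `[a, b] (EFin \o f).
Proof. by move=> cf; apply: segment_integrable; exact: continuous_subspaceT. Qed.

Lemma continuous_locally_integrable (f : R -> R) : continuous f ->
  locally_integrable setT f.
Proof.
move=> cf; split; [exact: continuous_measurable_fun|exact: openT|move=> K _ cK].
have : mu.-integrable K (EFin \o f).
  by apply: continuous_compact_integrable => //; exact: continuous_subspaceT.
by move=> /integrableP[_].
Qed.

Lemma cintegralD (a b : R) u v : continuousC u -> continuousC v ->
  cintegral a b (fun t => u t + v t) = cintegral a b u + cintegral a b v.
Proof.
move=> [ur ui] [vr vi]; rewrite /cintegral; simpc; congr (_ +i* _).
- under eq_Rintegral do rewrite ReD.
  by rewrite RintegralD//; exact: continuous_segment_integrable.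
- under eq_Rintegral do rewrite ImD.
  by rewrite RintegralD//; exact: continuous_segment_integrable.
Qed.

Lemma cintegralZ (a b : R) c u : continuousC u ->
  cintegral a b (fun t => c * u t) = c * cintegral a b u.
Proof.
move=> [ur ui]; rewrite /cintegral; case: c => x y; simpc; congr (_ +i* _).
- under eq_Rintegral do rewrite ReM.
  rewrite RintegralB//; [|by apply: segment_integrableZ; exact: continuous_subspaceT..].
  by rewrite !RintegralZl//; exact: continuous_segment_integrable.
- under eq_Rintegral do rewrite ImM.
  rewrite RintegralD//; [|by apply: segment_integrableZ; exact: continuous_subspaceT..].
  by rewrite !RintegralZl//; exact: continuous_segment_integrable.
Qed.

Lemma cintegral0 (a b : R) : cintegral a b (fun=> 0) = 0 :> C.
Proof. by rewrite /cintegral /Rintegral !integral0. Qed.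

Lemma cintegral_sum (a b : R) n (F : 'I_n -> R -> C) :
  (forall k, continuousC (F k)) ->
  continuousC (fun t => \sum_k F k t) /\
  cintegral a b (fun t => \sum_k F k t) = \sum_k cintegral a b (F k).
Proof.
elim: n F => [|n IH] F cF.
  rewrite big_ord0; rewrite (_ : (fun t => _) = fun=> 0); last first.
    by apply/funext => t; rewrite big_ord0.
  by split; [exact: continuousC_cst|exact: cintegral0].
have [cS IS] := IH (fun k => F (lift ord0 k)) (fun k => cF _).
rewrite (_ : (fun t => _) = fun t => F ord0 t + \sum_(k < n) F (lift ord0 k) t); last first.
  by apply/funext => t; rewrite big_ord_recl.
by split; [exact: continuousCD|rewrite cintegralD// IS big_ord_recl].
Qed.

(** The factor [2] comes from adding the bounds of the two parts. *)
Lemma normc_cintegral (a b : R) u : continuousC u ->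
  normc (cintegral a b u) <= 2 * \int[mu]_(t in `[a, b]) normc (u t).
Proof.
move=> cu; have [ur ui] := cu; have cn := continuous_normc cu.
have key (f : R -> R) : continuous f -> (forall t, `|f t| <= normc (u t)) ->
    `|\int[mu]_(t in `[a, b]) f t| <= \int[mu]_(t in `[a, b]) normc (u t).
  move=> cf H; apply: (@le_trans _ _ (\int[mu]_(t in `[a, b]) `|f t|)).
    by apply: le_normr_Rintegral => //; exact: continuous_segment_integrable.
  apply: le_Rintegral => //; last exact: continuous_segment_integrable.
  apply: continuous_segment_integrable => x; apply: cvg_norm; exact: cf.
rewrite (le_trans (normc_le_ReIm _))//=.
have k1 := key _ ur (fun t => ler_Re_normc (u t)).
have k2 := key _ ui (fun t => ler_Im_normc (u t)).
by rewrite mulr_natl mulr2n; exact: lerD.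
Qed.

Lemma cintegral_translation (a b t : R) u : continuousC u ->
  cintegral a b (fun x => u (x + t)) = cintegral (a + t) (b + t) u.
Proof.
move=> [ur ui]; rewrite /cintegral (Rintegral_translation a b t ur).
by rewrite (Rintegral_translation a b t ui).
Qed.

(** The two integrals differ by the integrals over two intervals of length [|t|]. *)
Lemma Rintegral_window (f : R -> R) (a b t M : R) : continuous f ->
  (forall x, `|f x| <= M) -> a <= b ->
  `|\int[mu]_(x in `[a + t, b + t]) f x - \int[mu]_(x in `[a, b]) f x| <= 2 * M * `|t|.
Proof.
move=> cf fM; wlog t0 : a b t / 0 <= t => [H|] ab.
  have [t0|t0] := leP 0 t; first exact: H.
  have := H (a + t) (b + t) (- t) ltac:(lra) ltac:(lra).
  by rewrite !addrK distrC normrN.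
have cs x y : {within `[x, y], continuous f} by exact: continuous_subspaceT.
have E1 := @Rintegral_split _ f a (b + t) b (cs _ _) ltac:(lra).
have E2 := @Rintegral_split _ f a (b + t) (a + t) (cs _ _) ltac:(lra).
have B1 := @Rintegral_segment_bound _ f b (b + t) M ltac:(lra) (cs _ _) (fun x _ => fM x).
have B2 := @Rintegral_segment_bound _ f a (a + t) M ltac:(lra) (cs _ _) (fun x _ => fM x).
move: E1 E2 B1 B2; rewrite (ger0_norm t0).
move: (\int[mu]_(x in _) _) => I0 E1; move: E1.
move: (\int[mu]_(x in `[a, b]) _) (\int[mu]_(x in `[b, b + t]) _) => I1 I2.
move: (\int[mu]_(x in `[a, a + t]) _) (\int[mu]_(x in `[a + t, b + t]) _) => I3 I4.
move=> -> E2 B1 B2; have -> : I4 - I1 = I2 - I3 by lra.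
rewrite (le_trans (ler_normB _ _))//; lra.
Qed.

Lemma cintegral_window (a b t M : R) u : continuousC u ->
  (forall x, normc (u x) <= M) -> a <= b ->
  normc (cintegral (a + t) (b + t) u - cintegral a b u) <= 4 * M * `|t|.
Proof.
move=> [ur ui] uM ab; rewrite /cintegral; simpc; rewrite (le_trans (normc_le_ReIm _))//=.
have h1 := @Rintegral_window _ a b t M ur (fun x => le_trans (ler_Re_normc _) (uM x)) ab.
have h2 := @Rintegral_window _ a b t M ui (fun x => le_trans (ler_Im_normc _) (uM x)) ab.
rewrite (le_trans (lerD h1 h2))//; lra.
Qed.

End ComplexContinuity.

(** * Fourier coefficients *)

Section FourierCoefficients.
Context {R : realType}.
Notation C := R[i].
Notation mu := (@lebesgue_measure R).
Implicit Types (u v h p : R -> C) (c : C) (lambda : R).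

Definition fourier_mean (l lambda : R) u : C :=
  ((2 * l)^-1)%:C * cintegral (- l) l (fun t => u t * expi (- (lambda * t))).

Lemma has_fourier_coefP u lambda c : has_fourier_coef u lambda c <->
  forall e : R, 0 < e -> \forall l \near +oo%R, normc (fourier_mean l lambda u - c) < e.
Proof. exact: cvgC. Qed.

Lemma normc_inv2l (l : R) : 0 < l -> normc ((2 * l)^-1)%:C = (2 * l)^-1.
Proof. by move=> l0; rewrite normc_real ger0_norm// invr_ge0 mulr_ge0// ltW. Qed.

(** A bounded error at the two ends of the window disappears in the mean. *)
Lemma fourier_coef_translation u lambda c (M t : R) : continuousC u ->
  (forall x, normc (u x) <= M) -> has_fourier_coef u lambda c ->
  has_fourier_coef (fun x => u (x + t)) lambda (c * expi (lambda * t)).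
Proof.
move=> cu uM /has_fourier_coefP H; apply/has_fourier_coefP => e e0.
have e2 : 0 < e / 2 by lra.
have M0 : 0 <= M by apply: le_trans (uM 0); exact: normc_ge0.
have K0 : 0 <= 4 * M * `|t| by rewrite !mulr_ge0.
near=> l.
have l0 : 0 < l by near: l; apply: nbhs_pinfty_gt; exact: num_real.
have lK : 4 * M * `|t| / e < l by near: l; apply: nbhs_pinfty_gt; exact: num_real.
have Hl : normc (fourier_mean l lambda u - c) < e / 2 by near: l; exact: H.
pose w x := u x * expi (- (lambda * x)).
have cw : continuousC w by exact: continuousC_fourier.
have E : cintegral (- l) l (fun x => u (x + t) * expi (- (lambda * x))) =
    expi (lambda * t) * cintegral (- l + t) (l + t) w.
  rewrite -cintegral_translation// -cintegralZ; last exact: continuousC_translation.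
  congr cintegral; apply/funext => x; rewrite /w mulrCA -expiD; congr (_ * expi _); ring.
have wM x : normc (w x) <= M by rewrite /w normcM normc_expi mulr1.
have D := cintegral_window t cw wM (ltac:(lra) : - l <= l).
have -> : fourier_mean l lambda (fun x => u (x + t)) - c * expi (lambda * t) =
  expi (lambda * t) * ((fourier_mean l lambda u - c) +
     ((2 * l)^-1)%:C * (cintegral (- l + t) (l + t) w - cintegral (- l) l w)).
  by rewrite /fourier_mean E -/w; ring.
rewrite normcM normc_expi mul1r (le_lt_trans (normcD _ _))//.
rewrite [normc (_ * (_ - _))]normcM normc_inv2l//.
have l2 : 0 < (2 * l)^-1 by rewrite invr_gt0 mulr_gt0.
(* the error at the ends of the window, divided by its length *)
have D2 := ler_wpM2l (ltW l2) D.
have D3 : (2 * l)^-1 * (4 * M * `|t|) <= e / 2.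
  rewrite mulrC ler_pdivrMr ?mulr_gt0//; move: lK; rewrite ltr_pdivrMr//; lra.
have := le_trans D2 D3; move: (normc _) (normc _) Hl => x y; lra.
Unshelve. all: by end_near. Qed.

Lemma fourier_mean_close u h (l lambda e : R) : 0 < l -> continuousC u -> continuousC h ->
  (forall t, normc (h t - u t) <= e) ->
  normc (fourier_mean l lambda h - fourier_mean l lambda u) <= 2 * e.
Proof.
move=> l0 cu ch hu.
have e0 : 0 <= e by apply: le_trans (hu 0); exact: normc_ge0.
pose w x := (h x - u x) * expi (- (lambda * x)).
have cw : continuousC w by apply: continuousC_fourier; exact: continuousCB.
have -> : fourier_mean l lambda h - fourier_mean l lambda u =
    ((2 * l)^-1)%:C * cintegral (- l) l w.
  rewrite /fourier_mean -mulrBr; congr (_ * _).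
  have -> : w = (fun x => h x * expi (- (lambda * x)) + (-1) * (u x * expi (- (lambda * x)))).
    by apply/funext => x; rewrite /w; ring.
  have ch' := continuousC_fourier lambda ch; have cu' := continuousC_fourier lambda cu.
  rewrite cintegralD//; last by apply: continuousCM => //; exact: continuousC_cst.
  by rewrite cintegralZ// mulN1r.
rewrite normcM normc_inv2l//.
have B : \int[mu]_(t in `[- l, l]) normc (w t) <= e * (2 * l).
  have -> : e * (2 * l) = e * (l - (- l)) by ring.
  rewrite -Rintegral_segment_cst; last lra.
  apply: Rintegral_segment_le; [|exact: within_cst|].
    by apply: continuous_subspaceT; exact: continuous_normc.
  by move=> x _; rewrite /w normcM normc_expi mulr1.
have l2 : 0 < (2 * l)^-1 by rewrite invr_gt0 mulr_gt0.
apply: (le_trans (ler_wpM2l (ltW l2) (normc_cintegral _ _ cw))).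
rewrite mulrC ler_pdivrMr ?mulr_gt0//.
by rewrite -mulrA ler_wpM2l.
Qed.

Lemma fourier_coef_limit h lambda c : continuousC h ->
  (forall e : R, 0 < e -> exists u c', [/\ continuousC u, forall t, normc (h t - u t) <= e,
     has_fourier_coef u lambda c' & normc (c' - c) <= e]) ->
  has_fourier_coef h lambda c.
Proof.
move=> ch H; apply/has_fourier_coefP => e e0; have e8 : 0 < e / 8 by lra.
have [u [c' [cu hu /has_fourier_coefP uc cc]]] := H _ e8.
near=> l.
have l0 : 0 < l by near: l; apply: nbhs_pinfty_gt; exact: num_real.
have Hl : normc (fourier_mean l lambda u - c') < e / 8 by near: l; exact: uc.
have := fourier_mean_close lambda l0 cu ch hu.
have := normcBD (fourier_mean l lambda h) c (fourier_mean l lambda u).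
have := normcBD (fourier_mean l lambda u) c c'; lra.
Unshelve. all: by end_near. Qed.

Lemma trig_poly_continuous p : trig_poly p -> continuousC p.
Proof.
move=> [n [c [m ->]]].
apply: (@cintegral_sum R 0 0 n (fun k t => c k * expi (m k * t)) _).1 => k.
by apply: continuousCM; [exact: continuousC_cst|exact: continuousC_expi].
Qed.

Lemma trig_poly_translation p (t : R) : trig_poly p -> trig_poly (fun x => p (x + t)).
Proof.
move=> [n [c [m ->]]]; exists n, (fun k => c k * expi (m k * t)), m.
apply/funext => x; apply: eq_bigr => k _.
by rewrite -mulrA -expiD; congr (_ * expi _); ring.
Qed.

Lemma mean_continuousC u (l : R) : continuousC u ->
  mean l u = ((2 * l)^-1 * \int[mu]_(t in `[- l, l]) normc (u t))%:E.
Proof.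
move=> cu; rewrite /mean EFinM /Rintegral fineK//.
apply: integrable_fin_num => //.
exact: (continuous_segment_integrable _ _ (continuous_normc cu)).
Qed.

Lemma cintegral_norm2 u (a b : R) : continuousC u ->
  complex.Re (cintegral a b (fun t => u t * (u t)^*)) =
  \int[mu]_(t in `[a, b]) (normc (u t) ^+ 2).
Proof.
move=> cu /=; apply: eq_Rintegral => t _.
by rewrite -sqr_normc normcE -rmorphXn.
Qed.

Lemma sum_near0 n (F : 'I_n -> R -> C) :
  (forall k (d : R), 0 < d -> \forall l \near +oo%R, normc (F k l) < d) ->
  forall d : R, 0 < d -> \forall l \near +oo%R, normc (\sum_k F k l) < d.
Proof.
elim: n F => [|n IH] F HF d d0.
  by apply: nearW => l; rewrite big_ord0 normc_zero.
have d2 : 0 < d / 2 by lra.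
have H1 := IH (fun k => F (lift ord0 k)) (fun k => HF _) _ d2.
apply: filterS (filterI (HF ord0 _ d2) H1) => l [h1 h2].
rewrite big_ord_recl (le_lt_trans (normcD _ _))//; move: h1 h2 => /=; lra.
Qed.

Lemma pinfty_gt (x : R) : \forall l \near +oo%R, x < l.
Proof. by apply: nbhs_pinfty_gt; exact: num_real. Qed.

(** If [p] is a trigonometric polynomial, the mean of [u * p^*] is zero. Hence that
    of [|u|^2] is at most a constant times [M] times the mean of [|u - p|], and it
    vanishes. The mean of [|u|] then vanishes by [|u| <= d / 2 + |u|^2 / (2 d)]. *)
Lemma zero_fourier_coef_null u (M : R) : continuousC u -> (forall t, normc (u t) <= M) ->
  (forall e : R, 0 < e -> exists2 p, trig_poly p & mean_le e (fun t => u t - p t)) ->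
  (forall lambda, has_fourier_coef u lambda 0) -> mean_le 0 u.
Proof.
move=> cu uM approx coef.
have M0 : 0 <= M by apply: le_trans (uM 0); exact: normc_ge0.
have cuu : continuousC (fun t => u t * (u t)^*).
  by apply: continuousCM => //; exact: continuousC_conj.
have sq (e : R) : 0 < e -> \forall l \near +oo%R,
    (2 * l)^-1 * \int[mu]_(t in `[- l, l]) (normc (u t) ^+ 2) <= e.
  move=> e0; pose e' := e / (8 * (M + 1)).
  have e'0 : 0 < e' by rewrite divr_gt0//; lra.
  have [p tp up] := approx _ e'0.
  have cp := trig_poly_continuous tp.
  have [n [c [m pE]]] := tp.
  pose U l := ((2 * l)^-1)%:C * cintegral (- l) l (fun t => u t * (p t)^*).
  have cup : continuousC (fun t => u t * (p t)^*).
    by apply: continuousCM => //; exact: continuousC_conj.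
  have UE l : U l = \sum_(k < n) (c k)^* * fourier_mean l (m k) u.
    have cF (k : 'I_n) : continuousC (fun t => (c k)^* * (u t * expi (- (m k * t)))).
      by apply: continuousCM; [exact: continuousC_cst|exact: continuousC_fourier].
    rewrite /U (_ : (fun t => _) = fun t => \sum_k (c k)^* * (u t * expi (- (m k * t)))).
      rewrite (cintegral_sum _ _ cF).2 mulr_sumr; apply: eq_bigr => k _.
      by rewrite cintegralZ; [rewrite /fourier_mean mulrCA|exact: continuousC_fourier].
    apply/funext => t; rewrite pE rmorph_sum mulr_sumr; apply: eq_bigr => k _.
    by rewrite rmorphM expiN [RHS]mulrCA.
  have U0 (d : R) : 0 < d -> \forall l \near +oo%R, normc (U l) < d.
    move=> d0; have H : \forall l \near +oo%R,
        normc (\sum_(k < n) (c k)^* * fourier_mean l (m k) u) < d.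
      apply: sum_near0 => // k d' d'0; have nc := normc_ge0 (c k).
      have d'' : 0 < d' / (normc (c k) + 1) by rewrite divr_gt0//; lra.
      have /has_fourier_coefP/(_ _ d'') := coef (m k).
      apply: filterS => l; rewrite subr0 => h; rewrite normcM normcJ.
      have h2 := ler_wpM2l nc (ltW h).
      rewrite (le_lt_trans h2)// mulrA ltr_pdivrMr; nra.
    by apply: filterS H => l; rewrite UE.
  have e2 : 0 < e / 2 by lra.
  have H1 := U0 _ e2; have H2 := up _ e'0.
  apply: filterS (filterI (pinfty_gt 0) (filterI H1 H2)) => l [/= l0 [Ul]].
  have cup' := continuousCB cu cp.
  rewrite mean_continuousC// lee_fin => ml.
  have l2 : 0 < (2 * l)^-1 by rewrite invr_gt0 mulr_gt0.
  have cd : continuousC (fun t => u t * (u t - p t)^*).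
    by apply: continuousCM => //; exact: continuousC_conj.
  pose V := ((2 * l)^-1)%:C * cintegral (- l) l (fun t => u t * (u t - p t)^*).
  have -> : (2 * l)^-1 * \int[mu]_(t in `[- l, l]) (normc (u t) ^+ 2) = complex.Re (U l + V).
    rewrite -cintegral_norm2// /U /V -mulrDr -cintegralD//.
    rewrite ReM [complex.Im (_%:C)]/= mul0r subr0; congr (_ * complex.Re (cintegral _ _ _)).
    by apply/funext => t; rewrite -mulrDr -rmorphD addrC subrK.
  have nV : normc V <= e / 2.
    rewrite normcM normc_inv2l//.
    have B : \int[mu]_(t in `[- l, l]) normc (u t * (u t - p t)^*) <=
        M * \int[mu]_(t in `[- l, l]) normc (u t - p t).
      have cn := continuous_normc cup'.
      rewrite -RintegralZl//; last exact: continuous_segment_integrable.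
      apply: Rintegral_segment_le.
      + by apply: continuous_subspaceT; exact: continuous_normc.
      + apply: continuous_subspaceT => x; apply: cvgM; [exact: cvg_cst|exact: cn].
      + by move=> x _; rewrite normcM normcJ ler_wpM2r// normc_ge0.
    have B2 := le_trans (normc_cintegral (- l) l cd) (ler_wpM2l (ltac:(lra) : 0 <= (2 : R)) B).
    apply: (le_trans (ler_wpM2l (ltW l2) B2)).
    move: ml; move: (\int[mu]_(t in _) _) => I ml.
    have -> : (2 * l)^-1 * (2 * (M * I)) = 2 * M * ((2 * l)^-1 * I) by ring.
    have h := ler_wpM2l (ltac:(lra) : 0 <= 2 * M) ml.
    apply: (le_trans h).
    have -> : 2 * M * (e' + e') = (e / 2) * (M / (M + 1)).
      by rewrite /e'; field; rewrite gt_eqF//; lra.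
    rewrite ler_piMr ?(ltW e2)// ler_pdivrMr; lra.
  rewrite (le_trans (ler_norm _))// (le_trans (ler_Re_normc _))//.
  by rewrite (le_trans (normcD _ _))// (splitr e) lerD// ltW.
move=> d d0; have dd : 0 < d ^+ 2 by rewrite exprn_gt0.
apply: filterS (filterI (pinfty_gt 0) (sq _ dd)) => l [/= l0 sl].
have l2 : 0 < (2 * l)^-1 by rewrite invr_gt0 mulr_gt0.
have cn := continuous_normc cu.
have cn2 : continuous (fun t => normc (u t) ^+ 2).
  by move=> x; exact: (cvgM (cn x) (cn x)).
rewrite mean_continuousC// add0r lee_fin.
have B : \int[mu]_(t in `[- l, l]) normc (u t) <=
    d / 2 * (2 * l) + (2 * d)^-1 * \int[mu]_(t in `[- l, l]) (normc (u t) ^+ 2).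
  have -> : d / 2 * (2 * l) = d / 2 * (l - (- l)) by ring.
  rewrite -Rintegral_segment_cst; last lra.
  have c1 : continuous (fun t : R => (2 * d)^-1 * normc (u t) ^+ 2).
    by move=> x; apply: (cvgM (cvg_cst _) (cn2 x)).
  rewrite -RintegralZl//; last exact: continuous_segment_integrable.
  rewrite -RintegralD//;
    [|exact/segment_integrable/within_cst|exact: continuous_segment_integrable].
  apply: Rintegral_segment_le.
  - exact: continuous_subspaceT.
  - by apply: continuous_subspaceT => x; apply: (cvgD (cvg_cst _) (c1 x)).
  - move=> x _; move: (normc (u x)) => y.
    rewrite -subr_ge0; have -> : d / 2 + (2 * d)^-1 * y ^+ 2 - y = (2 * d)^-1 * (y - d) ^+ 2.
      by field; rewrite gt_eqF.
    by rewrite mulr_ge0 ?sqr_ge0// invr_ge0 mulr_ge0// ltW.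
apply: (le_trans (ler_wpM2l (ltW l2) B)).
have d2 : 0 <= (2 * d)^-1 by rewrite invr_ge0 mulr_ge0// ltW.
have h := ler_wpM2l d2 sl.
move: h; move: (\int[mu]_(t in _) _) => I h.
rewrite mulrDr mulrCA [X in _ + X]mulrCA; apply: (le_trans (lerD (lexx _) h)).
rewrite le_eqVlt; apply/orP; left; apply/eqP; field.
by rewrite gt_eqF// gt_eqF.
Qed.

(** A trigonometric polynomial close to [u] in the mean is, after translation,
    close to [h]. *)
Lemma besicovitch_limit h : continuousC h ->
  (forall e : R, 0 < e -> exists u t, [/\ continuousC u, besicovitch u &
     forall x, normc (h x - u (x + t)) <= e]) -> besicovitch h.
Proof.
move=> ch H; split; [exact: continuous_locally_integrable ch.1|
  exact: continuous_locally_integrable ch.2|].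
move=> e e0; have e8 : 0 < e / 8 by lra.
have [u [t [cu [_ _ approx] hu]]] := H _ e8.
have [p tp up] := approx _ e8.
have tp' := trig_poly_translation t tp.
exists (fun x => p (x + t)) => //.
have cp := trig_poly_continuous tp; have cp' := trig_poly_continuous tp'.
have m1 : mean_le (e / 8) (fun x => u x - p x) by apply/mean_seminorm_le/ltW.
have cup := continuousC_measurable (continuousCB cu cp).
have m2 := mean_le_translation t (ltW e8) cup m1.
have cut := continuousC_translation t cu.
have m3 : mean_le (e / 8) (fun x => h x - u (x + t)).
  by apply: mean_le_bounded (ltW e8) hu; apply: continuousC_measurable; exact: continuousCB.
have m4 : mean_le (e / 8 + 2 * (e / 8)) (fun x => h x - p (x + t)).
  apply: mean_le_sum m3 m2; try (by apply: continuousC_measurable; exact: continuousCB).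
  by move=> x; exact: normcBD.
apply: (@le_lt_trans _ _ (e / 8 + 2 * (e / 8))%:E); first exact/mean_seminorm_le.
by rewrite lte_fin; lra.
Qed.

End FourierCoefficients.

(** * Limit characters *)

Section UnitCircle.
Context {R : realType}.
Notation C := R[i].

Lemma expi_surj (z : C) : normc z = 1 -> exists t : R, expi t = z.
Proof.
case: z => x y nz.
have xy : x ^+ 2 + y ^+ 2 = 1.
  by rewrite -[LHS]sqr_sqrtr ?addr_ge0 ?sqr_ge0// [Num.sqrt _]nz expr1n.
have y2 : 0 <= y ^+ 2 by rewrite sqr_ge0.
have x1 : -1 <= x <= 1 by apply/andP; split; nra.
have sx : sin (acos x) = `|y|.
  rewrite sin_acos// -sqrtr_sqr; congr Num.sqrt; lra.
have [y0|y0] := leP 0 y.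
  by exists (acos x); rewrite /expi acosK ?in_itv//= sx ger0_norm.
by exists (- acos x); rewrite /expi cosN sinN acosK ?in_itv//= sx ltr0_norm// opprK.
Qed.

Lemma ultra_real_limit (T : Type) (U : set_system T) (UU : UltraFilter U) (g : T -> R) (M : R) :
  (forall t, `|g t| <= M) ->
  exists x, forall e : R, 0 < e -> U [set t | `|g t - x| <= e].
Proof.
move=> gM.
have gK : U (g @^-1` `[- M, M]%classic).
  apply: filterE => t /=; rewrite in_itv/=; have := gM t; rewrite ler_norml//.
have [x [_ clx]] := segment_compact (fmap_proper_filter g _) gK.
exists x => e e0; have [//|Uc] := in_ultra_setVsetC [set t | `|g t - x| <= e] UU.
have [y [/= ye xy]] := clx [set y | ~ (`|y - x| <= e)] (ball x e) Uc (nbhsx_ballx _ _ e0).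
by exfalso; apply: ye; move: xy; rewrite /ball/= distrC => /ltW.
Qed.

(** Every ultrafilter of translations has a limit character: the point of the Bohr
    compactification of the line to which it converges. *)
Lemma ultra_character (U : set_system R) : UltraFilter U ->
  exists chi : R -> C, [/\ character chi, forall x, normc (chi x) = 1 &
    forall x (e : R), 0 < e -> U [set t | normc (expi (x * t) - chi x) <= e]].
Proof.
move=> UU.
have /choice[chi chiP] : forall x : R, exists c : C, forall e : R, 0 < e ->
    U [set t | normc (expi (x * t) - c) <= e].
  move=> x.
  have [a aP] := ultra_real_limit UU (fun t => (cos_max (x * t) : `|cos (x * t)| <= 1)).
  have [b bP] := ultra_real_limit UU (fun t => (sin_max (x * t) : `|sin (x * t)| <= 1)).
  exists (a +i* b) => e e0; have e2 : 0 < e / 2 by lra.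
  apply: filterS (filterI (aP _ e2) (bP _ e2)) => t [h1 h2].
  by apply: le_trans (normc_le_ReIm _) _; rewrite (splitr e); exact: lerD.
have pick x y z (e : R) : 0 < e -> exists t, [/\ normc (expi (x * t) - chi x) <= e,
    normc (expi (y * t) - chi y) <= e & normc (expi (z * t) - chi z) <= e].
  move=> e0; have [t [[h1 h2] h3]] := filter_ex (filterI (filterI
    (chiP x e e0) (chiP y e e0)) (chiP z e e0)); by exists t.
have n1 x : normc (chi x) = 1.
  apply/eqP; rewrite -subr_eq0 -normr_eq0 eq_le normr_ge0 andbT.
  apply/ler_addgt0Pr => e e0; rewrite add0r.
  have [t [h _ _]] := pick x x x e e0.
  have := normcD (expi (x * t) - chi x) (chi x); rewrite subrK normc_expi.
  have := normcD (chi x - expi (x * t)) (expi (x * t)); rewrite subrK normc_expi normcB.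
  rewrite ler_norml; lra.
exists chi; split => //; split.
- move=> x y; apply/eqP; rewrite -subr_eq0; apply/eqP/normc_le_eps => e e0.
  have e3 : 0 < e / 3 by lra.
  have [t [h1 h2 h3]] := pick x y (x + y) _ e3.
  have -> : chi (x + y) - chi x * chi y = - (expi ((x + y) * t) - chi (x + y)) +
      ((expi (x * t) - chi x) * expi (y * t) + chi x * (expi (y * t) - chi y)).
    by rewrite mulrDl expiD; ring.
  rewrite (le_trans (normcD _ _))// normc_opp.
  have := normcD ((expi (x * t) - chi x) * expi (y * t)) (chi x * (expi (y * t) - chi y)).
  rewrite [X in _ <= X + _ -> _]normcM [X in _ <= _ + X -> _]normcM normc_expi n1 mulr1 mul1r; lra.
- apply/eqP; rewrite -subr_eq0; apply/eqP/normc_le_eps => e e0.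
  have [t [h _ _]] := pick 0 0 0 e e0.
  by move: h; rewrite mul0r expi0 normcB.
Qed.

Lemma filter_forall_lt (T : Type) (F : set_system T) (FF : Filter F) n (A : nat -> set T) :
  (forall j, (j < n)%N -> F (A j)) -> F [set t | forall j, (j < n)%N -> A j t].
Proof.
elim: n => [|n IH] H; first by apply: filterE => t j.
apply: filterS (filterI (IH (fun j jn => H j (ltnW jn))) (H n (ltnSn n))) => t [H1 H2] j.
by rewrite ltnS leq_eqVlt => /predU1P[->//|/H1].
Qed.

(** The argument of [chi] can be prescribed on the independent family of
    [integral_basis] only: that it agrees with [chi] at each [lam j] uses that the
    coordinates there are integers. *)
Lemma character_Qlinear (chi : R -> C) (lam : nat -> R) n : character chi ->
  (forall x, normc (chi x) = 1) ->
  exists2 psi : R -> R, Qlinear_on (rat_span n lam) psi &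
    forall j, (j < n)%N -> chi (lam j) = expi (psi (lam j)).
Proof.
move=> chiP n1; have [m [mu [ind gen _]]] := integral_basis lam n.
have /choice[theta thetaP] : forall k, exists t : R, expi t = chi (mu k).
  by move=> k; exact: expi_surj.
have [psi psiQ psiE] := rat_linear_extension theta ind.
exists psi; last first.
  move=> j /gen[z ->]; rewrite psiE.
  exact: (character_expi_sum chiP (fun k _ => esym (thetaP k))).
apply: Qlinear_onS psiQ => _ [q ->].
apply: (big_ind (fun x => rat_span m mu x)) => [|_ _ [p ->] [r ->]|j _].
- by exists (fun=> 0); rewrite big1// => k _; rewrite rmorph0 mul0r.
- exists (fun k => p k + r k); rewrite -big_split/=; apply: eq_bigr => k _.
  by rewrite rmorphD/= mulrDl.
- have [z ->] := gen j (ltn_ord j); apply: rat_spanZ.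
  by exists (fun k => (z k)%:~R); apply: eq_bigr => k _; rewrite ratr_int.
Qed.

(** Kronecker's theorem is applied to an independent family of generators. The
    ultrafilter of approximating translations has a limit character that agrees with
    [expi \o psi] on that family, hence at each [lam j]; this avoids estimates for
    powers of unit complex numbers. *)
Lemma Qlinear_approx (psi : R -> R) (lam : nat -> R) n (d : nat -> R) :
  Qlinear_on (rat_span n lam) psi -> (forall j, 0 < d j) ->
  exists t : R, forall j, (j < n)%N ->
    normc (expi (lam j * t) - expi (psi (lam j))) <= d j.
Proof.
move=> psiQ d0; have [m [mu [ind gen sp]]] := integral_basis lam n.
pose E (e : R) := [set t : R | forall k, (k < m)%N ->
  normc (expi (mu k * t) - expi (psi (mu k))) < e].
have FF : ProperFilter (filter_from [set e : R | 0 < e] E).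
  apply: filter_from_proper; last first.
    by move=> e e0; exact: (kronecker (fun k => psi (mu k)) ind e0).
  apply: filter_from_filter; first by exists 1 => /=.
  move=> e e' e0 e'0; exists (Num.min e e'); first by rewrite /= lt_min e0.
  by move=> t Et; split => k km; have := Et k km; rewrite lt_min => /andP[].
have [U [UU FU]] := ultraFilterLemma FF.
have [chi [chiP n1 Uchi]] := ultra_character UU.
have chimu k : (k < m)%N -> chi (mu k) = expi (psi (mu k)).
  move=> km; apply/eqP; rewrite -subr_eq0; apply/eqP/normc_le_eps => e e0.
  have e2 : 0 < e / 2 by lra.
  have UE : U (E (e / 2)) by apply: FU; exists (e / 2).
  have [t [h1 h2]] := filter_ex (filterI UE (Uchi (mu k) _ e2)).
  have := h1 k km; have := normcBD (chi (mu k)) (expi (psi (mu k))) (expi (mu k * t)).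
  rewrite [normc (chi (mu k) - expi (mu k * t))]normcB; move: h2 => /=; lra.
have chil j : (j < n)%N -> chi (lam j) = expi (psi (lam j)).
  move=> /gen[z ->]; rewrite (Qlinear_on_sum z psiQ sp).
  exact: (character_expi_sum chiP chimu).
have UA : U [set t | forall j, (j < n)%N -> normc (expi (lam j * t) - expi (psi (lam j))) <= d j].
  apply: filter_forall_lt => j jn; rewrite -chil//; exact: Uchi.
by have [t tP] := filter_ex UA; exists t.
Qed.

End UnitCircle.

(** * Dirichlet series of the functions of the hull *)

Local Notation vline := Defs.vline.

Section DirichletSeries.
Context {R : realType}.
Notation C := R[i].
Variables alpha beta : \bar R.
Implicit Types (f g h : C -> C) (L : exponents R).

Local Notation in_dom := (in_dom alpha beta).
Local Notation reduced := (reduced alpha beta).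
Local Notation almost_periodic := (almost_periodic alpha beta).
Local Notation hull := (hull alpha beta).
Local Notation dirichlet_series := (dirichlet_series alpha beta).
Local Notation besicovitch_on_U := (besicovitch_on_U alpha beta).
Local Notation Beq := (Beq alpha beta).
Local Notation DLambda := (DLambda alpha beta).
Local Notation equivalent := (equivalent alpha beta).

Lemma strip_vline (s1 s2 sigma t : R) : s1 < sigma -> sigma < s2 -> strip s1 s2 (sigma +i* t).
Proof. by move=> h1 h2; rewrite /strip/= !ltW. Qed.

Lemma vline_vtranslate f (sigma tau t : R) :
  vline (vtranslate tau f) sigma t = vline f sigma (t + tau).
Proof. by rewrite /vline /vtranslate; congr f; simpc. Qed.

Lemma vline_continuous f (sigma : R) : holomorphic_on_U alpha beta f ->
  in_dom sigma -> continuousC (vline f sigma).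
Proof.
move=> hf sd.
have key (t e : R) : 0 < e -> \forall y \near t, normc (vline f sigma y - vline f sigma t) <= e.
  move=> e0; have [d d0 dP] := @holomorphic_continuous _ _ _ f (sigma +i* t) hf sd e e0.
  apply/nbhs_ballP; exists d => // y; rewrite /ball/= => ty.
  rewrite /vline (_ : sigma +i* y = (sigma +i* t) + (y - t) *i); last first.
    by simpc; congr (_ +i* _); ring.
  by apply: dP; rewrite (le_lt_trans (normc_le_ReIm _))//= normr0 add0r distrC.
split=> t; apply/cvgrPdist_le => /= e /(key t); apply: filterS => y; apply: le_trans;
  rewrite normcB.
  by rewrite -ReN -ReD; exact: ler_Re_normc.
by rewrite -ImN -ImD; exact: ler_Im_normc.
Qed.

Lemma vline_bounded f (sigma : R) : almost_periodic f -> in_dom sigma ->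
  exists M : R, forall t, normc (vline f sigma t) <= M.
Proof.
move=> apf sd; have [s1 [s2 [rs s1s ss2]]] := reduced_around sd.
have [M MP] := almost_periodic_bounded apf rs.
by exists M => t; apply: MP; exact: strip_vline.
Qed.

Lemma hull_besicovitch f h (sigma : R) : almost_periodic f -> hull f h -> in_dom sigma ->
  besicovitch (vline f sigma) -> besicovitch (vline h sigma).
Proof.
move=> apf hh sd bf.
have aph := hull_almost_periodic apf hh.
apply: besicovitch_limit; first exact: (vline_continuous aph.1).
move=> e e0; have [s1 [s2 [rs s1s ss2]]] := reduced_around sd.
have [tau tauP] := hh s1 s2 e rs e0.
exists (vline f sigma), tau; split => //; first exact: (vline_continuous apf.1).
by move=> x; rewrite -vline_vtranslate; apply: tauP; exact: strip_vline.
Qed.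

(** The translates of [f] tend to [h] along the filter [U] of translations. *)
Definition converges_along (U : set_system R) f h := forall s1 s2 e : R,
  reduced s1 s2 -> 0 < e ->
  U [set tau | forall s, strip s1 s2 s -> normc (vtranslate tau f s - h s) <= e].

(** Translation by [tau] multiplies the coefficient at [lambda] by
    [expi (lambda * tau)], and Fourier coefficients are continuous for uniform
    convergence on a line. *)
Lemma dirichlet_limit f h L a (U : set_system R) (chi : R -> C) :
  almost_periodic f -> almost_periodic h -> dirichlet_series L a f ->
  ProperFilter U -> converges_along U f h ->
  (forall x (e : R), 0 < e -> U [set t | normc (expi (x * t) - chi x) <= e]) ->
  dirichlet_series L (fun j => a j * chi (L j)) h.
Proof.
move=> apf aph fa UU Uh Uchi sigma sd.
have [s1 [s2 [rs s1s ss2]]] := reduced_around sd.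
have [M MP] := vline_bounded apf sd.
have cf := vline_continuous apf.1 sd; have ch := vline_continuous aph.1 sd.
have key lambda c : has_fourier_coef (vline f sigma) lambda c ->
    has_fourier_coef (vline h sigma) lambda (c * chi lambda).
  move=> fc; apply: fourier_coef_limit ch _ => e e0.
  have nc := normc_ge0 c.
  have e' : 0 < e / (normc c + 1) by rewrite divr_gt0//; lra.
  have [tau [t1 t2]] := filter_ex (filterI (Uh s1 s2 e rs e0) (Uchi lambda _ e')).
  exists (fun x => vline f sigma (x + tau)), (c * expi (lambda * tau)); split.
  - exact: continuousC_translation.
  - move=> t; rewrite -vline_vtranslate normcB; apply: t1; exact: strip_vline.
  - exact: fourier_coef_translation MP fc.
  - rewrite -mulrBr normcM; apply: (le_trans (ler_wpM2l nc t2)).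
    rewrite mulrA ler_pdivrMr; nra.
have [fj f0] := fa sigma sd; split.
- by move=> j /fj/key; rewrite mulrAC.
- by move=> lambda /f0/key; rewrite mul0r.
Qed.

Lemma reduced_union (s1 s2 t1 t2 : R) : reduced s1 s2 -> reduced t1 t2 ->
  reduced (Num.min s1 t1) (Num.max s2 t2).
Proof.
move=> [as1 s12 s2b] [at1 t12 t2b]; split.
- by rewrite /Num.min; case: ifP.
- by rewrite lt_max !gt_min s12 t12.
- by rewrite /Num.max; case: ifP.
Qed.

Lemma strip_sub (s1 s2 t1 t2 : R) s : s1 <= t1 -> t2 <= s2 -> strip t1 t2 s -> strip s1 s2 s.
Proof.
by move=> h1 h2 /andP[h3 h4]; rewrite /strip/= (le_trans h1)//= (le_trans h4).
Qed.

(** Sets indexed decreasingly by strips and precisions form a filter base, since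
    two reduced strips are contained in a third one. *)
Lemma strip_ultrafilter (T : Type) (A : R -> R -> R -> set T) : (alpha < beta)%E ->
  (forall s1 s2 e, reduced s1 s2 -> 0 < e -> A s1 s2 e !=set0) ->
  (forall s1 s2 e t1 t2 d, s1 <= t1 -> t2 <= s2 -> e <= d -> A s1 s2 e `<=` A t1 t2 d) ->
  exists2 U : set_system T, UltraFilter U &
    forall s1 s2 e, reduced s1 s2 -> 0 < e -> U (A s1 s2 e).
Proof.
move=> ab A0 AS.
pose D := [set p : R * R * R | reduced p.1.1 p.1.2 /\ 0 < p.2].
pose A' (p : R * R * R) := A p.1.1 p.1.2 p.2.
have FF : ProperFilter (filter_from D A').
  apply: filter_from_proper; last by move=> [[s1 s2] e] [/= rs e0]; exact: A0.
  apply: filter_from_filter.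
    by have [s1 [s2 rs]] := reduced_ex ab; exists (s1, s2, 1); split => /=.
  move=> [[s1 s2] e] [[t1 t2] d] [/= rs e0] [/= rt d0].
  exists (Num.min s1 t1, Num.max s2 t2, Num.min e d).
    by split => /=; [exact: reduced_union|rewrite lt_min e0].
  by rewrite /A' /= => x Ax; split; apply: AS Ax; rewrite ?ge_min ?le_max lexx ?orbT.
have [U [UU FU]] := ultraFilterLemma FF.
by exists U => // s1 s2 e rs e0; apply: FU; exists (s1, s2, e).
Qed.

Lemma hull_converges f h : (alpha < beta)%E -> hull f h ->
  exists2 U : set_system R, UltraFilter U & converges_along U f h.
Proof.
move=> ab hh; apply: (strip_ultrafilter (A := fun s1 s2 e => [set tau | forall s,
    strip s1 s2 s -> normc (vtranslate tau f s - h s) <= e])) => //.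
- move=> s1 s2 e rs e0; have [tau tauP] := hh s1 s2 e rs e0.
  by exists tau => s /tauP; rewrite normcB.
- move=> s1 s2 e t1 t2 d h1 h2 ed tau H s st.
  by rewrite (le_trans _ ed)//; apply: H; exact: strip_sub st.
Qed.

Lemma Qspan_rat_span L n : Qspan L n = rat_span n L.
Proof.
apply/seteqP; split => x [q ->]; last by exists q.
exists (fun k => if insub k is Some i then q i else 0).
by apply: eq_bigr => j _; rewrite valK.
Qed.

Lemma hull_equivalent f h L a : (alpha < beta)%E -> almost_periodic f ->
  dirichlet_series L a f -> hull f h -> DLambda L h /\ equivalent L f h.
Proof.
move=> ab apf fa hh; have aph := hull_almost_periodic apf hh.
have [U UU Uh] := hull_converges ab hh.
have [chi [chiP n1 Uchi]] := ultra_character UU.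
have hb := dirichlet_limit apf aph fa ultra_proper Uh Uchi.
split; first by split => //; eexists; exact: hb.
exists a, (fun j => a j * chi (L j)); split; [exact: fa|exact: hb|move=> n _ _].
have [psi psiQ psiE] := character_Qlinear L n chiP n1.
by exists psi; [rewrite Qspan_rat_span|move=> j /psiE ->].
Qed.

Lemma Beq_sym f g : Beq f g -> Beq g f.
Proof.
move=> fg sigma /fg; rewrite (_ : (fun t => _) = fun t => - (vline g sigma t - vline f sigma t)).
  rewrite /mean_seminorm.
  by under [X in limf_esup X _]funext do under eq_integral do rewrite normc_opp.
by apply/funext => t; rewrite opprB.
Qed.

Lemma besicovitch_measurable (u : R -> C) : besicovitch u -> measurableC u.
Proof. by move=> [[mr _ _] [mi _ _] _]. Qed.

Lemma besicovitch_on_U_measurable f (sigma : R) : besicovitch_on_U f -> in_dom sigma ->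
  measurableC (vline f sigma).
Proof. by move=> [bf _] /bf; exact: besicovitch_measurable. Qed.

Lemma Beq_trans f g h : besicovitch_on_U f -> besicovitch_on_U g -> besicovitch_on_U h ->
  Beq f g -> Beq g h -> Beq f h.
Proof.
move=> bf bg bh fg gh sigma sd; apply/mean_seminorm_eq0.
have mf := besicovitch_on_U_measurable bf sd.
have mg := besicovitch_on_U_measurable bg sd.
have mh := besicovitch_on_U_measurable bh sd.
rewrite -(addr0 0).
apply: (mean_le_sum _ _ _ _ (iffLR (mean_seminorm_eq0 _) (fg sigma sd))
  (iffLR (mean_seminorm_eq0 _) (gh sigma sd))).
all: try exact: measurableCB.
by move=> t; exact: normcBD.
Qed.

Lemma Beq_vtranslate f g (tau : R) : besicovitch_on_U f -> besicovitch_on_U g ->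
  Beq f g -> Beq (vtranslate tau f) (vtranslate tau g).
Proof.
move=> bf bg fg sigma sd; apply/mean_seminorm_eq0.
have mf := besicovitch_on_U_measurable bf sd.
have mg := besicovitch_on_U_measurable bg sd.
rewrite (_ : (fun t => _) = (fun t => (fun x => vline f sigma x - vline g sigma x) (t + tau))).
  rewrite -(mulr0 2); apply: (@mean_le_translation _
    (fun x => vline f sigma x - vline g sigma x) 0 tau) => //.
    exact: measurableCB.
  exact: (iffLR (mean_seminorm_eq0 _) (fg sigma sd)).
by apply/funext => t; rewrite !vline_vtranslate.
Qed.

Lemma hull_besicovitch_on_U f h : (alpha < beta)%E -> almost_periodic f ->
  besicovitch_on_U f -> hull f h -> besicovitch_on_U h.
Proof.
move=> ab apf [bf [L [a fa]]] hh; split.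
  by move=> sigma sd; exact: hull_besicovitch (bf sigma sd).
by have [[_ [b hb]] _] := hull_equivalent ab apf fa hh; exists L, b.
Qed.

Lemma fourier_coefB (u v : R -> C) lambda c d : continuousC u -> continuousC v ->
  has_fourier_coef u lambda c -> has_fourier_coef v lambda d ->
  has_fourier_coef (fun t => u t - v t) lambda (c - d).
Proof.
move=> cu cv /has_fourier_coefP H /has_fourier_coefP K.
apply/has_fourier_coefP => e e0; have e2 : 0 < e / 2 by lra.
apply: filterS (filterI (H _ e2) (K _ e2)) => l [h1 h2].
have cu' := continuousC_fourier lambda cu; have cv' := continuousC_fourier lambda cv.
have -> : fourier_mean l lambda (fun t => u t - v t) - (c - d) =
    (fourier_mean l lambda u - c) - (fourier_mean l lambda v - d).
  rewrite /fourier_mean.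
  have -> : (fun t => (u t - v t) * expi (- (lambda * t))) =
    (fun t => u t * expi (- (lambda * t)) + (-1) * (v t * expi (- (lambda * t)))).
    by apply/funext => t; ring.
  rewrite cintegralD//; last by apply: continuousCM => //; exact: continuousC_cst.
  by rewrite cintegralZ//; ring.
rewrite (le_lt_trans (normcD _ _))// normc_opp (splitr e); exact: ltrD.
Qed.

Lemma trig_polyB (p q : R -> C) : trig_poly p -> trig_poly q ->
  trig_poly (fun t => p t - q t).
Proof.
move=> [n [c [m ->]]] [n' [c' [m' ->]]].
exists (n + n')%N, (fun k => match fintype.split k with inl i => c i | inr i => - c' i end),
  (fun k => match fintype.split k with inl i => m i | inr i => m' i end).
apply/funext => t; rewrite big_split_ord/= -sumrN; congr (_ + _); apply: eq_bigr => k _.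
- by rewrite -[lshift _ _]/(unsplit (inl k)) unsplitK.
- by rewrite -[rshift _ _]/(unsplit (inr k)) unsplitK mulNr.
Qed.

(** The uniqueness theorem for Dirichlet series. *)
Lemma dirichlet_Beq f g L a b : almost_periodic f -> almost_periodic g ->
  besicovitch_on_U f -> besicovitch_on_U g ->
  dirichlet_series L a f -> dirichlet_series L b g ->
  (forall j, le_card j.+1 L -> a j = b j) -> Beq f g.
Proof.
move=> apf apg [bf _] [bg _] fa gb eab sigma sd.
have cf := vline_continuous apf.1 sd; have cg := vline_continuous apg.1 sd.
have [M MP] := vline_bounded apf sd; have [N NP] := vline_bounded apg sd.
apply/mean_seminorm_eq0; apply: (@zero_fourier_coef_null _ _ (M + N)).
- exact: continuousCB.
- by move=> t; rewrite (le_trans (normcD _ _))// normc_opp lerD.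
- move=> e e0; have e2 : 0 < e / 2 by lra.
  have [_ _ /(_ _ e2)[p tp fp]] := bf sigma sd.
  have [_ _ /(_ _ e2)[q tq gq]] := bg sigma sd.
  exists (fun t => p t - q t); first exact: trig_polyB.
  have cp := trig_poly_continuous tp; have cq := trig_poly_continuous tq.
  rewrite (splitr e); apply: mean_le_sum; last 2 first.
  + exact/mean_seminorm_le/ltW/fp.
  + exact/mean_seminorm_le/ltW/gq.
  + by apply: continuousC_measurable; apply: continuousCB; exact: continuousCB.
  + by apply: continuousC_measurable; exact: continuousCB.
  + by apply: continuousC_measurable; exact: continuousCB.
  + move=> t; rewrite -(normc_opp (vline g sigma t - q t)) (le_trans _ (normcD _ _))//.
    by rewrite le_eqVlt; apply/orP; left; apply/eqP; congr normc; ring.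
- move=> lambda.
  have [fj f0] := fa sigma sd; have [gj g0] := gb sigma sd.
  have [[j [jL <-]]|n] := pselect (exists j, le_card j.+1 L /\ L j = lambda).
    have := fourier_coefB cf cg (fj j jL) (gj j jL).
    by rewrite (eab j jL) subrr.
  have nl j : le_card j.+1 L -> L j != lambda.
    by move=> jL; apply/eqP => E; apply: n; exists j.
  by have := fourier_coefB cf cg (f0 _ nl) (g0 _ nl); rewrite subr0.
Qed.

(** For each [n], some translations multiply the first [n] coefficients of [f] by
    factors close to [expi (psi_n lambda_j)], and so nearly produce those of [g]. The
    translates of [f] along an ultrafilter of such translations have a limit in the
    hull, whose coefficients are those of [g]. *)
Lemma equivalent_hull f g L : (alpha < beta)%E -> almost_periodic f ->
  besicovitch_on_U f -> DLambda L g -> besicovitch_on_U g -> equivalent L f g ->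
  exists2 h, hull f h & Beq h g.
Proof.
move=> ab apf bf [apg _] bg [a [b [fa gb E]]].
pose A n (d : R) := [set t : R | forall j, (j < n)%N -> le_card j.+1 L ->
  normc (a j * expi (L j * t) - b j) <= d].
have A0 n (d : R) : 0 < d -> A n d !=set0.
  (* only the first [card L] exponents are meaningful *)
  move=> d0; pose n' := if card_exponents L is Some N then minn n N else n.
  have nn' j : (j < n)%N -> le_card j.+1 L -> (j < n')%N.
    by rewrite /le_card /n'; case: card_exponents => // N; rewrite leq_min => -> ->.
  have n'L : le_card n' L.
    by rewrite /le_card /n'; case: card_exponents => // N; rewrite geq_minr.
  have [n'0|n'0] := posnP n'.
    by exists 0 => j jn jL; have := nn' j jn jL; rewrite n'0.
  have [psi psiQ psiE] := E n' n'0 n'L.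
  rewrite Qspan_rat_span in psiQ.
  (* the precision that makes [a_j * expi (lambda_j * t)] within [d] of [b_j] *)
  have d' j : 0 < d / (normc (a j) + 1).
    by have := normc_ge0 (a j) => ?; rewrite divr_gt0//; lra.
  have [t tP] := Qlinear_approx psiQ d'.
  exists t => j jn jL; have jn' := nn' j jn jL.
  have na := normc_ge0 (a j).
  rewrite (psiE j jn') -mulrBr normcM; apply: (le_trans (ler_wpM2l na (tP j jn'))).
  rewrite mulrA ler_pdivrMr; nra.
have FF : ProperFilter (filter_from [set p : nat * R | 0 < p.2] (fun p => A p.1 p.2)).
  apply: filter_from_proper; last by move=> [n d] /= d0; exact: A0.
  apply: filter_from_filter; first by exists (0%N, 1) => /=.
  move=> [n d] [n' d'] /= d0 d'0; exists (maxn n n', Num.min d d').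
    by rewrite /= lt_min d0.
  move=> t At; split => j jn jL; have := At j; rewrite leq_max jn ?orbT => /(_ isT jL);
    by rewrite le_min => /andP[].
have [U [UU FU]] := ultraFilterLemma FF.
have [chi [chiP n1 Uchi]] := ultra_character UU.
have Uk : U [set tau | hull f (vtranslate tau f)].
  by apply: filterE => tau; exact: hull_vtranslate.
have [h hh Uh] := hull_limit apf UU Uk.
have aph := hull_almost_periodic apf hh.
exists h => //.
apply: (dirichlet_Beq aph apg (hull_besicovitch_on_U ab apf bf hh) bg
  (dirichlet_limit apf aph fa ultra_proper Uh Uchi) gb) => j jL.
apply/eqP; rewrite -subr_eq0; apply/eqP/normc_le_eps => e e0.
have na := normc_ge0 (a j).
have e2 : 0 < e / 2 by lra.
have e' : 0 < e / 2 / (normc (a j) + 1) by rewrite divr_gt0//; lra.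
have UA : U (A j.+1 (e / 2)) by apply: FU; exists (j.+1, e / 2).
have [t [h1 h2]] := filter_ex (filterI UA (Uchi (L j) _ e')).
have := h1 j (ltnSn j) jL.
have h3 : normc (a j * chi (L j) - a j * expi (L j * t)) <= e / 2.
  rewrite -mulrBr normcM normcB; apply: (le_trans (ler_wpM2l na h2)).
  rewrite mulrA ler_pdivrMr; nra.
have := normcBD (a j * chi (L j)) (b j) (a j * expi (L j * t)); lra.
Qed.

End DirichletSeries.

(** * The closure of the translates *)

Section BesicovitchSpace.
Context {R : realType} (alpha beta : \bar R) (ab : (alpha < beta)%E).
Notation C := R[i].
Notation B := (Bspace ab).
Implicit Types (f g h : C -> C) (F G : B).

Local Notation reduced := (reduced alpha beta).
Local Notation hull := (hull alpha beta).
Local Notation Beq := (Beq alpha beta).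
Local Notation besicovitch_on_U := (besicovitch_on_U alpha beta).
Local Notation almost_periodic := (almost_periodic alpha beta).

Lemma Bclass_besicovitch F f : Bclass F f -> besicovitch_on_U f.
Proof. by have [f0 _ ->] := BclassP F; case. Qed.

Lemma Bclass_Beq F f g : Bclass F f -> Bclass F g -> Beq f g.
Proof.
have [f0 b0 ->] := BclassP F => -[bf f0f] [bg f0g].
exact: (Beq_trans bf b0 bg (Beq_sym f0f) f0g).
Qed.

Lemma Bclass_closed F f g : Bclass F f -> besicovitch_on_U g -> Beq f g -> Bclass F g.
Proof.
have [f0 b0 ->] := BclassP F => -[bf f0f] bg fg.
split; [exact: bg|exact: (Beq_trans b0 bf bg f0f fg)].
Qed.

Lemma Beq_refl f : Beq f f.
Proof.
move=> sigma sd; apply/mean_seminorm_eq0.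
by under [X in mean_le _ X]funext do rewrite subrr; exact: mean_le0.
Qed.

Lemma Bclass_ex f : besicovitch_on_U f -> exists F, Bclass F f.
Proof.
move=> bf; have P : is_Bclass alpha beta [set g | besicovitch_on_U g /\ Beq f g] by exists f.
by exists (MkBspace ab P); split => //; exact: Beq_refl.
Qed.

Lemma Bclass_nonempty F : exists f, Bclass F f.
Proof. by have [f bf ->] := BclassP F; exists f; split => //; exact: Beq_refl. Qed.

Lemma strip_dist_le_sup (s1 s2 e : R) F G f g : Bclass F f -> Bclass G g ->
  (forall s, strip s1 s2 s -> normc (f s - g s) <= e) ->
  (strip_dist s1 s2 F G <= e%:E)%E.
Proof.
move=> Ff Gg H; apply: ge_ereal_inf.
exists (ereal_sup [set (normc ((f, g).1 s - (f, g).2 s))%:E | s in strip s1 s2]).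
  by exists (f, g).
by apply: ge_ereal_sup => _ [s ss <-]; rewrite lee_fin; exact: H.
Qed.

Lemma strip_dist_lt (s1 s2 e : R) F G : (strip_dist s1 s2 F G < e%:E)%E ->
  exists f g, [/\ Bclass F f, Bclass G g &
    forall s, strip s1 s2 s -> normc (f s - g s) <= e].
Proof.
move=> /ereal_inf_lt[_ [[f g] [/= Ff Gg] <-] lt_e]; exists f, g; split => // s ss.
rewrite -lee_fin; apply: le_trans (ltW lt_e).
by apply: ereal_sup_ubound; exists s.
Qed.

Lemma vtranslates_self F : vtranslates F F.
Proof. by have [f Ff] := Bclass_nonempty F; exists 0, f; rewrite vtranslate0. Qed.

Lemma nbhs_strip_dist F (O : set B) : nbhs F O -> exists s1 s2 e : R,
  [/\ reduced s1 s2, 0 < e & forall G, (strip_dist s1 s2 F G < e%:E)%E -> O G].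
Proof.
rewrite nbhsE => -[P [oP PF] PO].
have [s1 [s2 [e [rs e0 H]]]] := oP F PF.
by exists s1, s2, e; split => // G /H /PO.
Qed.

(** The complement is open by the very definition of the topology, so the triangle
    inequality for [strip_dist] is avoided. *)
Lemma closed_strip_dist (A : set B) :
  (forall F, (forall s1 s2 e : R, reduced s1 s2 -> 0 < e ->
     exists2 G, A G & (strip_dist s1 s2 F G < e%:E)%E) -> A F) -> closed A.
Proof.
move=> H; have oC : open (~` A); last by rewrite -(setCK A); exact: open_closedC.
change (Bopen (~` A)) => F nAF.
apply: contrapT => nH; apply: nAF; apply: H => s1 s2 e rs e0.
apply: contrapT => nG; apply: nH; exists s1, s2, e; split => // G lt_e AG.
by apply: nG; exists G.
Qed.

Variable F : B.
Variable f : C -> C.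
Hypothesis Ff : Bclass F f.
Hypothesis apf : almost_periodic f.

Let bf : besicovitch_on_U f := Bclass_besicovitch Ff.

Definition hull_classes : set B := classes_of (hull f).

Lemma hull_class h : hull f h -> exists2 G, hull_classes G & Bclass G h.
Proof.
move=> hh; have [G Gh] := Bclass_ex (hull_besicovitch_on_U ab apf bf hh).
by exists G => //; exists h.
Qed.

(** Functions of the hull whose classes approach [G] on larger and larger strips
    have a limit [h] in the hull along some ultrafilter. On each line [h] differs
    from a member of [G] by a function of arbitrarily small mean. *)
Lemma closed_hull_classes : closed hull_classes.
Proof.
apply: closed_strip_dist => G H.
have [g Gg] := Bclass_nonempty G.
pose A (s1 s2 e : R) : set (C -> C) := [set k | hull f k /\ exists2 G' : B, Bclass G' k &
  (strip_dist s1 s2 G G' < e%:E)%E].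
have A0 (s1 s2 e : R) : reduced s1 s2 -> 0 < e -> A s1 s2 e !=set0.
  move=> rs e0; have [G' [k hk G'k] lt_e] := H s1 s2 e rs e0.
  by exists k; split => //; exists G'.
have AS (s1 s2 e t1 t2 d : R) : s1 <= t1 -> t2 <= s2 -> e <= d ->
    A s1 s2 e `<=` A t1 t2 d.
  move=> h1 h2 ed k [hk [G' G'k lt_e]]; split => //; exists G' => //.
  rewrite (le_lt_trans (strip_dist_le _ _ h1 h2))// (lt_le_trans lt_e)//.
have [U UU UA] := strip_ultrafilter ab A0 AS.
have [s1 [s2 rs]] := reduced_ex ab.
have Uk : U [set k | hull f k] by apply: filterS (UA _ _ _ rs ltr01) => k [].
have [h hh Uh] := hull_limit apf UU Uk.
have bh := hull_besicovitch_on_U ab apf bf hh.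
exists h => //; apply: (Bclass_closed Gg bh) => sigma sd.
apply/mean_seminorm_eq0/mean_le_inf => e e0; have e2 : 0 < e / 2 by lra.
have [t1 [t2 [rt t1s st2]]] := reduced_around sd.
have [k [[hk [G' G'k /strip_dist_lt[g' [k' [Gg' G'k' gk]]]]] kh]] :=
  filter_ex (filterI (UA _ _ _ rt e2) (Uh _ _ _ rt e2)).
have bg := Bclass_besicovitch Gg; have bg' := Bclass_besicovitch Gg'.
have bk := Bclass_besicovitch G'k; have bk' := Bclass_besicovitch G'k'.
have m f1 f2 : besicovitch_on_U f1 -> besicovitch_on_U f2 ->
    measurableC (fun t => vline f1 sigma t - vline f2 sigma t).
  by move=> b1 b2; apply: measurableCB; exact: besicovitch_on_U_measurable sd.
have n1 := iffLR (mean_seminorm_eq0 _) (Bclass_Beq Gg Gg' sd).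
have n2 := iffLR (mean_seminorm_eq0 _) (Bclass_Beq G'k' G'k sd).
have b1 : mean_le (e / 2) (fun t => vline g' sigma t - vline k' sigma t).
  by apply: mean_le_bounded; [exact: m|exact: ltW|move=> t; apply: gk; exact: strip_vline].
have b2 : mean_le (e / 2) (fun t => vline k sigma t - vline h sigma t).
  by apply: mean_le_bounded; [exact: m|exact: ltW|move=> t; apply: kh; exact: strip_vline].
have c1 : mean_le (0 + e / 2) (fun t => vline g sigma t - vline k' sigma t).
  by apply: (mean_le_sum _ _ _ _ n1 b1); [exact: m..|move=> t; exact: normcBD].
have c2 : mean_le (0 + e / 2) (fun t => vline k' sigma t - vline h sigma t).
  by apply: (mean_le_sum _ _ _ _ n2 b2); [exact: m..|move=> t; exact: normcBD].
have -> : e = (0 + e / 2) + (0 + e / 2) by lra.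
by apply: (mean_le_sum _ _ _ _ c1 c2); [exact: m..|move=> t; exact: normcBD].
Qed.

Lemma compact_hull_classes : compact hull_classes.
Proof.
rewrite compact_ultra => U UU UH.
have /choice[k kP] : forall G, exists k, hull_classes G -> hull f k /\ Bclass G k.
  move=> G; have [[k hk Gk]|n] := pselect (hull_classes G); first by exists k.
  by exists f.
have Uk : U [set G | hull f (k G)] by apply: filterS UH => G /kP[].
have [h hh Uh] := hull_limit apf UU Uk.
have [G HG Gh] := hull_class hh.
exists G; split => // O /nbhs_strip_dist[s1 [s2 [e [rs e0 eO]]]].
have e2 : 0 < e / 2 by lra.
apply: filterS (filterI UH (Uh _ _ _ rs e2)) => G' [/kP[_ G'k] kh].
apply: eO; apply: (@le_lt_trans _ _ (e / 2)%:E); last by rewrite lte_fin; lra.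
by apply: strip_dist_le_sup Gh G'k _ => s ss; rewrite normcB; exact: kh.
Qed.

(** The translate of any function of [F] is in the class of the translate of [f],
    because translation preserves null functions. *)
Lemma closure_vtranslates : closure (vtranslates F) = hull_classes.
Proof.
apply/seteqP; split.
  rewrite closureE => G; apply; split; first exact: closed_hull_classes.
  move=> {}G [tau [g [Fg Gg]]].
  have hf : hull f (vtranslate tau f) by exact: hull_vtranslate.
  exists (vtranslate tau f) => //.
  apply: (Bclass_closed Gg (hull_besicovitch_on_U ab apf bf hf)).
  apply: Beq_vtranslate bf (Bclass_Beq Fg Ff); exact: Bclass_besicovitch Fg.
move=> G [h hh Gh] O /nbhs_strip_dist[s1 [s2 [e [rs e0 eO]]]].
have e2 : 0 < e / 2 by lra.
have [tau tauP] := hh s1 s2 _ rs e2.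
have [G' _ G'f] := hull_class (@hull_vtranslate _ alpha beta f tau).
exists G'; split; first by exists tau, f.
apply: eO; apply: (@le_lt_trans _ _ (e / 2)%:E); last by rewrite lte_fin; lra.
exact: strip_dist_le_sup Gh G'f tauP.
Qed.

Lemma hull_classes_equiv_class : exists (L : exponents R) (S : set (C -> C)),
  is_equiv_class alpha beta L S /\ hull_classes = classes_of S.
Proof.
have [_ [L [a fa]]] := bf.
exists L, [set g | DLambda alpha beta L g /\ equivalent alpha beta L f g]; split.
  by exists f => //; split => //; exists a.
apply/seteqP; split => G.
  move=> [h hh Gh]; exists h => //; exact: hull_equivalent fa hh.
move=> [g [Lg fg] Gg]; have bg := Bclass_besicovitch Gg.
have [h hh hg] := equivalent_hull ab apf bf Lg bg fg.
exists h => //; apply: (Bclass_closed Gg (hull_besicovitch_on_U ab apf bf hh)).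
exact: Beq_sym.
Qed.

End BesicovitchSpace.

Theorem theorem5 (R : realType) (alpha beta : \bar R) (ab : (alpha < beta)%E)
    (F : Bspace ab) :
  in_AP F <->
  compact (closure (vtranslates F)) /\
  exists (L : exponents R) (S : set (R[i] -> R[i])),
    is_equiv_class alpha beta L S /\
    closure (vtranslates F) = classes_of S.
Proof.
split=> [[f Ff apf]|[_ [L [S [[f0 _ ->] clE]]]]].
  rewrite (closure_vtranslates Ff apf); split; first exact: (compact_hull_classes Ff apf).
  exact: (hull_classes_equiv_class Ff apf).
have : closure (vtranslates F) F by apply: subset_closure; exact: vtranslates_self.
by rewrite clE => -[g [[apg _] _] Fg]; exists g.
Qed.
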